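(* Let $h>0$ and $\mu>0$ be fixed real numbers. For each positive integer $q$, let $D_q\subset\mathbb{R}^2$ be the planar domain obtained by attaching to the unit square $Q=[0,1]\times[0,1]$ the $q$ rectangles $T_{q,j}=\left[\frac{j-1}{q},\frac{j-1}{q}+\frac{1}{2q}\right]\times[1,1+h]$, $j=1,\dots,q$, and let $N_{D_q}(\lambda)$ be the number of eigenvalues (counted with multiplicity) of the Dirichlet Laplacian in $D_q$ that are smaller than or equal to $\lambda$. Then, as $q\to\infty$, $$N_{D_q}(\mu q^2)=c(\mu)\,q^2+O(q),$$ where $$c(\mu)=\frac{\mu}{4\pi}+\frac{h}{\pi}\sqrt{\mu}\sum_{l=1}^{[\sqrt{\mu}/(2\pi)]}\sqrt{1-\frac{4\pi^2l^2}{\mu}}.$$ Here $[\cdot]$ denotes the floor of a number (and the sum is zero if $[\sqrt{\mu}/(2\pi)]=0$).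
   Context: $D_q=Q\cup\bigl(\bigcup_{j=1}^q T_{q,j}\bigr)$, where $T_q=[0,1/(2q)]\times[0,h]$ and $T_{q,j}=T_q+((j-1)/q,\,1)$ is the parallel shift of $T_q$ by the vector $((j-1)/q,1)$. The Dirichlet Laplacian in $D_q$ means the operator $-\Delta$ on the open set that is the interior of $D_q$, with zero boundary condition on the boundary (the self-adjoint operator associated with the quadratic form $\int|\nabla u|^2$ on $H^1_0$ of the interior of $D_q$); it has discrete spectrum consisting of positive eigenvalues of finite multiplicity. The numbers $h$ and $\mu$ are independent of $q$, and the constant implied in $O(q)$ may depend on $h$ and $\mu$ but not on $q$. *)

(* Defs.v *)
From HB Require Import structures.
From mathcomp Require Import all_boot all_order all_algebra.
From mathcomp Require Import all_classical all_reals all_analysis.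

Set Implicit Arguments.
Unset Strict Implicit.
Unset Printing Implicit Defensive.

Import Order.TTheory GRing.Theory Num.Theory.
Import numFieldNormedType.Exports.

Local Open Scope classical_set_scope.
Local Open Scope ring_scope.

Definition lebesgue2 (R : realType) :
    {measure set (measurableTypeR R * measurableTypeR R) -> \bar R} :=
  (@lebesgue_measure R \x @lebesgue_measure R)%E.

Definition e1 (R : realType) : R * R := (1, 0).
Definition e2 (R : realType) : R * R := (0, 1).

Fixpoint Cn (R : realType) (n : nat) (f : R * R -> R) : Prop :=
  match n with
  | 0%N => continuous f
  | m.+1 => [/\ forall x, derivable f x (e1 R) /\ derivable f x (e2 R),
                Cn m ('D_(e1 R) f) & Cn m ('D_(e2 R) f)]
  end.

(* C_c^oo(O); a test function is extended by 0 to the whole plane. *)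
Definition test_function (R : realType) (O : set (R * R)) (f : R * R -> R) :=
  [/\ forall n, Cn n f,
      compact (closure [set x | f x != 0])
    & closure [set x | f x != 0] `<=` O].

(* Elements of L^2(O) and H^1_0(O) are represented by functions on the whole
   plane whose values outside O are irrelevant, hence the restrictions. *)
Definition L2norm (R : realType) (O : set (R * R)) (f : R * R -> R) : \bar R :=
  ('N[lebesgue2 R]_(2%:E) [EFin \o (f \_ O)])%E.

Definition L2 (R : realType) (O : set (R * R)) (f : R * R -> R) : Prop :=
  (f \_ O) \in Lfun (lebesgue2 R) 2%:E.

Definition weak_derivative (R : realType) (O : set (R * R)) (v : R * R)
    (u g : R * R -> R) : Prop :=
  forall phi, test_function O phi ->
    \int[lebesgue2 R]_(x in O) (u x * 'D_v phi x) =
    - \int[lebesgue2 R]_(x in O) (g x * phi x).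

(* u belongs to H^1(O), with weak gradient (g1, g2) *)
Definition H1 (R : realType) (O : set (R * R)) (u g1 g2 : R * R -> R) : Prop :=
  [/\ L2 O u, L2 O g1, L2 O g2,
      weak_derivative O (e1 R) u g1 & weak_derivative O (e2 R) u g2].

(* u belongs to H^1_0(O), the closure of C_c^oo(O) in H^1(O), with weak
   gradient (g1, g2) *)
Definition H10 (R : realType) (O : set (R * R)) (u g1 g2 : R * R -> R) : Prop :=
  H1 O u g1 g2 /\
  forall eps : R, 0 < eps -> exists phi,
    [/\ test_function O phi,
        (L2norm O (phi \- u)%R < eps%:E)%E,
        (L2norm O ('D_(e1 R) phi \- g1)%R < eps%:E)%E
      & (L2norm O ('D_(e2 R) phi \- g2)%R < eps%:E)%E].

(* Graph of the self-adjoint operator of L^2(O) associated with the quadratic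
   form \int |grad u|^2 on H^1_0(O): u is in its domain, with image f. *)
Definition dirichlet_laplacian (R : realType) (O : set (R * R))
    (u f : R * R -> R) : Prop :=
  L2 O f /\
  exists g1 g2, H10 O u g1 g2 /\
    forall v h1 h2, H10 O v h1 h2 ->
      \int[lebesgue2 R]_(x in O) (g1 x * h1 x + g2 x * h2 x) =
      \int[lebesgue2 R]_(x in O) (f x * v x).

Definition eigenspace (R : realType) (O : set (R * R)) (lam : R) :
    set (R * R -> R) :=
  [set u | dirichlet_laplacian O u (fun x => lam * u x)].

Definition eigenvalue (R : realType) (O : set (R * R)) (lam : R) : Prop :=
  exists2 u, eigenspace O lam u & ~ (u = cst 0 %[ae lebesgue2 R in O]).

(* linear independence in L^2(O) *)
Definition lin_indep (R : realType) (O : set (R * R)) (k : nat)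
    (u : 'I_k -> R * R -> R) : Prop :=
  forall c : 'I_k -> R,
    (fun x => \sum_(i < k) c i * u i x) = cst 0 %[ae lebesgue2 R in O] ->
    forall i, c i = 0.

(* dimension of the eigenspace, as a subspace of L^2(O) *)
Definition multiplicity (R : realType) (O : set (R * R)) (lam : R) : \bar R :=
  ereal_sup [set k%:R%:E | k in [set k : nat | exists u : 'I_k -> R * R -> R,
    (forall i, eigenspace O lam (u i)) /\ lin_indep O u]].

(* The value is +oo if the count is infinite. *)
Definition counting_function (R : realType) (O : set (R * R)) (lam : R) :
    \bar R :=
  \esum_(nu in [set nu | eigenvalue O nu /\ nu <= lam]) multiplicity O nu.

Definition unit_square (R : realType) : set (R * R) := `[0, 1] `*` `[0, 1].

Definition tooth (R : realType) (h : R) (q j : nat) : set (R * R) :=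
  [set p + ((j%:R - 1) / q%:R, 1) | p in `[0, 1 / (2 * q%:R)] `*` `[0, h]].

Definition comb (R : realType) (h : R) (q : nat) : set (R * R) :=
  @unit_square R `|` \bigcup_(j in [set j | (1 <= j <= q)%N]) tooth h q j.

Definition weyl_const (R : realType) (h mu : R) : R :=
  mu / (4 * pi) +
  h / pi * Num.sqrt mu *
    \sum_(1 <= l < (Num.truncn (Num.sqrt mu / (2 * pi))).+1)
      Num.sqrt (1 - 4 * pi ^+ 2 * l%:R ^+ 2 / mu).

(* Main.v *)
Require Import Defs.
From HB Require Import structures.
From mathcomp Require Import all_boot all_order all_algebra.
From mathcomp Require Import all_classical all_reals all_analysis.
From mathcomp Require Import measurable_realfun ring lra.

Set Implicit Arguments.
Unset Strict Implicit.
Unset Printing Implicit Defensive.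

Import Order.TTheory GRing.Theory Num.Theory.
Import numFieldNormedType.Exports.

Local Open Scope classical_set_scope.
Local Open Scope ring_scope.

(** The count is squeezed between two elementary counts by Dirichlet-Neumann
    bracketing.  Cut the comb along the line y = 1 into the unit square and the
    q teeth, and put L = mu q^2 + 1.

    Upper bound.  Extend a test function by 0 and look at it on one piece, a
    rectangle of width l and height H.  It vanishes on the two vertical sides,
    so each horizontal slice can be expanded in the sine modes of [0, l], with
    wave numbers w = m pi / l.  The modes with w^2 >= L satisfy the inequality
    L int u^2 <= int |grad u|^2 by themselves.  For the finitely many others,
    cut the height into N cells with pi N / H >= sqrt (L - w^2): by the Neumann
    Poincare inequality on each cell, what is missing is controlled by the
    integrals over the cells.  Summing over modes and pieces, on H^1_0 the form
    int |grad u|^2 dominates L int u^2 up to the squares of finitely many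
    functionals (neumann_gap).  A space spanned by eigenfunctions for
    eigenvalues below L cannot contain a nonzero vector killed by all these
    functionals, so their number bounds the counting function
    (eigenvector_family_bound, counting_upper).

    Lower bound.  The products of sines carried by one piece belong to H^1_0,
    and are mutually orthogonal for the mass and for the energy
    (dirichlet_family).  Counting those with energy at most mu q^2 bounds the
    counting function from below, provided that eigenfunctions exist.  They do
    because of the inequality with finitely many functionals just described: it
    makes a minimizing sequence of the Rayleigh quotient, along which the
    functionals converge, a Cauchy sequence (ground_state), and one passes from
    one eigenfunction to the next on the orthogonal complement
    (eigenvectors_exist, counting_lower).

    Asymptotics.  Both counts on a piece are the sum over the modes w < sqrt L
    of (H / pi) sqrt (L - w^2) + O(1), where for the lower one mu q^2 stands
    instead of L (comb_bracket).  On the square, where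
    w = m pi, this sum is, with r = sqrt L / pi, the area of a quarter of the
    disk of radius r up to O(r) (quarter_disk_upper, quarter_disk_lower), that
    is L / (4 pi) + O(q).  In a tooth w = 2 pi q m, so for large q only
    the m with 2 pi m <= sqrt mu contribute, and the q teeth give
    (h / pi) q^2 times the sum of the sqrt (mu - 4 pi^2 m^2), up to O(q). *)

(** * Linear algebra and compactness in finite dimension *)

Lemma kernel_vector (F : fieldType) (I J : finType) (L : I -> J -> F) :
  (#|J| < #|I|)%N ->
  exists2 c : I -> F, exists i, c i != 0 & forall j, \sum_i c i * L i j = 0.
Proof.
move=> JI.
pose M : 'M[F]_(#|I|, #|J|) := \matrix_(i, j) L (enum_val i) (enum_val j).
have : kermx M != 0.
  (* The rank of M is at most #|J|. *)
  rewrite kermx_eq0 /row_free neq_ltn; apply/orP; left.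
  exact: leq_ltn_trans (rank_leq_col _) JI.
move=> /rowV0Pn[v vM v0].
exists (fun i => v 0 (enum_rank i)).
  apply: contrapT => nex; move/eqP : v0; apply; apply/rowP => k; rewrite mxE.
  apply/eqP; apply: contrapT => /negP vk; apply: nex; exists (enum_val k).
  by rewrite enum_valK.
move=> j; move/sub_kermxP : vM => /rowP /(_ (enum_rank j)).
rewrite !mxE => vMj; rewrite -[RHS]vMj.
rewrite (reindex (@enum_val I I)); last first.
  by apply: onW_bij; exact: enum_val_bij.
by apply: eq_bigr => k _; rewrite enum_valK mxE enum_rankK.
Qed.

(** Compactness of a box of R^n, as a cluster point of the sequence. *)
Lemma bounded_family_subsequence (R : realType) (n : nat) (K : R)
    (x : nat -> 'I_n -> R) :
  (forall k j, `|x k j| <= K) ->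
  exists p : 'I_n -> R, forall (e : R) N, 0 < e -> exists2 k, (N <= k)%N &
    forall j, `|x k j - p j| < e.
Proof.
move=> xK.
pose v k : 'rV[R]_n := \row_j x k j.
have := @rV_compact R n (fun=> `[- K, K]%classic) (fun=> @segment_compact R _ _).
move=> /(_ (v @ \oo)); case.
  by exists 0%N => // k _ i; rewrite /= mxE in_itv /= -ler_norml; exact: xK.
move=> p [_ clp]; exists (p ord0) => e N e0.
have [|y [[k /= Nk <-] pk]] := clp [set v k | k in [set k | (N <= k)%N]] (ball p e)
  _
  (nbhsx_ballx _ _ e0).
  by exists N => // k /= Nk; exists k.
exists k => // j.
have := pk.2 ord0 j; rewrite /ball /= mxE distrC; exact.
Qed.

(** * Positive symmetric forms *)

Section Forms.
Context (R : realType) (V : lmodType R).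
Implicit Types (H : V -> Prop) (f a b : V -> V -> R) (u v w : V) (k : R).

Definition subspace H := H 0 /\ forall k u v, H u -> H v -> H (k *: u + v).

Definition positive_form H f :=
  [/\ forall u v, H u -> H v -> f u v = f v u,
      forall k u v w, H u -> H v -> H w -> f (k *: u + v) w = k * f u w + f v w
    & forall u, H u -> 0 <= f u u].

Section OneForm.
Variables (H : V -> Prop) (f : V -> V -> R).
Hypotheses (sH : subspace H) (pf : positive_form H f).

Lemma subspaceB u v : H u -> H v -> H (u - v).
Proof. by move=> Hu Hv; rewrite addrC -scaleN1r; apply: sH.2. Qed.

Lemma subspaceZ k u : H u -> H (k *: u).
Proof. by move=> Hu; rewrite -[_ *: _]addr0; apply: sH.2 => //; exact: sH.1. Qed.

Lemma subspaceD u v : H u -> H v -> H (u + v).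
Proof. by move=> Hu Hv; rewrite -[u]scale1r; apply: sH.2. Qed.

Lemma subspace_sum (I : finType) (P : pred I) (c : I -> R) (u : I -> V) :
  (forall i, H (u i)) -> H (\sum_(i | P i) c i *: u i).
Proof.
move=> Hu; elim/big_rec: _ => [|i v _ Hv]; first exact: sH.1.
exact: sH.2.
Qed.

Lemma form_sym u v : H u -> H v -> f u v = f v u.
Proof. by case: pf => h _ _; exact: h. Qed.

Lemma form_ge0 u : H u -> 0 <= f u u.
Proof. by case: pf => _ _ h; exact: h. Qed.

Lemma form_linl k u v w : H u -> H v -> H w ->
  f (k *: u + v) w = k * f u w + f v w.
Proof. by case: pf => _ h _; exact: h. Qed.

Lemma form0l w : H w -> f 0 w = 0.
Proof.
move=> Hw; have := form_linl (-1) Hw Hw Hw.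
by rewrite scaleN1r addNr => ->; rewrite mulN1r addNr.
Qed.

Lemma formZl k u w : H u -> H w -> f (k *: u) w = k * f u w.
Proof.
move=> Hu Hw; rewrite -[_ *: _]addr0 form_linl ?form0l ?addr0//.
exact: sH.1.
Qed.

Lemma form_suml (I : finType) (P : pred I) (c : I -> R) (u : I -> V) w :
  (forall i, H (u i)) -> H w ->
  f (\sum_(i | P i) c i *: u i) w = \sum_(i | P i) c i * f (u i) w.
Proof.
move=> Hu Hw.
suff: H (\sum_(i | P i) c i *: u i) /\
  f (\sum_(i | P i) c i *: u i) w = \sum_(i | P i) c i * f (u i) w by case.
elim/big_rec2: _ => [|i x y _ [Hy IH]].
  by split; [exact: sH.1|exact: form0l].
by split; [exact: sH.2|rewrite form_linl ?IH].
Qed.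

Lemma form_sumr (I : finType) (P : pred I) (c : I -> R) (u : I -> V) w :
  (forall i, H (u i)) -> H w ->
  f w (\sum_(i | P i) c i *: u i) = \sum_(i | P i) c i * f w (u i).
Proof.
move=> Hu Hw; rewrite form_sym ?form_suml//; last exact: subspace_sum.
by apply: eq_bigr => i _; rewrite (form_sym Hw).
Qed.

Lemma form_quad k u v : H u -> H v ->
  f (k *: u + v) (k *: u + v) = k ^+ 2 * f u u + 2 * k * f u v + f v v.
Proof.
move=> Hu Hv; have Huv : H (k *: u + v) by apply: sH.2.
rewrite form_linl// (form_sym Hu Huv) (form_sym Hv Huv) !form_linl//.
by rewrite (form_sym Hv Hu); ring.
Qed.

Lemma form_quadB u v : H u -> H v ->
  f (u - v) (u - v) = f u u - 2 * f u v + f v v.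
Proof.
move=> Hu Hv; rewrite addrC -scaleN1r form_quad// (form_sym Hv Hu); ring.
Qed.

(** The parallelogram law. *)
Lemma form_distr u v : H u -> H v ->
  f (u - v) (u - v) <= 2 * (f u u + f v v).
Proof.
move=> Hu Hv; have := form_ge0 (subspaceD Hu Hv).
rewrite -{1 2}[u]scale1r form_quad// form_quadB//; lra.
Qed.

(** Positivity of the form on s *: u + v and on - s *: u + v. *)
Lemma form_young s u v : 0 < s -> H u -> H v ->
  `|2 * f u v| <= s * f u u + f v v / s.
Proof.
move=> s0 Hu Hv.
have h (t : R) : t ^+ 2 = 1 -> 0 <= s * f u u + f v v / s + t * (2 * f u v).
  move=> t2; have := form_ge0 (sH.2 (s * t) _ _ Hu Hv).
  rewrite form_quad// exprMn t2 mulr1 => h.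
  rewrite -(pmulr_rge0 _ s0); apply: le_trans h _.
  rewrite le_eqVlt; apply/orP; left; apply/eqP; field.
  by rewrite gt_eqF.
rewrite ler_norml; have := h 1; have := h (-1).
rewrite sqrrN expr1n => /(_ erefl) h1 /(_ erefl) h2.
by apply/andP; split; lra.
Qed.

(** In the preceding inequality the weight of f u u can be taken arbitrarily
    large, because f u u = 0; so that of f v v becomes arbitrarily small. *)
Lemma form_null u v : H u -> H v -> f u u = 0 -> f u v = 0.
Proof.
move=> Hu Hv u0; apply/eqP; rewrite -normr_eq0 eq_le normr_ge0 andbT.
apply/ler_addgt0Pr => e e0.
(* With this weight the term in f v v is less than e. *)
have s0 : 0 < (f v v + 1) / e by rewrite divr_gt0// ltr_wpDl// form_ge0.
have := form_young s0 Hu Hv; rewrite u0 mulr0 add0r normrM ger0_norm// => h.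
have : f v v / ((f v v + 1) / e) <= e.
  rewrite invf_div mulrA ler_pdivrMr ?ltr_wpDl ?form_ge0//.
  by rewrite mulrDr mulr1 mulrC lerDl ltW.
have := normr_ge0 (f u v); lra.
Qed.

Lemma form_CS u v : H u -> H v -> f u v ^+ 2 <= f u u * f v v.
Proof.
move=> Hu Hv; have := form_ge0 Hv; rewrite le_eqVlt => /orP[/eqP v0|v0].
  by rewrite -v0 mulr0 (form_sym Hu)// form_null// expr0n.
(* Positivity on the part of u that is orthogonal to v. *)
have := form_ge0 (sH.2 (- (f u v / f v v)) _ _ Hv Hu); rewrite form_quad//.
rewrite (form_sym Hv Hu) => h; rewrite -subr_ge0 -(pmulr_lge0 _ (_ : 0 < (f v v)^-1)) ?invr_gt0//.
apply: le_trans h _; rewrite le_eqVlt; apply/orP; left; apply/eqP; field.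
by rewrite gt_eqF.
Qed.

Lemma form_close w (e : R) : H w -> 0 < e -> exists2 d, 0 < d &
  forall u, H u -> f (u - w) (u - w) < d -> `|f u u - f w w| < e.
Proof.
move=> Hw e0; have w0 := form_ge0 Hw.
pose s := 3 * (f w w + 1) / e.
have s0 : 0 < s by rewrite divr_gt0// mulr_gt0// ltr_wpDl.
exists (e / 3 / (1 + s)); first by rewrite !divr_gt0// addr_gt0.
move=> u Hu ud; have Hd : H (u - w) by exact: subspaceB.
have E : f u u = f (u - w) (u - w) + 2 * f (u - w) w + f w w.
  by have := form_quad 1 Hd Hw; rewrite scale1r subrK => ->; ring.
have := form_young s0 Hd Hw.
have : f w w / s <= e / 3.
  rewrite /s invf_div mulrA ler_pdivrMr; last by rewrite mulr_gt0// ltr_wpDl.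
  have : 0 <= e * (f w w) by rewrite mulr_ge0// ltW.
  by lra.
have : (1 + s) * f (u - w) (u - w) < e / 3.
  by rewrite mulrC -ltr_pdivlMr ?addr_gt0.
have := form_ge0 Hd.
set x := f (u - w) (u - w) in E *; set y := f (u - w) w in E *.
move=> x0 h3 h4 /ler_normlP[h5 h6].
apply/ltr_normlP; split; lra.
Qed.

Lemma form_lim_eq (c : R) w : H w ->
  (forall e : R, 0 < e -> exists u, [/\ H u, f (u - w) (u - w) < e &
     `|f u u - c| < e]) -> f w w = c.
Proof.
move=> Hw h; apply/eqP; rewrite -subr_eq0 -normr_eq0 eq_le normr_ge0 andbT.
apply/ler_addgt0Pr => e e0; rewrite add0r.
have [d d0 dP] := form_close Hw (divr_gt0 e0 (ltr0n R 2)).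
have [|u [Hu ud uc]] := h (Num.min d (e / 2)).
  by rewrite lt_min d0 divr_gt0.
have := dP u Hu (lt_le_trans ud _); rewrite ge_min lexx => /(_ isT) h1.
have h2 : `|f u u - c| < e / 2.
  by apply: (lt_le_trans uc); rewrite ge_min lexx orbT.
have -> : f w w - c = (f u u - c) - (f u u - f w w) by ring.
apply: le_trans (ler_normB _ _) _; move: h1 h2; lra.
Qed.

End OneForm.
End Forms.

(** * Eigenvectors below a spectral gap *)

Section Spectral.
Context (R : realType) (V : lmodType R).
Variables (a b : V -> V -> R).

(** Completeness of H for the norm given by a + b: in other words, a is closed. *)
Definition complete_for (H : V -> Prop) :=
  forall u : nat -> V, (forall n, H (u n)) ->
  (forall e : R, 0 < e -> exists N, forall m n, (N <= m)%N -> (N <= n)%N ->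
     a (u m - u n) (u m - u n) + b (u m - u n) (u m - u n) < e) ->
  exists2 w, H w & forall e : R, 0 < e -> exists N, forall n, (N <= n)%N ->
     a (u n - w) (u n - w) + b (u n - w) (u n - w) < e.

(** On the common kernel of the functionals l the form a is at least L times b;
    off this kernel the defect is controlled by the values of l.  It leaves
    room for at most #|J| eigenvalues below L. *)
Definition gap_inequality (H : V -> Prop) (L : R) (J : finType)
    (l : J -> V -> R) :=
  [/\ forall j k u v, H u -> H v -> l j (k *: u + v) = k * l j u + l j v,
      exists K, forall j u, H u -> l j u ^+ 2 <= K * b u u
    & exists2 C, 0 <= C & forall u, H u ->
        L * b u u <= a u u + C * \sum_j l j u ^+ 2].

(** Minimize a under the constraint b u u = 1, and let nu be the infimum.  The
    form q = a - nu b is positive, and small along a minimizing sequence, hence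
    by the parallelogram law also on differences of its terms.  Along a
    subsequence on which the functionals l converge, the gap inequality, where
    L - nu > 0, then makes the b-norm of these differences small.  The limit e
    has q e e = 0, and the Cauchy-Schwarz inequality for q turns this into the
    eigenvalue equation. *)
Lemma ground_state (H : V -> Prop) (n : nat) (l : 'I_n -> V -> R) (L lam : R) :
  subspace H -> positive_form H a -> positive_form H b ->
  complete_for H -> gap_inequality H L l -> lam < L ->
  (exists w, [/\ H w, 0 < b w w & a w w <= lam * b w w]) ->
  exists e nu, [/\ H e, b e e = 1, nu <= lam &
    forall v, H v -> a e v = nu * b e v].
Proof.
move=> sH pa pb cH [ll [K lK] [C C0 lC]] lamL [w [Hw bw aw]].
pose S := [set a u u | u in [set u | H u /\ b u u = 1]].
have scale u : H u -> 0 < b u u -> S (a u u / b u u).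
  move=> Hu bu; exists ((Num.sqrt (b u u))^-1 *: u).
    split; first exact: subspaceZ.
    have Hs : H ((Num.sqrt (b u u))^-1 *: u) by exact: subspaceZ.
    rewrite (formZl sH pb)// (form_sym pb Hu Hs) (formZl sH pb)// mulrA.
    by rewrite -expr2 exprVn sqr_sqrtr ?ltW// mulVf ?gt_eqF.
  have Hs : H ((Num.sqrt (b u u))^-1 *: u) by exact: subspaceZ.
  rewrite (formZl sH pa)// (form_sym pa Hu Hs) (formZl sH pa)// mulrA.
  by rewrite -expr2 exprVn sqr_sqrtr ?ltW// mulrC.
have Slb : lbound S 0 by move=> _ [u [Hu _] <-]; exact: (form_ge0 pa).
have hS : has_inf S by split; [exists (a w w / b w w); exact: scale|exists 0].
pose nu := inf S.
have nulam : nu <= lam.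
  apply: le_trans (ge_inf hS.2 (scale _ Hw bw)) _.
  by rewrite ler_pdivrMr.
have q0 u : H u -> 0 <= a u u - nu * b u u.
  move=> Hu; have := form_ge0 pb Hu; rewrite le_eqVlt => /orP[/eqP<-|bu].
    by rewrite mulr0 subr0 (form_ge0 pa).
  by rewrite subr_ge0 -ler_pdivlMr//; apply: ge_inf (scale _ Hu bu); exact: hS.2.
have nu0 : 0 <= nu by apply: lb_le_inf => //; exact: hS.1.
(* nu is an infimum, so this form is positive. *)
pose q u v := a u v - nu * b u v.
have pq : positive_form H q.
  split => [u v Hu Hv|k u v x Hu Hv Hx|u Hu]; last exact: q0.
  - by rewrite /q (form_sym pa Hu Hv) (form_sym pb Hu Hv).
  - by rewrite /q (form_linl pa)// (form_linl pb)//; ring.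
pose r (k : nat) : R := k.+1%:R^-1.
have r0 k : 0 < r k by rewrite invr_gt0.
have [u uP] : exists u : nat -> V, forall k,
    [/\ H (u k), b (u k) (u k) = 1 & q (u k) (u k) < r k].
  have h k : exists v, [/\ H v, b v v = 1 & q v v < r k].
    have [_ [v [Hv bv] <-] vk] := inf_adherent (r0 k) hS.
    by exists v; split => //; rewrite /q bv mulr1 ltrBlDl.
  by exists (fun k => projT1 (cid (h k))) => k; case: (cid (h k)).
have Hu k : H (u k) by case: (uP k).
have bu k : b (u k) (u k) = 1 by case: (uP k).
have qu k : q (u k) (u k) < r k by case: (uP k).
have [p pP] : exists p : 'I_n -> R, forall (e : R) N, 0 < e ->
    exists2 k, (N <= k)%N & forall j, `|l j (u k) - p j| < e.
  apply: (@bounded_family_subsequence _ _ (1 + K) (fun k j => l j (u k))) => k j.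
  have := lK j _ (Hu k); rewrite bu mulr1 -real_normK ?num_real// => h.
  have [h1|h1] := leP `|l j (u k)| 1.
    apply: le_trans h1 _; rewrite lerDl.
    by apply: le_trans h; exact: sqr_ge0.
  apply: (@le_trans _ _ (`|l j (u k)| ^+ 2)); last by apply: le_trans h _; rewrite lerDr.
  by rewrite expr2 ler_peMl// ltW.
have [g gP] : exists g : nat -> nat, forall k, (k <= g k)%N /\
    forall j, `|l j (u (g k)) - p j| < r k.
  have h k : exists m, (k <= m)%N /\ forall j, `|l j (u m) - p j| < r k.
    have [m km mP] := pP _ k (r0 k).
    by exists m.
  by exists (fun k => projT1 (cid (h k))) => k; case: (cid (h k)).
have inv_le (N m : nat) : (N <= m)%N -> r m <= r N.
  by move=> Nm; rewrite /r lef_pV2 ?posrE ?ltr0n// ler_nat ltnS.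
have LL : 0 < L - nu by rewrite subr_gt0; exact: le_lt_trans lamL.
(* From q on differences to b on differences, by the gap inequality. *)
have dist N m k : (N <= m)%N -> (N <= k)%N ->
    q (u (g m) - u (g k)) (u (g m) - u (g k)) <= 4 * r N /\
    b (u (g m) - u (g k)) (u (g m) - u (g k)) <=
      (4 + 4 * C * n%:R) * r N / (L - nu).
  move=> Nm Nk.
  have qN i : (N <= i)%N -> q (u (g i)) (u (g i)) <= r N.
    move=> Ni; apply: ltW; apply: lt_le_trans (qu _) _.
    by apply: inv_le; apply: leq_trans Ni _; case: (gP i).
  have Hd : H (u (g m) - u (g k)) by exact: subspaceB.
  have hq : q (u (g m) - u (g k)) (u (g m) - u (g k)) <= 4 * r N.
    apply: le_trans (form_distr sH pq _ _) _ => //.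
    by have := qN _ Nm; have := qN _ Nk; lra.
  split=> //; rewrite ler_pdivlMr//.
  have hl j : l j (u (g m) - u (g k)) ^+ 2 <= 4 * r N.
    have -> : l j (u (g m) - u (g k)) = l j (u (g m)) - l j (u (g k)).
      by rewrite -[u (g m) - _]addrC -scaleN1r ll// mulN1r addrC.
    have /ltW hm := (gP m).2 j; have /ltW hk := (gP k).2 j.
    have h2 : `|l j (u (g m)) - l j (u (g k))| <= 2 * r N.
      have -> : l j (u (g m)) - l j (u (g k)) =
         (l j (u (g m)) - p j) - (l j (u (g k)) - p j) by ring.
      apply: le_trans (ler_normB _ _) _.
      by have := inv_le _ _ Nm; have := inv_le _ _ Nk; lra.
    rewrite -real_normK ?num_real//.
    apply: le_trans (_ : (2 * r N) ^+ 2 <= _).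
      by rewrite ler_pXn2r// nnegrE ?mulr_ge0// ltW.
    rewrite exprMn expr2 -natrM ler_wpM2l// expr2 ler_piMl//; first exact: ltW.
    by rewrite invf_le1 ?ler1n.
  have hs : \sum_j l j (u (g m) - u (g k)) ^+ 2 <= n%:R * (4 * r N).
    apply: le_trans (ler_sum _ (fun j _ => hl j)) _.
    by rewrite sumr_const card_ord -[leLHS]mulr_natl.
  have := lC _ Hd; have := ler_wpM2l C0 hs; rewrite /q in hq; lra.
have [|e He eP] := cH (fun k => u (g k)) (fun k => Hu _).
  move=> eps eps0.
  (* a + b = q + (1 + nu) b, so A bounds a + b on differences, in units of r N. *)
  pose A := 4 + (1 + nu) * ((4 + 4 * C * n%:R) / (L - nu)).
  have A0 : 0 < A.
    rewrite ltr_pwDl//; apply: mulr_ge0; first exact: addr_ge0.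
    by apply: divr_ge0; rewrite ?(ltW LL)// addr_ge0// !mulr_ge0.
  have [N NP] : exists N : nat, A / eps < N%:R.
    by exists (Num.bound (A / eps)); apply: archi_boundP; rewrite divr_ge0// ltW.
  exists N => m k Nm Nk; have [h1 h2] := dist _ _ _ Nm Nk.
  apply: (@le_lt_trans _ _ (A * r N)).
    have hb : 0 <= 1 + nu by rewrite addr_ge0.
    have := ler_wpM2l hb h2; move: h1; rewrite /q /A; lra.
  rewrite /r ltr_pdivrMr ?ltr0n// mulrC -ltr_pdivrMr//.
  by apply: lt_le_trans NP _; rewrite ler_nat.
have Hdk k : H (u (g k) - e) by exact: subspaceB.
have be : b e e = 1.
  apply: (form_lim_eq sH pb) => // eps eps0; have [N NP] := eP _ eps0.
  exists (u (g N)); split => //; last by rewrite bu subrr normr0.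
  by apply: le_lt_trans (NP N _) => //; rewrite lerDr (form_ge0 pa).
have qe : q e e = 0.
  apply: (form_lim_eq sH pq) => // eps eps0; have [N NP] := eP _ eps0.
  have [M MP] : exists M : nat, eps^-1 < M%:R.
    by exists (Num.bound eps^-1); apply: archi_boundP; rewrite invr_ge0 ltW.
  exists (u (g (maxn N M))); split => //.
    apply: le_lt_trans (NP _ (leq_maxl _ _)).
    rewrite /q lerD// -mulNr; have := form_ge0 pb (Hdk (maxn N M)).
    by have : 0 <= nu * b (u (g (maxn N M)) - e) (u (g (maxn N M)) - e);
      [rewrite mulr_ge0//; exact: (form_ge0 pb)|lra].
  rewrite subr0 ger0_norm ?(form_ge0 pq)//.
  apply: lt_le_trans (qu _) _.
  apply: (@le_trans _ _ (r M)).
    by apply: inv_le; apply: leq_trans (gP _).1; exact: leq_maxr.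
  rewrite /r -[eps]invrK lef_pV2 ?posrE ?invr_gt0 ?ltr0n//.
  by apply: ltW; apply: lt_le_trans MP _; rewrite ler_nat.
exists e, nu; split => // v Hv.
by have := form_null sH pq He Hv qe; rewrite /q => /eqP; rewrite subr_eq0 => /eqP.
Qed.

Definition eigenpair (H : V -> Prop) (e : V) (nu : R) :=
  H e /\ forall v, H v -> a e v = nu * b e v.

(** Induction on the number k of eigenvectors found so far.  On the subspace of
    the vectors that are b-orthogonal to them the hypotheses persist, and k
    linear conditions cannot exclude all the combinations of more than k
    vectors w, so there is a trial vector for the next minimization. *)
Lemma eigenvectors_exist (H : V -> Prop) (n : nat) (l : 'I_n -> V -> R)
    (L lam : R) (I : finType) (w : I -> V) :
  subspace H -> positive_form H a -> positive_form H b ->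
  complete_for H -> gap_inequality H L l -> lam < L ->
  (forall i, [/\ H (w i), 0 < b (w i) (w i) & a (w i) (w i) <= lam * b (w i) (w i)]) ->
  (forall i j, i != j -> a (w i) (w j) = 0 /\ b (w i) (w j) = 0) ->
  exists (e : 'I_#|I| -> V) (nu : 'I_#|I| -> R),
    (forall i, eigenpair H (e i) (nu i) /\ nu i <= lam) /\
    forall i j, b (e i) (e j) = (i == j)%:R.
Proof.
move=> sH pa pb cH gH lamL w1 w2.
suff: forall k, (k <= #|I|)%N -> exists (e : nat -> V) (nu : nat -> R),
    (forall i, (i < k)%N -> eigenpair H (e i) (nu i) /\ nu i <= lam) /\
    forall i j, (i < k)%N -> (j < k)%N -> b (e i) (e j) = (i == j)%:R.
  move=> /(_ #|I| (leqnn _)) [e [nu [h1 h2]]].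
  exists (e \o val), (nu \o val); split=> [i|i j] /=; first exact: h1.
  by rewrite h2.
elim=> [_|k IH kI]; first by exists (fun=> 0), (fun=> 0).
have [e [nu [e1 e2]]] := IH (ltnW kI).
have He i : (i < k)%N -> H (e i) by move=> /e1[[]].
(* The orthogonal complement of the eigenvectors already found. *)
pose H' v := H v /\ forall i, (i < k)%N -> b v (e i) = 0.
have H'H v : H' v -> H v by case.
have sH' : subspace H'.
  split=> [|c u v [Hu hu] [Hv hv]]; split.
  - exact: sH.1.
  - by move=> i ik; rewrite (form0l pb)//; exact: He.
  - exact: sH.2.
  - move=> i ik; rewrite (form_linl pb)//; last exact: He.
    by rewrite hu// hv// mulr0 addr0.
have sub_form f : positive_form H f -> positive_form H' f.
  by case=> h1 h2 h3; split=> [u v [? _] [? _]|c u v x [? _] [? _] [? _]|u [? _]];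
    [exact: h1|exact: h2|exact: h3].
have cH' : complete_for H'.
  move=> u Hu cu; have [v Hv uv] := cH u (fun n => (Hu n).1) cu.
  exists v => //; split=> // i ik; apply/eqP; rewrite -normr_eq0.
  rewrite eq_le normr_ge0 andbT; apply/ler_addgt0Pr => eps eps0.
  have [N /(_ N (leqnn _)) NP] := uv (eps ^+ 2) (exprn_gt0 _ eps0).
  have HuN := (Hu N).1; have Hd : H (u N - v) by exact: subspaceB.
  have -> : b v (e i) = - b (u N - v) (e i).
    rewrite -{1}[v](subKr (u N)) -[u N - (_ - _)]addrC -scaleN1r (form_linl pb)//.
    - by rewrite (Hu N).2// addr0 mulN1r.
    - exact: He.
  have := form_young sH pb (s := eps^-1) (ltac:(by rewrite invr_gt0)) Hd (He _ ik).
  rewrite normrN e2// eqxx invrK mul1r normrM ger0_norm//.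
  have h : b (u N - v) (u N - v) <= eps ^+ 2.
    apply: ltW; apply: le_lt_trans NP; rewrite lerDr; exact: (form_ge0 pa).
  have : eps^-1 * b (u N - v) (u N - v) <= eps.
    by rewrite mulrC ler_pdivrMr// -expr2.
  lra.
have gH' : gap_inequality H' L l.
  case: gH => g1 [K g2] [C C0 g3]; split.
  - by move=> j c u v [? _] [? _]; exact: g1.
  - by exists K => j u [? _]; exact: g2.
  - by exists C => // u [? _]; exact: g3.
have trial : exists v, [/\ H' v, 0 < b v v & a v v <= lam * b v v].
  have Ik : (#|'I_k| < #|I|)%N by rewrite card_ord.
  have [c [i0 ci0] c0] := kernel_vector (fun i (j : 'I_k) => b (w i) (e j)) Ik.
  have Hw i : H (w i) by case: (w1 i).
  pose W := \sum_i c i *: w i.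
  have HW : H W by exact: subspace_sum.
  have diag f : positive_form H f -> (forall i j, i != j -> f (w i) (w j) = 0) ->
      f W W = \sum_i c i ^+ 2 * f (w i) (w i).
    move=> pf fo; rewrite (form_suml sH pf)//; apply: eq_bigr => i _.
    rewrite (form_sumr sH pf)// (bigD1 i)//= big1 ?addr0 => [|j ji].
      by rewrite expr2 mulrA.
    by rewrite fo ?mulr0// eq_sym.
  exists W; split.
  - split=> // i ik; rewrite (form_suml sH pb)//; last exact: He.
    exact: (c0 (Ordinal ik)).
  - rewrite diag => [|//|i j /w2[]//].
    rewrite (bigD1 i0)//= ltr_pwDl//.
      by rewrite mulr_gt0 ?exprn_even_gt0//; case: (w1 i0).
    by apply: sumr_ge0 => i _; rewrite mulr_ge0 ?sqr_ge0// (form_ge0 pb).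
  - rewrite !diag//; [|by move=> i j /w2[]|by move=> i j /w2[]].
    rewrite mulr_sumr; apply: ler_sum => i _; rewrite mulrCA.
    by rewrite ler_wpM2l ?sqr_ge0//; case: (w1 i).
have [x [nux [Hx bx nuxlam xP]]] := ground_state sH' (sub_form _ pa)
    (sub_form _ pb) cH' gH' lamL trial.
have Hxx : H x by case: Hx.
have bxe i : (i < k)%N -> b x (e i) = 0 by move=> ik; exact: Hx.2.
have axe i : (i < k)%N -> a x (e i) = 0.
  move=> ik; rewrite (form_sym pa)//; last exact: He.
  have [[_ ->//] _] := e1 _ ik.
  by rewrite (form_sym pb) ?bxe ?mulr0//; exact: He.
have xeig : eigenpair H x nux.
  (* The equation holds on the complement, and for e 0, ..., e (k - 1) both sides
     vanish. *)
  split=> // v Hv; pose p := \sum_(j < k) b v (e j) *: e j.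
  have Hp : H p by apply: subspace_sum => // j; exact: He.
  have H'd : H' (v - p).
    split=> [|i ik]; first exact: subspaceB.
    rewrite -[v - p]addrC -scaleN1r (form_linl pb)//; last exact: He.
    rewrite (form_suml sH pb)//; [|by move=> j; exact: He|exact: He].
    rewrite (bigD1 (Ordinal ik))//= big1 => [|j ji].
      by rewrite e2// eqxx mulr1 addr0 mulN1r addNr.
    by rewrite e2// (_ : (j == i :> nat) = false) ?mulr0//; apply/negbTE.
  have split_form f : positive_form H f -> (forall i, (i < k)%N -> f x (e i) = 0) ->
      f x v = f x (v - p).
    move=> pf fe; rewrite -[in LHS](subrK p v) -[v - p]scale1r.
    rewrite (form_sym pf)//; last first.
      by rewrite scale1r; apply: subspaceD => //; exact: subspaceB.
    rewrite (form_linl pf)//; last exact: subspaceB.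
    rewrite mul1r scale1r (form_sym pf Hp)// (form_sumr sH pf)//; last by move=> j; exact: He.
    rewrite big1 ?addr0 => [|j _]; last by rewrite fe ?mulr0.
    by rewrite (form_sym pf)//; exact: subspaceB.
  by rewrite (split_form a)// (split_form b)// xP.
exists (fun i => if i == k then x else e i), (fun i => if i == k then nux else nu i).
split=> [i|i j].
  by rewrite ltnS leq_eqVlt; case: (eqVneq i k) => [_ _|_ /= ik]; [|exact: e1].
rewrite !ltnS (leq_eqVlt i) (leq_eqVlt j).
case: (eqVneq i k) => [->|ik]; case: (eqVneq j k) => [->|jk] /=.
- by rewrite bx.
- by move=> _ jk'; rewrite bxe.
- move=> ik' _; rewrite (form_sym pb)//; last exact: He.
  by rewrite bxe// (negbTE ik).
- exact: e2.
Qed.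

(** If there were more than n eigenvectors, some nonzero combination U of them
    would be killed by all the functionals.  Eigenvectors for distinct
    eigenvalues are orthogonal for both forms, hence a U U <= lam * b U U, and
    the gap inequality gives L * b U U <= a U U with L > lam. *)
Lemma eigenvector_family_bound (H : V -> Prop) (n : nat) (l : 'I_n -> V -> R)
    (L lam : R) (K : finType) (nu : K -> R) (m : K -> nat)
    (u : forall k, 'I_(m k) -> V) :
  subspace H -> positive_form H a -> positive_form H b ->
  gap_inequality H L l -> lam < L -> injective nu ->
  (forall k i, eigenpair H (u k i) (nu k)) -> (forall k, nu k <= lam) ->
  (forall k (c : 'I_(m k) -> R),
     b (\sum_i c i *: u k i) (\sum_i c i *: u k i) = 0 -> forall i, c i = 0) ->
  (\sum_k m k <= n)%N.
Proof.
move=> sH pa pb [ll _ [C C0 lC]] lamL nuI ue nulam ufree.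
have Hu k i : H (u k i) by case: (ue k i).
rewrite leqNgt; apply/negP => nm.
have card : #|{: {k : K & 'I_(m k)}}| = (\sum_k m k)%N.
  rewrite card_tagged sumnE big_map big_enum /=.
  by apply: eq_bigr => k _; rewrite card_ord.
have Ik : (#|'I_n| < #|{: {k : K & 'I_(m k)}}|)%N by rewrite card_ord card.
have [c [[k0 i0] ck0] c0] :=
  kernel_vector (fun (p : {k : K & 'I_(m k)}) j => l j (u (tag p) (tagged p))) Ik.
pose W k := \sum_i c (Tagged (fun k => 'I_(m k)) i) *: u k i.
have HW k : H (W k) by exact: subspace_sum.
pose U := \sum_k 1 *: W k.
have HU : H U by exact: subspace_sum.
have l0 j : l j 0 = 0.
  by have := ll j (-1) 0 0 sH.1 sH.1; rewrite scaler0 addr0 mulN1r addNr.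
have lsum (I : finType) (d : I -> R) (v : I -> V) j : (forall i, H (v i)) ->
    l j (\sum_i d i *: v i) = \sum_i d i * l j (v i).
  move=> Hv; suff: H (\sum_i d i *: v i) /\
     l j (\sum_i d i *: v i) = \sum_i d i * l j (v i) by case.
  elim/big_rec2: _ => [|i x y _ [Hy IH]]; first by split; [exact: sH.1|].
  by split; [exact: sH.2|rewrite ll ?IH].
have lU j : l j U = 0.
  rewrite lsum//; under eq_bigr do rewrite mul1r lsum//.
  rewrite -[RHS](c0 j).
  rewrite (sig_big_dep (fun=> true) (fun k i => true)
    (fun k i => c (Tagged (fun k => 'I_(m k)) i) * l j (u k i))) /=.
  by apply: eq_big => // -[].
have aW k v : H v -> a (W k) v = nu k * b (W k) v.
  move=> Hv; rewrite (form_suml sH pa)// (form_suml sH pb)// mulr_sumr.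
  by apply: eq_bigr => i _; rewrite (ue k i).2// mulrCA.
have bW k k' : k != k' -> b (W k) (W k') = 0.
  move=> kk'; have h : (nu k - nu k') * b (W k) (W k') = 0.
    rewrite mulrBl -aW// (form_sym pb (HW k))// -aW// (form_sym pa (HW k))//.
    by rewrite subrr.
  move/eqP : h; rewrite mulf_eq0 subr_eq0 => /orP[/eqP/nuI/eqP|/eqP//].
  by rewrite (negbTE kk').
have bWU k : b (W k) U = b (W k) (W k).
  rewrite (form_sumr sH pb)// (bigD1 k)//= big1 ?addr0 ?mul1r// => k' kk'.
  by rewrite bW ?mulr0// eq_sym.
have bU : b U U = \sum_k b (W k) (W k).
  by rewrite (form_suml sH pb)//; apply: eq_bigr => k _; rewrite mul1r bWU.
have aU : a U U <= lam * b U U.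
  rewrite bU (form_suml sH pa)// mulr_sumr; apply: ler_sum => k _.
  by rewrite mul1r aW// bWU ler_wpM2r// (form_ge0 pb).
have bU0 : 0 < b U U.
  rewrite lt_neqAle (form_ge0 pb)// andbT eq_sym; apply: contraNneq ck0 => b0.
  have : b (W k0) (W k0) == 0.
    move: b0; rewrite bU => /eqP; rewrite psumr_eq0; last first.
      by move=> k _; exact: (form_ge0 pb).
    by move=> /allP/(_ k0); rewrite mem_index_enum; exact.
  by move=> /eqP/ufree/(_ i0)/eqP.
have := lC _ HU; rewrite big1 ?mulr0 ?addr0 => [|j _]; last by rewrite lU expr0n.
by apply/negP; rewrite -ltNge; apply: le_lt_trans aU _; rewrite ltr_pM2r.
Qed.

End Spectral.

(** * Derivatives, continuity and integrals in one variable *)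

Section Calculus.
Context {R : realType}.
Implicit Types (f g F : R -> R) (x a b c k : R).

(** The rules of calculus for an explicit abstraction, which is what proof search
    can unify with. *)
Lemma derM f g x df dg : is_derive x 1 f df -> is_derive x 1 g dg ->
  is_derive x 1 (fun y => f y * g y) (df * g x + f x * dg).
Proof.
move=> hf hg; have := is_deriveM hf hg.
by move/is_derive_eq; apply; rewrite /GRing.scale /= addrC mulrC.
Qed.

Lemma derD f g x df dg : is_derive x 1 f df -> is_derive x 1 g dg ->
  is_derive x 1 (fun y => f y + g y) (df + dg).
Proof. by move=> hf hg; exact: is_deriveD. Qed.

Lemma derB f g x df dg : is_derive x 1 f df -> is_derive x 1 g dg ->
  is_derive x 1 (fun y => f y - g y) (df - dg).
Proof. by move=> hf hg; exact: is_deriveB. Qed.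

Lemma derN f x df : is_derive x 1 f df -> is_derive x 1 (fun y => - f y) (- df).
Proof. by move=> hf; exact: is_deriveN. Qed.

Lemma derC c x : is_derive x 1 (fun _ : R => c) 0.
Proof. exact: is_derive_cst. Qed.

Lemma derI x : is_derive x 1 (fun y : R => y) 1.
Proof. exact: is_derive_id. Qed.

Lemma der_comp f g x df dg : is_derive (g x) 1 f df -> is_derive x 1 g dg ->
  is_derive x 1 (fun y => f (g y)) (df * dg).
Proof. by move=> hf hg; exact: is_derive1_comp. Qed.

Lemma derV g x dg : g x != 0 -> is_derive x 1 g dg ->
  is_derive x 1 (fun y => (g y)^-1) (- dg / g x ^+ 2).
Proof.
move=> gx hg; have := is_deriveV gx hg.
by move/is_derive_eq; apply; rewrite /GRing.scale /= mulNr mulrC mulNr.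
Qed.

Lemma der_cont f x df : is_derive x 1 f df -> {for x, continuous f}.
Proof.
by move=> [h _]; apply: differentiable_continuous; exact/derivable1_diffP.
Qed.

Lemma derE f x df : is_derive x 1 f df -> derive1 f x = df.
Proof. by move=> [_ <-]; rewrite derive1E. Qed.

End Calculus.

Ltac der_step := first
  [ match goal with H : is_derive _ _ _ _ |- _ => notypeclasses refine H end
  | notypeclasses refine (derI _) | notypeclasses refine (derC _ _)
  | notypeclasses refine (derN _) | notypeclasses refine (derB _ _)
  | notypeclasses refine (derM _ _) | notypeclasses refine (derD _ _)
  | notypeclasses refine (der_comp (is_derive_sin _) _)
  | notypeclasses refine (der_comp (is_derive_cos _) _) ].

(** Proves a derivative by structural recursion, with the derivatives of the
    building blocks taken from the context, and leaves the equation between the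
    derivative found and the one announced. *)
Ltac der := notypeclasses refine (is_derive_eq _ _); [ solve [repeat der_step] | cbv beta ].

Section Continuity.
Context {R : realType}.
Implicit Types (f g : R -> R) (x c : R).

Lemma contM f g x : {for x, continuous f} -> {for x, continuous g} ->
  {for x, continuous (fun y => f y * g y)}.
Proof. by move=> hf hg; exact: continuousM. Qed.

Lemma contD f g x : {for x, continuous f} -> {for x, continuous g} ->
  {for x, continuous (fun y => f y + g y)}.
Proof. by move=> hf hg; exact: continuousD. Qed.

Lemma contN f x : {for x, continuous f} -> {for x, continuous (fun y => - f y)}.
Proof. by move=> hf; exact: continuousN. Qed.

Lemma contB f g x : {for x, continuous f} -> {for x, continuous g} ->
  {for x, continuous (fun y => f y - g y)}.
Proof. by move=> hf hg; exact: continuousB. Qed.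

Lemma contC c x : {for x, continuous (fun _ : R => c)}.
Proof. exact: cst_continuous. Qed.

Lemma contI x : {for x, continuous (fun y : R => y)}.
Proof. exact: cvg_id. Qed.

Lemma contX f x n : {for x, continuous f} ->
  {for x, continuous (fun y => f y ^+ n)}.
Proof.
by move=> hf; apply: (@continuous_comp _ _ _ f (fun y => y ^+ n)) => //; exact: exprn_continuous.
Qed.

Lemma cont_sin f x : {for x, continuous f} -> {for x, continuous (fun y => sin (f y))}.
Proof. by move=> hf; apply: continuous_comp => //; exact: continuous_sin. Qed.

Lemma cont_cos f x : {for x, continuous f} -> {for x, continuous (fun y => cos (f y))}.
Proof. by move=> hf; apply: continuous_comp => //; exact: continuous_cos. Qed.

Lemma cont_sum (I : Type) (r : seq I) (P : pred I) (f : I -> R -> R) x :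
  (forall i, {for x, continuous (f i)}) ->
  {for x, continuous (fun y => \sum_(i <- r | P i) f i y)}.
Proof.
move=> h; rewrite -fct_sumE.
by elim/big_rec: _ => [|i z _ IH]; [exact: contC|exact: contD].
Qed.

End Continuity.

Ltac cont_step := lazymatch goal with
  | |- @prop_for _ _ (fun z => @continuous_at _ _ z (fun y => @Algebra.add _ (@?f y) (@Algebra.opp _ (@?g y)))) _ =>
      refine (contB _ _)
  | |- @prop_for _ _ (fun z => @continuous_at _ _ z (fun y => @Algebra.add _ (@?f y) (@?g y))) _ =>
      refine (contD _ _)
  | |- @prop_for _ _ (fun z => @continuous_at _ _ z (fun y => @GRing.mul _ (@?f y) (@?g y))) _ =>
      refine (contM _ _)
  | |- @prop_for _ _ (fun z => @continuous_at _ _ z (fun y => @GRing.exp _ (@?f y) ?n)) _ =>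
      refine (contX _)
  | |- @prop_for _ _ (fun z => @continuous_at _ _ z (fun y => @Algebra.opp _ (@?f y))) _ =>
      refine (contN _)
  | |- @prop_for _ _ (fun z => @continuous_at _ _ z (fun y => sin (@?f y))) _ =>
      refine (cont_sin _)
  | |- @prop_for _ _ (fun z => @continuous_at _ _ z (fun y => cos (@?f y))) _ =>
      refine (cont_cos _)
  | |- @prop_for _ _ (fun z => @continuous_at _ _ z (fun y => bigop _ _ _)) _ =>
      (apply: cont_sum => ?)
  | _ => first [ assumption | refine (@contC _ _ _) | refine (@contI _ _)
    | match goal with
      | H : forall x, @continuous_at _ _ x _ |- _ => refine (H _)
      | H : forall x, @prop_for _ x _ _ |- _ => refine (H _)
      end ]
  end.

(** Continuity by the same recursion. *)
Ltac cont := solve [repeat cont_step].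

Section IntervalIntegral.
Context {R : realType}.
Implicit Types (f g F : R -> R) (x a b c k : R).
Local Notation mu := (@lebesgue_measure R).

Definition itg a b f := \int[mu]_(x in `[a, b]) f x.

Definition cont_on a b f := forall x, a <= x <= b -> {for x, continuous f}.

Lemma cont_on_integrable a b f : cont_on a b f -> mu.-integrable `[a, b] (EFin \o f).
Proof.
move=> h; apply: continuous_compact_integrable; first exact: segment_compact.
by apply: continuous_subspace_itv => x; rewrite in_itv => /h.
Qed.

Lemma eq_itg a b f g : (forall x, a <= x <= b -> f x = g x) -> itg a b f = itg a b g.
Proof.
by move=> h; apply: eq_Rintegral => x; rewrite inE /= in_itv => /h.
Qed.

Lemma itgD a b f g : cont_on a b f -> cont_on a b g ->
  itg a b (fun x => f x + g x) = itg a b f + itg a b g.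
Proof.
by move=> /cont_on_integrable hf /cont_on_integrable hg; exact: RintegralD.
Qed.

Lemma itgB a b f g : cont_on a b f -> cont_on a b g ->
  itg a b (fun x => f x - g x) = itg a b f - itg a b g.
Proof.
by move=> /cont_on_integrable hf /cont_on_integrable hg; exact: RintegralB.
Qed.

Lemma itgZ a b c f : cont_on a b f -> itg a b (fun x => c * f x) = c * itg a b f.
Proof. by move=> /cont_on_integrable hf; exact: RintegralZl. Qed.

Lemma itg_ge0 a b f : (forall x, a <= x <= b -> 0 <= f x) -> 0 <= itg a b f.
Proof. by move=> h; apply: Rintegral_ge0 => x /=; rewrite in_itv => /h. Qed.

Lemma le_itg a b f g : cont_on a b f -> cont_on a b g ->
  (forall x, a <= x <= b -> f x <= g x) -> itg a b f <= itg a b g.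
Proof.
move=> hf hg h; rewrite -subr_ge0 -itgB//; apply: itg_ge0 => x /h.
by rewrite subr_ge0.
Qed.

Lemma itg_cst a b c : a <= b -> itg a b (fun=> c) = c * (b - a).
Proof.
move=> ab; rewrite /itg Rintegral_cst//.
rewrite /= lebesgue_measure_itv/= lte_fin.
by case: ltgtP ab => // -> _; rewrite subrr.
Qed.

Lemma itg0 a b : itg a b (fun=> 0) = 0.
Proof. by rewrite /itg /Rintegral integral0. Qed.

Lemma itg_sum (I : Type) (r : seq I) (P : pred I) a b (f : I -> R -> R) :
  (forall i, cont_on a b (f i)) ->
  itg a b (fun x => \sum_(i <- r | P i) f i x) = \sum_(i <- r | P i) itg a b (f i).
Proof.
move=> h; elim: r => [|i r IH].
  by rewrite big_nil -[RHS](itg0 a b); apply: eq_itg => x _; rewrite big_nil.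
rewrite big_cons; case: ifP => Pi; rewrite -IH.
  rewrite -itgD//; first by apply: eq_itg => x _; rewrite big_cons Pi.
  by move=> x xab; apply: cont_sum => j; exact: h.
by apply: eq_itg => x _; rewrite big_cons Pi.
Qed.

Lemma itg_point a f : itg a a f = 0.
Proof. by rewrite /itg set_itv1 Rintegral_set1. Qed.

Lemma itg_split a b c f : a <= c -> c <= b -> cont_on a b f ->
  itg a b f = itg a c f + itg c b f.
Proof.
move=> ac cb h; have hi := cont_on_integrable h.
have := @Rintegral_itvB R f (BLeft a) (BRight b) c hi.
rewrite !bnd_simp => /(_ ac cb) /eqP; rewrite subr_eq => /eqP; rewrite /itg => ->.
rewrite addrC Rintegral_itv_obnd_cbnd//.
apply: integrableS hi => //; apply: subset_itv; by rewrite bnd_simp.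
Qed.

Lemma itg_FTC a b F f : a <= b -> cont_on a b f ->
  (forall x, a <= x <= b -> is_derive x 1 F (f x)) -> itg a b f = F b - F a.
Proof.
rewrite le_eqVlt => /orP[/eqP<-|ab] cf dF; first by rewrite itg_point subrr.
have dc x : a <= x <= b -> {for x, continuous F} by move=> /dF/der_cont.
rewrite /itg /Rintegral (@continuous_FTC2 _ f F)//.
- by apply: continuous_subspace_itv => x; rewrite in_itv => /cf.
- split.
  + by move=> x; rewrite in_itv /= => /andP[/ltW ax /ltW xb]; case: (dF x) => //; rewrite ax.
  + by apply: cvg_at_right_filter; apply: dc; rewrite lexx ltW.
  + by apply: cvg_at_left_filter; apply: dc; rewrite lexx ltW.
- move=> x; rewrite in_itv /= => /andP[/ltW ax /ltW xb].
  by apply: derE; apply: dF; rewrite ax.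
Qed.

Lemma itg_chain a (d : R) (n : nat) f : 0 <= d -> cont_on a (a + n%:R * d) f ->
  itg a (a + n%:R * d) f = \sum_(i < n) itg (a + i%:R * d) (a + i.+1%:R * d) f.
Proof.
move=> d0; elim: n => [|n IH] h; first by rewrite big_ord0 mul0r addr0 itg_point.
have le1 : a <= a + n%:R * d by rewrite lerDl mulr_ge0.
have le2 : a + n%:R * d <= a + n.+1%:R * d.
  by rewrite lerD2l ler_wpM2r// ler_nat.
rewrite big_ord_recr /= -IH; first exact: itg_split.
by move=> x /andP[ax xb]; apply: h; rewrite ax (le_trans xb).
Qed.

End IntervalIntegral.

(** * Sharp Wirtinger and Poincare inequalities on intervals *)

Section Wirtinger.
Context {R : realType}.
Implicit Types (g dg : R -> R) (x a b k t : R).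

Definition C1_on a b g dg :=
  (forall x, a <= x <= b -> is_derive x 1 g (dg x)) /\ cont_on a b dg.

Lemma C1_cont a b g dg : C1_on a b g dg -> cont_on a b g.
Proof. by move=> [h _] x /h/der_cont. Qed.

Lemma C1_sub a b a' b' g dg : a <= a' -> b' <= b -> C1_on a b g dg -> C1_on a' b' g dg.
Proof.
move=> aa bb [h1 h2]; split=> x /andP[x1 x2]; [apply: h1|apply: h2];
by rewrite (le_trans aa)// (le_trans x2).
Qed.

(** Picone identity.  The function p = s' / s, where s is a positive solution of
    s'' = - k^2 s, satisfies p' = - k^2 - p^2, so that
    g'^2 - k^2 g^2 - (g^2 p)' = (g' - g p)^2.  The phase t keeps the
    argument of the sine inside ]0, pi[. *)
Lemma picone a b k t g dg : a <= b -> 0 < k -> C1_on a b g dg ->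
  0 < t -> k * (b - a) + t < pi ->
  k ^+ 2 * itg a b (fun x => g x ^+ 2)
    + g b ^+ 2 * (k * cos (k * (b - a) + t) / sin (k * (b - a) + t))
    - g a ^+ 2 * (k * cos t / sin t)
  <= itg a b (fun x => dg x ^+ 2).
Proof.
move=> ab k0 Cg t0 tpi.
have cg := C1_cont Cg; have [dgP cdg] := Cg.
pose s x := sin (k * (x - a) + t).
pose p x := k * cos (k * (x - a) + t) / s x.
have s0 x : a <= x <= b -> 0 < s x.
  move=> /andP[ax xb]; apply: sin_gt0_pi; rewrite ltr_wpDl//=.
    by apply: le_lt_trans tpi; rewrite lerD2r ler_wpM2l ?(ltW k0)// lerD2r.
  by rewrite mulr_ge0 ?subr_ge0// ltW.
have ds x : is_derive x 1 s (k * cos (k * (x - a) + t)).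
  by rewrite /s; der; ring.
pose dp x := - k ^+ 2 - p x ^+ 2.
have dP x : a <= x <= b -> is_derive x 1 p (dp x).
  move=> xab; have sx : s x != 0 by rewrite gt_eqF// s0.
  have dV := derV sx (ds x).
  rewrite /p; der.
  by rewrite /dp /p -/(s x); field.
have cp : cont_on a b p by move=> x /dP/der_cont.
(* Integrate the derivative f of F = g^2 p, with p a and p b written out. *)
pose F x := g x ^+ 2 * p x.
pose f x := 2 * (g x * dg x) * p x + g x ^+ 2 * (- k ^+ 2 - p x ^+ 2).
have dF x : a <= x <= b -> is_derive x 1 F (f x).
  move=> xab; rewrite /F; have := dgP _ xab; have := dP _ xab => h1 h2.
  under eq_fun do rewrite expr2.
  by der; rewrite /f /dp; ring.
have cf : cont_on a b f.
  move=> x xab; have := cg _ xab; have := cdg _ xab; have := cp _ xab => *.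
  by rewrite /f; cont.
have := itg_FTC ab cf dF; rewrite /F => E.
rewrite -itgZ; last by move=> x xab; have := cg _ xab => ?; cont.
have pa : p a = k * cos t / sin t by rewrite /p /s subrr mulr0 add0r.
rewrite -addrA -{1}/(s b) -{1}/(p b) -pa -E -itgD//; last first.
  by move=> x xab; have := cg _ xab => ?; cont.
apply: le_itg => [x xab|x xab|x xab].
- by have := cg _ xab; have := cf _ xab => *; cont.
- by have := cdg _ xab => *; cont.
rewrite -subr_ge0 (_ : _ - _ = (dg x - g x * p x) ^+ 2) ?sqr_ge0//.
by rewrite /f; ring.
Qed.

(** The Picone identity degenerates at the sharp constant k0, which has to be
    approached from below. *)
Lemma le_limit_sqr k0 (A B : R) : 0 < k0 -> 0 <= A ->
  (forall k, 0 < k -> k < k0 -> k ^+ 2 * A <= B) -> k0 ^+ 2 * A <= B.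
Proof.
move=> k00 A0 h; rewrite leNgt; apply/negP => BA.
have B0 : 0 <= B.
  have k2 : 0 < k0 / 2 by rewrite divr_gt0.
  apply: le_trans (h _ k2 _); first by rewrite mulr_ge0// sqr_ge0.
  by rewrite ltr_pdivrMr// ltr_pMr// ltr1n.
have {}A0 : 0 < A.
  rewrite lt_neqAle A0 andbT; apply/eqP => A00; move: BA.
  by rewrite -A00 mulr0 ltNge B0.
(* If B < k0^2 A, the hypothesis fails halfway between sqrt (B / A) and k0. *)
pose s := Num.sqrt (B / A).
have s2 : s ^+ 2 = B / A by rewrite sqr_sqrtr// divr_ge0// ltW.
have s0 : 0 <= s by exact: sqrtr_ge0.
have sk : s < k0.
  by rewrite -(ltr_pXn2r (n := 2))// ?nnegrE ?ltW// s2 ltr_pdivrMr.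
have m1 : 0 < (s + k0) / 2 by rewrite divr_gt0// ltr_wpDl.
have := h _ m1 ltac:(lra); rewrite -ler_pdivlMr// -s2.
by rewrite ler_pXn2r ?nnegrE ?(ltW m1)//; lra.
Qed.

(** The phase is chosen such that the sine is symmetric about the midpoint. *)
Lemma wirtinger_DD a b g dg : a < b -> C1_on a b g dg -> g a = 0 -> g b = 0 ->
  (pi / (b - a)) ^+ 2 * itg a b (fun x => g x ^+ 2) <= itg a b (fun x => dg x ^+ 2).
Proof.
move=> ab Cg ga gb; have ba : 0 < b - a by rewrite subr_gt0.
apply: le_limit_sqr; first by rewrite divr_gt0// pi_gt0.
  by apply: itg_ge0 => x _; exact: sqr_ge0.
move=> k k0; rewrite ltr_pdivlMr// => kpi.
have := @picone a b k ((pi - k * (b - a)) / 2) g dg (ltW ab) k0 Cg.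
rewrite ga gb expr0n !mul0r addr0 subr0; apply; first by lra.
lra.
Qed.

(** The phase is chosen such that the cosine vanishes at the end b, where g is
    free. *)
Lemma wirtinger_DN a b g dg : a < b -> C1_on a b g dg -> g a = 0 ->
  (pi / 2 / (b - a)) ^+ 2 * itg a b (fun x => g x ^+ 2) <= itg a b (fun x => dg x ^+ 2).
Proof.
move=> ab Cg ga; have ba : 0 < b - a by rewrite subr_gt0.
have pi0 := pi_gt0 R.
apply: le_limit_sqr; first by rewrite !divr_gt0.
  by apply: itg_ge0 => x _; exact: sqr_ge0.
move=> k k0; rewrite ltr_pdivlMr// => kpi.
have := @picone a b k (pi / 2 - k * (b - a)) g dg (ltW ab) k0 Cg.
rewrite [k * _ + _]addrC subrK cos_pihalf ga expr0n mulr0 !mul0r mulr0 addr0 subr0.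
by apply; lra.
Qed.

(** The phase is chosen such that the cosine vanishes at the end a, where g is
    free. *)
Lemma wirtinger_ND a b g dg : a < b -> C1_on a b g dg -> g b = 0 ->
  (pi / 2 / (b - a)) ^+ 2 * itg a b (fun x => g x ^+ 2) <= itg a b (fun x => dg x ^+ 2).
Proof.
move=> ab Cg gb; have ba : 0 < b - a by rewrite subr_gt0.
have pi0 := pi_gt0 R.
apply: le_limit_sqr; first by rewrite !divr_gt0.
  by apply: itg_ge0 => x _; exact: sqr_ge0.
move=> k k0; rewrite ltr_pdivlMr// => kpi.
have := @picone a b k (pi / 2) g dg (ltW ab) k0 Cg.
rewrite cos_pihalf gb expr0n mulr0 !mul0r mulr0 addr0 subr0.
by apply; lra.
Qed.

(** Subtract the value at the midpoint, and use on each half the inequality for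
    functions that vanish at one end: the half length and the quarter wave give
    together the constant pi / (b - a).  Among the constants to subtract the mean
    is the best, so the left-hand side is smaller than with the midpoint value. *)
Lemma neumann_poincare a b g dg : a < b -> C1_on a b g dg ->
  (pi / (b - a)) ^+ 2 *
    (itg a b (fun x => g x ^+ 2) - (itg a b g) ^+ 2 / (b - a))
  <= itg a b (fun x => dg x ^+ 2).
Proof.
move=> ab Cg; have ba : 0 < b - a by rewrite subr_gt0.
pose m := (a + b) / 2; pose c := g m.
have am : a < m by rewrite /m; lra.
have mb : m < b by rewrite /m; lra.
have cg := C1_cont Cg; have [dgP cdg] := Cg.
have Cgc : C1_on a b (fun x => g x - c) dg.
  by split=> // x /dgP h; der; rewrite subr0.
have h1 := wirtinger_ND am (C1_sub (lexx a) (ltW mb) Cgc) (subrr _).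
have h2 := wirtinger_DN mb (C1_sub (ltW am) (lexx b) Cgc) (subrr _).
have e1 : pi / 2 / (m - a) = pi / (b - a) by rewrite /m; field; lra.
have e2 : pi / 2 / (b - m) = pi / (b - a) by rewrite /m; field; lra.
rewrite e1 in h1; rewrite e2 in h2.
have c1 : cont_on a b (fun x => dg x ^+ 2).
  by move=> x xab; have := cdg _ xab => ?; cont.
have c2 : cont_on a b (fun x => (g x - c) ^+ 2).
  by move=> x xab; have := cg _ xab => ?; cont.
rewrite (itg_split (ltW am) (ltW mb) c1).
apply: le_trans (lerD h1 h2); rewrite -mulrDr -(itg_split (ltW am) (ltW mb) c2).
rewrite ler_wpM2l ?sqr_ge0//.
have -> : itg a b (fun x => (g x - c) ^+ 2) =
    itg a b (fun x => g x ^+ 2) - 2 * c * itg a b g + c ^+ 2 * (b - a).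
  have c3 : cont_on a b (fun x => g x ^+ 2).
    by move=> x xab; have := cg _ xab => ?; cont.
  have c4 : cont_on a b (fun x => 2 * c * g x).
    by move=> x xab; have := cg _ xab => ?; cont.
  have c5 : cont_on a b (fun _ : R => c ^+ 2) by move=> x _; exact: contC.
  rewrite -(itg_cst _ (ltW ab)) -itgZ// -itgB// -itgD//.
    by apply: eq_itg => x _; ring.
  by move=> x xab; have := cg _ xab => ?; cont.
rewrite -subr_ge0.
have -> : itg a b (fun x => g x ^+ 2) - 2 * c * itg a b g + c ^+ 2 * (b - a) -
   (itg a b (fun x => g x ^+ 2) - itg a b g ^+ 2 / (b - a)) =
   (c * (b - a) - itg a b g) ^+ 2 / (b - a).
  by field; rewrite gt_eqF.
by rewrite divr_ge0 ?sqr_ge0// ltW.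
Qed.

Lemma cell_poincare a (d : R) (n : nat) g dg : 0 < d ->
  C1_on a (a + n%:R * d) g dg ->
  (pi / d) ^+ 2 * (itg a (a + n%:R * d) (fun x => g x ^+ 2) -
     (\sum_(i < n) (itg (a + i%:R * d) (a + i.+1%:R * d) g) ^+ 2) / d)
  <= itg a (a + n%:R * d) (fun x => dg x ^+ 2).
Proof.
move=> d0 Cg; have cg := C1_cont Cg; have [dgP cdg] := Cg.
have c1 : cont_on a (a + n%:R * d) (fun x => dg x ^+ 2).
  by move=> x xab; have := cdg _ xab => ?; cont.
have c2 : cont_on a (a + n%:R * d) (fun x => g x ^+ 2).
  by move=> x xab; have := cg _ xab => ?; cont.
rewrite (itg_chain (ltW d0) c1) (itg_chain (ltW d0) c2) mulr_suml -sumrB mulr_sumr; apply: ler_sum => i _.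
have ei : (a + i.+1%:R * d) - (a + i%:R * d) = d by rewrite -natr1; ring.
have lti : a + i%:R * d < a + i.+1%:R * d by rewrite -subr_gt0 ei.
have := @neumann_poincare (a + i%:R * d) (a + i.+1%:R * d) g dg lti.
rewrite ei; apply; apply: C1_sub Cg.
  by rewrite lerDl mulr_ge0// ltW.
by rewrite lerD2l ler_wpM2r ?(ltW d0)// ler_nat.
Qed.

Lemma node_wirtinger a (d : R) (n : nat) g dg : 0 < d ->
  C1_on a (a + n%:R * d) g dg ->
  (forall i, (i <= n)%N -> g (a + i%:R * d) = 0) ->
  (pi / d) ^+ 2 * itg a (a + n%:R * d) (fun x => g x ^+ 2)
  <= itg a (a + n%:R * d) (fun x => dg x ^+ 2).
Proof.
move=> d0 Cg gi; have cg := C1_cont Cg; have [dgP cdg] := Cg.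
have c1 : cont_on a (a + n%:R * d) (fun x => dg x ^+ 2).
  by move=> x xab; have := cdg _ xab => ?; cont.
have c2 : cont_on a (a + n%:R * d) (fun x => g x ^+ 2).
  by move=> x xab; have := cg _ xab => ?; cont.
rewrite (itg_chain (ltW d0) c1) (itg_chain (ltW d0) c2) mulr_sumr; apply: ler_sum => i _.
have ei : (a + i.+1%:R * d) - (a + i%:R * d) = d by rewrite -natr1; ring.
have lti : a + i%:R * d < a + i.+1%:R * d by rewrite -subr_gt0 ei.
have := @wirtinger_DD (a + i%:R * d) (a + i.+1%:R * d) g dg lti.
rewrite ei; apply; [|by apply: gi; exact: ltnW|exact: gi].
apply: C1_sub Cg.
  by rewrite lerDl mulr_ge0// ltW.
by rewrite lerD2l ler_wpM2r ?(ltW d0)// ler_nat.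
Qed.

End Wirtinger.

(** * From functions with nodes to all functions *)

Section Nodes.
Context (R : realType) (V : lmodType R) (a b : V -> V -> R).

(** Let r be the part of f that is b-orthogonal to the modes phi.  Among the
    combinations of the M + 1 vectors r and phi j a nonzero one, v, satisfies the
    M conditions node j v = 0, hence L * b v v <= a v v.  All forms are diagonal in
    these vectors, and the modes lie strictly below L, so the coefficient of r
    cannot be 0, and L * b r r <= a r r follows. *)
Lemma sharp_from_nodes (H : V -> Prop) (M : nat) (phi : 'I_M -> V)
    (mu : 'I_M -> R) (node : 'I_M -> V -> R) (K L : R) :
  subspace H -> positive_form H a -> positive_form H b -> 0 < K ->
  (forall j, eigenpair a b H (phi j) (mu j) /\ mu j < L) ->
  (forall i j, b (phi i) (phi j) = K *+ (i == j)) ->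
  (forall j k u v, H u -> H v -> node j (k *: u + v) = k * node j u + node j v) ->
  (forall v, H v -> (forall j, node j v = 0) -> L * b v v <= a v v) ->
  forall f, H f -> L * b f f <= a f f + \sum_j (L - mu j) * (b f (phi j)) ^+ 2 / K.
Proof.
move=> sH pa pb K0 phi1 phi2 nodeL nodeP f Hf.
have Hphi j : H (phi j) by case: (phi1 j) => -[].
pose d j := b f (phi j) / K.
pose p := \sum_j d j *: phi j; pose r := f - p.
have Hp : H p by exact: subspace_sum.
have Hr : H r by exact: subspaceB.
have bp j : b p (phi j) = b f (phi j).
  rewrite (form_suml sH pb)// (bigD1 j)//= big1 => [|i ij].
    by rewrite phi2 eqxx mulr1n addr0 /d divfK// gt_eqF.
  by rewrite phi2 (negbTE ij) mulr0n mulr0.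
have br j : b r (phi j) = 0.
  by rewrite /r addrC -scaleN1r (form_linl pb)// bp mulN1r addNr.
have ar j : a r (phi j) = 0.
  by rewrite (form_sym pa)// (phi1 j).1.2// (form_sym pb)// br mulr0.
have comb (g : V -> V -> R) (c0 : R) (c : 'I_M -> R) : positive_form H g ->
    (forall j, g r (phi j) = 0) ->
    (forall i j, i != j -> g (phi i) (phi j) = 0) ->
    g (c0 *: r + \sum_j c j *: phi j) (c0 *: r + \sum_j c j *: phi j) =
    c0 ^+ 2 * g r r + \sum_j c j ^+ 2 * g (phi j) (phi j).
  move=> pg gr gphi; set q := \sum_j _.
  have Hq : H q by exact: subspace_sum.
  rewrite (form_quad sH pg)// (form_sumr sH pg)// big1 ?mulr0 ?addr0; last first.
    by move=> j _; rewrite gr mulr0.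
  congr (_ + _); rewrite (form_suml sH pg)//; apply: eq_bigr => i _.
  rewrite (form_sumr sH pg)// (bigD1 i)//= big1 ?addr0 => [|j ji].
    by rewrite expr2 mulrA.
  by rewrite gphi ?mulr0// eq_sym.
have bphi i j : i != j -> b (phi i) (phi j) = 0 by move=> ij; rewrite phi2 (negbTE ij).
have aphi i j : i != j -> a (phi i) (phi j) = 0.
  by move=> ij; rewrite (phi1 i).1.2// bphi// mulr0.
have aphi2 i : a (phi i) (phi i) = mu i * K by rewrite (phi1 i).1.2// phi2 eqxx.
(* M linear conditions on the M + 1 vectors r, phi 0, ..., phi (M - 1). *)
pose w (o : 'I_M.+1) := if unlift ord0 o is Some j then phi j else r.
have oI : (#|'I_M| < #|'I_M.+1|)%N by rewrite !card_ord.
have [c [z cz] c0] := kernel_vector (fun o j => node j (w o)) oI.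
pose v := c ord0 *: r + \sum_j c (lift ord0 j) *: phi j.
have Hv : H v by apply: sH.2 => //; exact: subspace_sum.
have node0 j : node j 0 = 0.
  by have := nodeL j (-1) 0 0 sH.1 sH.1; rewrite scaler0 addr0 mulN1r addNr.
have nv j : node j v = 0.
  rewrite nodeL//; last exact: subspace_sum.
  have -> : node j (\sum_i c (lift ord0 i) *: phi i) = \sum_i c (lift ord0 i) * node j (phi i).
    suff: H (\sum_i c (lift ord0 i) *: phi i) /\
      node j (\sum_i c (lift ord0 i) *: phi i) = \sum_i c (lift ord0 i) * node j (phi i) by case.
    elim/big_rec2: _ => [|i x y _ [Hy IH]]; first by split; [exact: sH.1|].
    by split; [exact: sH.2|rewrite nodeL ?IH].
  rewrite -[RHS](c0 j) big_ord_recl {1}/w unlift_none; congr (_ + _).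
  by apply: eq_bigr => i _; rewrite /w liftK.
have := nodeP v Hv nv.
have -> : b v v = c ord0 ^+ 2 * b r r + \sum_j c (lift ord0 j) ^+ 2 * K.
  by rewrite comb//; congr (_ + _); apply: eq_bigr => i _; rewrite phi2 eqxx.
have -> : a v v = c ord0 ^+ 2 * a r r + \sum_j c (lift ord0 j) ^+ 2 * (mu j * K).
  by rewrite comb//; congr (_ + _); apply: eq_bigr => i _; rewrite aphi2.
rewrite mulrDr -lerBDl => hv.
have {hv} key : \sum_j c (lift ord0 j) ^+ 2 * ((L - mu j) * K) <= c ord0 ^+ 2 * (a r r - L * b r r).
  have E : \sum_j c (lift ord0 j) ^+ 2 * ((L - mu j) * K) =
      L * (\sum_j c (lift ord0 j) ^+ 2 * K) - \sum_j c (lift ord0 j) ^+ 2 * (mu j * K).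
    by rewrite mulr_sumr -sumrB; apply: eq_bigr => j _; ring.
  rewrite E; lra.
have pos j : 0 < (L - mu j) * K by rewrite mulr_gt0// subr_gt0; case: (phi1 j).
have sum0 : 0 <= \sum_j c (lift ord0 j) ^+ 2 * ((L - mu j) * K).
  by apply: sumr_ge0 => j _; rewrite mulr_ge0 ?sqr_ge0// ltW.
have Er : 0 <= a r r - L * b r r.
  (* If the coefficient of r vanishes, key forces all the other ones to vanish. *)
  have [c00|c00] := eqVneq (c ord0) 0; last first.
    by rewrite -(@pmulr_rge0 _ (c ord0 ^+ 2)) ?exprn_even_gt0//; exact: le_trans sum0 key.
  move: key; rewrite c00 expr0n mul0r => key.
  have {key} /eqP : \sum_j c (lift ord0 j) ^+ 2 * ((L - mu j) * K) = 0.
    by apply/eqP; rewrite eq_le key sum0.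
  rewrite psumr_eq0; last by move=> j _; rewrite mulr_ge0 ?sqr_ge0// ltW.
  move=> /allP h; case: (unliftP ord0 z) cz => [j ->|->]; last by rewrite c00 eqxx.
  have := h j (mem_index_enum _); rewrite /= mulf_eq0 sqrf_eq0 (gt_eqF (pos j)) orbF.
  by move=> /eqP ->; rewrite eqxx.
have ff : f = 1 *: r + p by rewrite scale1r /r subrK.
have -> : b f f = b r r + \sum_j d j ^+ 2 * K.
  rewrite {1 2}ff comb// expr1n mul1r; congr (_ + _).
  by apply: eq_bigr => i _; rewrite phi2 eqxx.
have -> : a f f = a r r + \sum_j d j ^+ 2 * (mu j * K).
  rewrite {1 2}ff comb// expr1n mul1r; congr (_ + _).
  by apply: eq_bigr => i _; rewrite aphi2.
have -> : \sum_j (L - mu j) * b f (phi j) ^+ 2 / K =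
    L * (\sum_j d j ^+ 2 * K) - \sum_j d j ^+ 2 * (mu j * K).
  rewrite mulr_sumr -sumrB; apply: eq_bigr => j _; rewrite /d.
  by field; rewrite gt_eqF.
by rewrite mulrDr; lra.
Qed.

Lemma bessel (H : V -> Prop) (M : nat) (phi : 'I_M -> V) (K : R) (f : V) :
  subspace H -> positive_form H b -> 0 < K -> H f -> (forall j, H (phi j)) ->
  (forall i j, b (phi i) (phi j) = K *+ (i == j)) ->
  \sum_j (b f (phi j)) ^+ 2 / K <= b f f.
Proof.
move=> sH pb K0 Hf Hphi phi2.
pose d j := b f (phi j) / K.
pose p := \sum_j d j *: phi j.
have Hp : H p by exact: subspace_sum.
have := form_ge0 pb (subspaceB sH Hf Hp).
rewrite (form_quadB sH pb)//.
have -> : b p p = \sum_j (b f (phi j)) ^+ 2 / K.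
  rewrite (form_suml sH pb)//; apply: eq_bigr => i _.
  rewrite (form_sumr sH pb)// (bigD1 i)//= big1 ?addr0 => [|j ji].
    by rewrite phi2 eqxx mulr1n /d; field; rewrite gt_eqF.
  by rewrite phi2 eq_sym (negbTE ji) mulr0n mulr0.
have -> : b f p = \sum_j (b f (phi j)) ^+ 2 / K.
  rewrite (form_sumr sH pb)//; apply: eq_bigr => i _.
  by rewrite /d; ring.
lra.
Qed.

End Nodes.

(** * Sine modes of an interval *)

Section SineModes.
Context {R : realType}.
Implicit Types (f g df dg : R -> R) (x a b : R).

Lemma sin_npi (n : nat) : sin (n%:R * pi) = 0 :> R.
Proof.
elim: n => [|n IH]; first by rewrite mul0r sin0.
by rewrite -natr1 mulrDl mul1r sinDpi IH oppr0.
Qed.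

Definition wavenumber a b (m : nat) : R := m%:R * (pi / (b - a)).
Definition sine_mode a b (m : nat) x : R := sin (wavenumber a b m * (x - a)).
Definition dsine_mode a b (m : nat) x : R :=
  wavenumber a b m * cos (wavenumber a b m * (x - a)).

Lemma sine_mode_l a b m : sine_mode a b m a = 0.
Proof. by rewrite /sine_mode subrr mulr0 sin0. Qed.

Lemma sine_mode_r a b m : a < b -> sine_mode a b m b = 0.
Proof.
by move=> ab; rewrite /sine_mode /wavenumber -mulrA divfK ?sin_npi// subr_eq0 gt_eqF.
Qed.

Lemma der_sine_mode a b m x : is_derive x 1 (sine_mode a b m) (dsine_mode a b m x).
Proof. by rewrite /sine_mode /dsine_mode; der; ring. Qed.

Lemma der_dsine_mode a b m x : is_derive x 1 (dsine_mode a b m)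
  (- wavenumber a b m ^+ 2 * sine_mode a b m x).
Proof. by rewrite /sine_mode /dsine_mode; der; ring. Qed.

Lemma cont_sine_mode a b m x : {for x, continuous (sine_mode a b m)}.
Proof. exact: der_cont (der_sine_mode _ _ _ _). Qed.

Lemma cont_dsine_mode a b m x : {for x, continuous (dsine_mode a b m)}.
Proof. exact: der_cont (der_dsine_mode _ _ _ _). Qed.

Lemma C1_sine_mode a b m c d : C1_on c d (sine_mode a b m) (dsine_mode a b m).
Proof.
by split=> x _; [exact: der_sine_mode|exact: cont_dsine_mode].
Qed.

(** The weak form of the equation satisfied by a sine mode, by parts. *)
Lemma sine_mode_energy a b m g dg : a < b -> C1_on a b g dg -> g a = 0 -> g b = 0 ->
  itg a b (fun x => dsine_mode a b m x * dg x) =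
  wavenumber a b m ^+ 2 * itg a b (fun x => sine_mode a b m x * g x).
Proof.
move=> ab Cg ga gb; have cg := C1_cont Cg; have [dgP cdg] := Cg.
pose s := sine_mode a b m; pose ds := dsine_mode a b m; set w := wavenumber a b m.
have cs x : {for x, continuous s} by exact: cont_sine_mode.
have cds x : {for x, continuous ds} by exact: cont_dsine_mode.
pose F x := ds x * g x.
have dF x : a <= x <= b -> is_derive x 1 F (ds x * dg x - w ^+ 2 * (s x * g x)).
  move=> xab; have h1 := dgP _ xab; have h2 := der_dsine_mode a b m x.
  by rewrite /F; der; rewrite -/w; rewrite -/(s x); rewrite -/(ds x); ring.
have c1 : cont_on a b (fun x => ds x * dg x).
  by move=> x xab; have := cdg _ xab => ?; cont.
have c2 : cont_on a b (fun x => w ^+ 2 * (s x * g x)).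
  by move=> x xab; have := cg _ xab => ?; cont.
have c3 : cont_on a b (fun x => s x * g x).
  by move=> x xab; have := cg _ xab => ?; cont.
have c4 : cont_on a b (fun x => ds x * dg x - w ^+ 2 * (s x * g x)).
  by move=> x xab; have := cg _ xab => ?; have := cdg _ xab => ?; cont.
have := itg_FTC (ltW ab) c4 dF.
rewrite itgB// itgZ// /F ga gb !mulr0 subrr => /eqP.
by rewrite subr_eq0 => /eqP.
Qed.

(** Eigenfunctions for distinct eigenvalues. *)
Lemma sine_mode_orth a b m n : a < b -> m != n ->
  itg a b (fun x => sine_mode a b m x * sine_mode a b n x) = 0.
Proof.
move=> ab mn.
have h1 := sine_mode_energy m ab (C1_sine_mode a b n a b) (sine_mode_l _ _ _) (sine_mode_r _ ab).
have h2 := sine_mode_energy n ab (C1_sine_mode a b m a b) (sine_mode_l _ _ _) (sine_mode_r _ ab).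
have e1 : itg a b (fun x => dsine_mode a b n x * dsine_mode a b m x) =
    itg a b (fun x => dsine_mode a b m x * dsine_mode a b n x).
  by apply: eq_itg => x _; rewrite mulrC.
have e2 : itg a b (fun x => sine_mode a b n x * sine_mode a b m x) =
    itg a b (fun x => sine_mode a b m x * sine_mode a b n x).
  by apply: eq_itg => x _; rewrite mulrC.
move: h2; rewrite e1 e2 h1 => /eqP; rewrite -subr_eq0 -mulrBl mulf_eq0.
case/orP => [|/eqP//]; rewrite subr_sqr mulf_eq0 /wavenumber -mulrBl -mulrDl.
have p0 : pi / (b - a) != 0.
  by rewrite mulf_neq0 ?invr_neq0 ?gt_eqF ?pi_gt0 ?subr_gt0.
have z t : (t * (pi / (b - a)) == 0) = (t == 0) by rewrite mulf_eq0 (negbTE p0) orbF.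
rewrite !z subr_eq0 eqr_nat (negbTE mn) /=.
by rewrite -natrD pnatr_eq0 addn_eq0 => /andP[/eqP m0 /eqP n0]; rewrite m0 n0 in mn.
Qed.

Lemma sine_mode_norm a b m : a < b -> (0 < m)%N ->
  itg a b (fun x => sine_mode a b m x * sine_mode a b m x) = (b - a) / 2.
Proof.
move=> ab m0; pose s := sine_mode a b m; pose ds := dsine_mode a b m.
set w := wavenumber a b m.
have w0 : w != 0.
  by rewrite !mulf_neq0 ?invr_neq0 ?gt_eqF ?pi_gt0 ?subr_gt0 ?ltr0n.
(* An antiderivative of the square of the sine mode. *)
pose F x := (x - a) / 2 - s x * ds x / (2 * w ^+ 2).
have dF x : a <= x <= b -> is_derive x 1 F (s x * s x).
  move=> _; have h1 := der_sine_mode a b m x; have h2 := der_dsine_mode a b m x.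
  pose c := cos (w * (x - a)).
  have c2 : c ^+ 2 = 1 - s x ^+ 2.
    by apply/eqP; rewrite eq_sym subr_eq -(cos2Dsin2 (w * (x - a))).
  rewrite /F; der; rewrite -/w -/(s x) -/(ds x).
  have -> : ds x = w * c by [].
  transitivity ((1 - c ^+ 2 + s x ^+ 2) / 2); first by field.
  by rewrite c2; field.
have cs x : {for x, continuous s} by exact: cont_sine_mode.
rewrite (itg_FTC (ltW ab) _ dF); last by move=> x _; cont.
rewrite /F /s sine_mode_l sine_mode_r//; ring.
Qed.

Lemma wavenumber_ge0 a b m : a < b -> 0 <= wavenumber a b m.
Proof.
by move=> ab; rewrite /wavenumber mulr_ge0// divr_ge0 ?pi_ge0// subr_ge0 ltW.
Qed.

End SineModes.

Section SineInequality.
Context {R : realType}.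
Implicit Types (f df : R -> R) (x a b L : R).

Lemma cont_space a b : subspace (fun f : R -> R => cont_on a b f).
Proof.
split=> [x _|k u v hu hv x xab]; first exact: contC.
have h1 := hu _ xab; have h2 := hv _ xab.
by have : {for x, continuous (fun y => k * u y + v y)} by cont.
Qed.

Lemma cont_form a b : positive_form (fun f : R -> R => cont_on a b f)
  (fun f g => itg a b (fun x => f x * g x)).
Proof.
split=> [u v _ _|k u v w hu hv hw|u _]; last by apply: itg_ge0 => x _; rewrite -expr2 sqr_ge0.
  by apply: eq_itg => x _; rewrite mulrC.
rewrite -itgZ; last by move=> x xab; have := hu _ xab => ?; have := hw _ xab => ?; cont.
rewrite -itgD; first by apply: eq_itg => x _; rewrite !fctE /GRing.scale /=; ring.
- by move=> x xab; have := hu _ xab => ?; have := hw _ xab => ?; cont.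
- by move=> x xab; have := hv _ xab => ?; have := hw _ xab => ?; cont.
Qed.

Lemma sine_mode_gram a b (M : nat) (i j : 'I_M) : a < b ->
  itg a b (fun x => sine_mode a b i.+1 x * sine_mode a b j.+1 x) =
  ((b - a) / 2) *+ (i == j).
Proof.
move=> ab; have [->|ij] := eqVneq i j; first by rewrite sine_mode_norm.
by rewrite sine_mode_orth.
Qed.

Lemma sine_bessel a b (M : nat) f : a < b -> cont_on a b f ->
  \sum_(j < M) (itg a b (fun x => f x * sine_mode a b j.+1 x)) ^+ 2 / ((b - a) / 2)
  <= itg a b (fun x => f x ^+ 2).
Proof.
move=> ab cf.
have K0 : 0 < (b - a) / 2 by rewrite divr_gt0// subr_gt0.
have := @bessel R _ _ _ M (fun j => sine_mode a b j.+1) _ f (cont_space a b)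
  (cont_form a b) K0 cf (fun j x _ => @cont_sine_mode R a b j.+1 x)
  (fun i j => sine_mode_gram i j ab).
by under [X in _ <= itg _ _ X]eq_fun do rewrite -expr2.
Qed.

Definition dirichlet_pair a b (u : (R -> R) * (R -> R)) :=
  [/\ C1_on a b u.1 u.2, u.1 a = 0 & u.1 b = 0].

Lemma dirichlet_pair_space a b : subspace (dirichlet_pair a b).
Proof.
split=> [|k u v [[u1 u2] ua ub] [[v1 v2] va vb]].
  by split=> //; split=> x _; [exact: derC|exact: contC].
split; last 2 first.
- by rewrite /= !fctE ua va scaler0 addr0.
- by rewrite /= !fctE ub vb scaler0 addr0.
split=> x xab.
  have h1 := u1 _ xab; have h2 := v1 _ xab.
  have : is_derive x 1 (fun y => k * u.1 y + v.1 y) (k * u.2 x + v.2 x) by der; ring.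
  exact.
have h1 := u2 _ xab; have h2 := v2 _ xab.
by have : {for x, continuous (fun y => k * u.2 y + v.2 y)} by cont.
Qed.

Lemma dirichlet_pair_form1 a b : positive_form (dirichlet_pair a b)
  (fun u v => itg a b (fun x => u.1 x * v.1 x)).
Proof.
have [h1 h2 h3] := cont_form a b.
split=> [u v [/C1_cont hu _ _] [/C1_cont hv _ _]|
  k u v w [/C1_cont hu _ _] [/C1_cont hv _ _] [/C1_cont hw _ _]|u [/C1_cont hu _ _]].
- exact: h1.
- exact: h2.
- exact: h3.
Qed.

Lemma dirichlet_pair_form2 a b : positive_form (dirichlet_pair a b)
  (fun u v => itg a b (fun x => u.2 x * v.2 x)).
Proof.
have [h1 h2 h3] := cont_form a b.
split=> [u v [[_ hu] _ _] [[_ hv] _ _]|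
  k u v w [[_ hu] _ _] [[_ hv] _ _] [[_ hw] _ _]|u [[_ hu] _ _]].
- exact: h1.
- exact: h2.
- exact: h3.
Qed.

(** The nodes are the interior points that divide [a, b] into M + 1 equal parts:
    for a function vanishing there the inequality on each part has the constant
    wavenumber a b M.+1 ^+ 2. *)
Lemma sine_inequality a b (M : nat) L f df : a < b -> C1_on a b f df ->
  f a = 0 -> f b = 0 ->
  (forall j : 'I_M, wavenumber a b j.+1 ^+ 2 < L) -> L <= wavenumber a b M.+1 ^+ 2 ->
  L * itg a b (fun x => f x ^+ 2) <= itg a b (fun x => df x ^+ 2) +
    \sum_(j < M) (L - wavenumber a b j.+1 ^+ 2) *
       (itg a b (fun x => f x * sine_mode a b j.+1 x)) ^+ 2 / ((b - a) / 2).
Proof.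
move=> ab Cf fa fb wL Lw.
have K0 : 0 < (b - a) / 2 by rewrite divr_gt0// subr_gt0.
pose d := (b - a) / M.+1%:R.
have d0 : 0 < d by rewrite divr_gt0 ?subr_gt0 ?ltr0n.
have bE : b = a + M.+1%:R * d by rewrite /d mulrC divfK ?pnatr_eq0//; ring.
pose V : lmodType R := ((R -> R) * (R -> R))%type.
pose B (u v : V) := itg a b (fun x => u.1 x * v.1 x).
pose A (u v : V) := itg a b (fun x => u.2 x * v.2 x).
pose phi (j : 'I_M) : V := (sine_mode a b j.+1, dsine_mode a b j.+1).
have Hphi j : dirichlet_pair a b (phi j).
  by split; [exact: C1_sine_mode|exact: sine_mode_l|exact: sine_mode_r].
pose node (j : 'I_M) (u : V) := u.1 (a + j.+1%:R * d).
have := @sharp_from_nodes R V A B (dirichlet_pair a b) M phi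
  (fun j => wavenumber a b j.+1 ^+ 2) node ((b - a) / 2) L
  (dirichlet_pair_space a b) (dirichlet_pair_form2 a b) (dirichlet_pair_form1 a b) K0.
have phiE j : eigenpair A B (dirichlet_pair a b) (phi j) (wavenumber a b j.+1 ^+ 2) /\
    wavenumber a b j.+1 ^+ 2 < L.
  split; [|exact: wL]; split; first exact: Hphi.
  by move=> v [Cv va vb]; exact: sine_mode_energy.
move=> /(_ phiE (fun i j => sine_mode_gram i j ab)).
have nodeL j k u v : dirichlet_pair a b u -> dirichlet_pair a b v ->
  node j (k *: u + v) = k * node j u + node j v by [].
move=> /(_ nodeL).
have nodeP (v : V) : dirichlet_pair a b v -> (forall j, node j v = 0) ->
    L * B v v <= A v v.
  move=> [Cv va vb] nv.
  have pd : pi / d = wavenumber a b M.+1.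
    by rewrite /d /wavenumber invf_div mulrCA.
  have nodes i : (i <= M.+1)%N -> v.1 (a + i%:R * d) = 0.
    case: i => [|i]; first by rewrite mul0r addr0.
    rewrite leq_eqVlt => /orP[/eqP[->]|]; first by rewrite -bE.
    by rewrite ltnS => iM; exact: (nv (Ordinal iM)).
  have := @node_wirtinger R a d M.+1 v.1 v.2 d0; rewrite -bE => /(_ Cv nodes).
  rewrite pd => h.
  have sqE (u : R -> R) : itg a b (fun x => u x * u x) = itg a b (fun x => u x ^+ 2).
    by apply: eq_itg => x _; rewrite expr2.
  rewrite /B /A !sqE; apply: le_trans h; rewrite ler_wpM2r//.
  by apply: itg_ge0 => x _; exact: sqr_ge0.
move=> /(_ nodeP (f, df)); rewrite /A /B /phi /=.
have sqE (u : R -> R) : itg a b (fun x => u x * u x) = itg a b (fun x => u x ^+ 2).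
  by apply: eq_itg => x _; rewrite expr2.
by rewrite !sqE; apply; split.
Qed.

End SineInequality.

(** * Integrals over rectangles *)

Section Plane.
Context {R : realType}.
Implicit Types (a b c d x y : R) (F u : R * R -> R).
Local Notation mu := (@lebesgue_measure R).
Local Notation T2 := (measurableTypeR R * measurableTypeR R)%type.
Local Notation mu2 := (lebesgue2 R).

(** A union of boxes with rational vertices. *)
Lemma open_measurable2 (U : set (R * R)) : open U -> measurable (U : set T2).
Proof.
move=> oU.
pose box (q : rat * rat * rat * rat) : set T2 :=
  `](ratr q.1.1.1 : R), ratr q.1.1.2[ `*` `](ratr q.1.2 : R), ratr q.2[.
have -> : U = \bigcup_q (if `[< box q `<=` U >] then box q else set0).
  apply/seteqP; split=> [[x y] Uxy|[x y] [q _]]; last by case: asboolP => // h /h.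
  have : nbhs (x, y) U by move: oU; rewrite openE; exact.
  rewrite -nbhs_ballE => -[e /= e0 eU].
  have [p1 p1P] := rat_in_itvoo (ltac:(lra) : x - e < x).
  have [p2 p2P] := rat_in_itvoo (ltac:(lra) : x < x + e).
  have [p3 p3P] := rat_in_itvoo (ltac:(lra) : y - e < y).
  have [p4 p4P] := rat_in_itvoo (ltac:(lra) : y < y + e).
  move: p1P p2P p3P p4P; rewrite !in_itv /=.
  move=> /andP[h1 h2] /andP[h3 h4] /andP[h5 h6] /andP[h7 h8].
  exists (p1, p2, p3, p4) => //; case: asboolP => [_|[]].
    by split; rewrite /= in_itv /= ?h2 ?h3 ?h6 ?h7.
  move=> [s t] [] /=; rewrite !in_itv /= => /andP[k1 k2] /andP[k3 k4].
  apply: eU; split; rewrite /ball /= ltr_distlC; apply/andP; split; lra.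
apply: countable_bigcupT_measurable => [|q]; first exact: countableP.
case: asboolP => // _; apply: measurableX; exact: measurable_itv.
Qed.

Lemma continuous_measurable2 F : continuous F -> measurable_fun [set: T2] F.
Proof.
move=> /continuousP cF.
apply: (measurability _ (measurable_realfun.RGenOpens.measurableE R)).
move=> _ [_ [a [b ->] <-]]; rewrite setTI.
by apply: open_measurable2; apply: cF; exact: interval_open.
Qed.

Definition rect a b c d : set (R * R) := `[a, b] `*` `[c, d].

Lemma measurable_rect a b c d : measurable (rect a b c d : set T2).
Proof. by apply: measurableX; exact: measurable_itv. Qed.

Lemma compact_rect a b c d : compact (rect a b c d).
Proof. by apply: compact_setX; exact: segment_compact. Qed.

Lemma rect_lty a b c d : (mu2 (rect a b c d) < +oo)%E.
Proof.
have -> : mu2 (rect a b c d) = (mu `[a, b]%classic * mu `[c, d]%classic)%E.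
  by apply: product_measure1E; exact: measurable_itv.
have h s t : mu `[s, t]%classic \is a fin_num.
  by rewrite /= lebesgue_measure_itv /=; case: ifP.
by rewrite -ge0_fin_numE ?mule_ge0// fin_numM.
Qed.

Lemma compact_bound F (A : set (R * R)) : continuous F -> compact A ->
  exists2 M, 0 <= M & forall z, A z -> `|F z| <= M.
Proof.
move=> cF cA.
have /compact_bounded[M [_ mrt]] :=
  continuous_compact (continuous_subspaceT cF) cA.
exists (`|M| + 1); first by rewrite addr_ge0.
by move=> z Az; apply: mrt; [rewrite (le_lt_trans (ler_norm _))// ltrDl|exists z].
Qed.

Lemma rect_integrable a b c d F : continuous F ->
  mu2.-integrable (rect a b c d) (EFin \o F).
Proof.
move=> cF; apply: measurable_bounded_integrable.
- exact: measurable_rect.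
- exact: rect_lty.
- by apply: measurable_funTS; exact: continuous_measurable2.
- have [M M0 MP] := compact_bound cF (@compact_rect a b c d).
  exists M; split; rewrite ?num_real// => x Mx z Az.
  by apply: le_trans (MP _ Az) _; exact: ltW.
Qed.

Lemma cont_slice1 F y : continuous F -> continuous (fun x => F (x, y)).
Proof.
move=> cF x; apply: (@continuous_comp _ _ _ (fun x => (x, y)) F); last exact: cF.
by apply: (@cvg_pair _ _ _ (nbhs x) (nbhs x) (nbhs y) _ _ _ id (fun=> y)); [exact: cvg_id|exact: cvg_cst].
Qed.

Lemma cont_slice2 F x : continuous F -> continuous (fun y => F (x, y)).
Proof.
move=> cF y; apply: (@continuous_comp _ _ _ (fun y => (x, y)) F); last exact: cF.
by apply: (@cvg_pair _ _ _ (nbhs y) (nbhs x) (nbhs y) _ _ _ (fun=> x) id); [exact: cvg_cst|exact: cvg_id].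
Qed.

Lemma rect_patchE a b c d F x y : (F \_ (rect a b c d)) (x, y) =
  if (x \in `[a, b]) && (y \in `[c, d]) then F (x, y) else 0.
Proof.
rewrite patchE (_ : ((x, y) \in rect a b c d) = (x \in `[a, b]) && (y \in `[c, d]))//.
by apply/idP/idP => [|/andP[? ?]]; rewrite inE => // -[/= -> ->].
Qed.

Lemma itv_patchE (f : R -> \bar R) a b x : (f \_ `[a, b]%classic) x =
  if x \in `[a, b] then f x else 0%E.
Proof. by rewrite patchE (_ : (x \in `[a, b]%classic) = (x \in `[a, b])) ?mem_setE. Qed.

Lemma rect_fubini a b c d F : continuous F ->
  \int[mu2]_(z in rect a b c d) F z = itg c d (fun y => itg a b (fun x => F (x, y))).
Proof.
move=> cF; have iF := @rect_integrable a b c d F cF.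
have mR := @measurable_rect a b c d.
rewrite Rintegral_mkcond.
have iFr : mu2.-integrable setT (EFin \o (F \_ (rect a b c d))).
  by rewrite -restrict_EFin; apply/integrable_restrict => //; rewrite setTI.
rewrite /Rintegral -(integral21_prod_meas1 iFr) /itg /Rintegral.
rewrite [in RHS]integral_mkcond; congr fine; apply: eq_integral => y _.
rewrite /fubini_G itv_patchE; case: ifPn => yP.
  rewrite fineK; last first.
    apply: integrable_fin_num => //; apply: cont_on_integrable => x _.
    exact: cont_slice1.
  rewrite [in RHS]integral_mkcond; apply: eq_integral => x _.
  by rewrite itv_patchE /= rect_patchE yP andbT; case: ifP.
rewrite (eq_integral (cst 0%E)) ?integral0// => x _ /=.
by rewrite rect_patchE (negbTE yP) andbF.
Qed.

Lemma rect_fubini' a b c d F : continuous F ->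
  \int[mu2]_(z in rect a b c d) F z = itg a b (fun x => itg c d (fun y => F (x, y))).
Proof.
move=> cF; have iF := @rect_integrable a b c d F cF.
have mR := @measurable_rect a b c d.
rewrite Rintegral_mkcond.
have iFr : mu2.-integrable setT (EFin \o (F \_ (rect a b c d))).
  by rewrite -restrict_EFin; apply/integrable_restrict => //; rewrite setTI.
rewrite /Rintegral -(integral12_prod_meas1 iFr) /itg /Rintegral.
rewrite [in RHS]integral_mkcond; congr fine; apply: eq_integral => x _.
rewrite /fubini_F itv_patchE; case: ifPn => xP.
  rewrite fineK; last first.
    apply: integrable_fin_num => //; apply: cont_on_integrable => y _.
    exact: cont_slice2.
  rewrite [in RHS]integral_mkcond; apply: eq_integral => y _.
  by rewrite itv_patchE /= rect_patchE xP andTb; case: ifP.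
rewrite (eq_integral (cst 0%E)) ?integral0// => y _ /=.
by rewrite rect_patchE (negbTE xP) andFb.
Qed.

Lemma cont_param_itg a b F : continuous F ->
  continuous (fun y => itg a b (fun x => F (x, y))).
Proof.
move=> cF y0.
have [M M0 MP] := compact_bound cF (@compact_rect a b (y0 - 1) (y0 + 1)).
have mI := measurable_itv `[a, b] : measurable (`[a, b]%classic : set (measurableTypeR R)).
have i1 y : `]y0 - 1, y0 + 1[%classic y ->
    mu.-integrable `[a, b] (EFin \o (fun x => F (x, y))).
  by move=> _; apply: cont_on_integrable => x _; exact: cont_slice1.
have i2 : {ae mu, forall x, `[a, b]%classic x ->
    {in `]y0 - 1, y0 + 1[%classic, continuous (fun y => F (x, y))}}.
  by apply/aeW => x _ y _; exact: cont_slice2.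
have i3 : mu.-integrable `[a, b] (EFin \o (fun _ : R => M)).
  by apply: cont_on_integrable => x _; exact: contC.
have i4 y : `]y0 - 1, y0 + 1[%classic y ->
    {ae mu, forall x, `[a, b]%classic x -> `|F (x, y)| <= M}.
  rewrite /= in_itv /= => /andP[/ltW y1 /ltW y2]; apply/aeW => x xab.
  by apply: MP; split => //=; rewrite in_itv /= y1.
apply: (continuity_under_integral mI i1 i2 i3 i4).
by rewrite inE /= in_itv /=; apply/andP; split; lra.
Qed.

Lemma der_param_itg a b F dF : continuous F -> continuous dF ->
  (forall x y, is_derive y 1 (fun t => F (x, t)) (dF (x, y))) ->
  forall y, is_derive y 1 (fun y => itg a b (fun x => F (x, y)))
    (itg a b (fun x => dF (x, y))).
Proof.
move=> cF cdF dFP y0.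
have [M M0 MP] := compact_bound cdF (@compact_rect a b (y0 - 1) (y0 + 1)).
have I0 : `]y0 - 1, y0 + 1[%classic y0 by rewrite /= in_itv /=; apply/andP; split; lra.
have i1 y : `]y0 - 1, y0 + 1[%classic y ->
    mu.-integrable `[a, b] (EFin \o (fun x => F (x, y))).
  by move=> _; apply: cont_on_integrable => x _; exact: cont_slice1.
have i2 y x : `]y0 - 1, y0 + 1[%classic y -> `[a, b]%classic x ->
    derivable (fun t => F (x, t)) y 1.
  by move=> _ _; case: (dFP x y).
have i3 : mu.-integrable `[a, b] (EFin \o (fun _ : R => M)).
  by apply: cont_on_integrable => x _; exact: contC.
have pE y x : partial1of2 (fun y x => F (x, y)) y x = dF (x, y).
  by rewrite /partial1of2 (derE (dFP x y)).
have i4 y x : `]y0 - 1, y0 + 1[%classic y -> `[a, b]%classic x ->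
    `|partial1of2 (fun y x => F (x, y)) y x| <= M.
  rewrite pE /= in_itv /= => /andP[/ltW y1 /ltW y2] xab.
  by apply: MP; split => //=; rewrite in_itv /= y1.
have mI := measurable_itv `[a, b] : measurable (`[a, b]%classic : set (measurableTypeR R)).
have D1 := derivable_under_integral mI I0 i1 i2 (fun=> M0) i3 i4.
have D2 := differentiation_under_integral mI I0 i1 i2 (fun=> M0) i3 i4.
split; first exact: D1.
rewrite -derive1E D2 /itg.
by apply: eq_Rintegral => x _; rewrite pE.
Qed.

Definition plane_C1 u u1 u2 :=
  [/\ continuous u, continuous u1, continuous u2,
      forall x y, is_derive x 1 (fun t => u (t, y)) (u1 (x, y)) &
      forall x y, is_derive y 1 (fun t => u (x, t)) (u2 (x, y))].

Lemma cont_mulfst F (g : R -> R) : continuous F -> continuous g ->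
  continuous (fun z : R * R => F z * g z.1).
Proof.
move=> cF cg z; apply: (@continuousM _ _ F (fun z => g z.1)); first exact: cF.
by apply: (@continuous_comp _ _ _ fst g); [exact: cvg_fst|exact: cg].
Qed.

(** Expand the horizontal slices of u in sine modes.  Slice by slice, the modes
    with wave number at least sqrt L are paid for by u1.  The coefficient c of
    another mode is a function of the height; its Poincare inequality on N j
    cells, whose sharp constant is at least L - w^2, is paid for by the same
    coefficient of u2, and the sum of the squares of these coefficients is
    controlled by Bessel. *)
Lemma rect_inequality a b c d u u1 u2 (L : R) (M : nat) (N : 'I_M -> nat) :
  a < b -> c < d -> plane_C1 u u1 u2 ->
  (forall y, c <= y <= d -> u (a, y) = 0 /\ u (b, y) = 0) ->
  (forall j : 'I_M, wavenumber a b j.+1 ^+ 2 < L) -> L <= wavenumber a b M.+1 ^+ 2 ->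
  (forall j : 'I_M, (0 < N j)%N /\
     L - wavenumber a b j.+1 ^+ 2 <= (pi / ((d - c) / (N j)%:R)) ^+ 2) ->
  L * \int[mu2]_(z in rect a b c d) u z ^+ 2 <=
  \int[mu2]_(z in rect a b c d) (u1 z ^+ 2 + u2 z ^+ 2) +
  \sum_(j < M) \sum_(i < N j)
    (L - wavenumber a b j.+1 ^+ 2) / ((b - a) / 2 * ((d - c) / (N j)%:R)) *
    (\int[mu2]_(z in rect a b (c + i%:R * ((d - c) / (N j)%:R))
        (c + i.+1%:R * ((d - c) / (N j)%:R))) (u z * sine_mode a b j.+1 z.1)) ^+ 2.
Proof.
move=> ab cd [cu cu1 cu2 du1 du2] ubc wL Lw NP.
set w := wavenumber a b; set K := (b - a) / 2; set H := d - c.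
have K0 : 0 < K by rewrite divr_gt0// subr_gt0.
have H0 : 0 < H by rewrite subr_gt0.
pose s := sine_mode a b.
have cs m : continuous (s m) by move=> x; exact: cont_sine_mode.
have csq (v : R * R -> R) : continuous v -> continuous (fun z : R * R => v z ^+ 2).
  by move=> cv z; apply: (@continuous_comp _ _ _ v (fun x => x ^+ 2)); [exact: cv|exact: exprn_continuous].
have cadd (v v' : R * R -> R) : continuous v -> continuous v' -> continuous (fun z : R * R => v z + v' z).
  by move=> cv cv' z; apply: (@continuousD _ _ _ v v'); [exact: cv|exact: cv'].
pose cj (j : 'I_M) y := itg a b (fun x => u (x, y) * s j.+1 x).
pose ej (j : 'I_M) y := itg a b (fun x => u2 (x, y) * s j.+1 x).
have ccj j : continuous (cj j).
  exact: (@cont_param_itg a b _ (cont_mulfst cu (cs j.+1))).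
have cej j : continuous (ej j).
  exact: (@cont_param_itg a b _ (cont_mulfst cu2 (cs j.+1))).
have dcj j y : is_derive y 1 (cj j) (ej j y).
  apply: (@der_param_itg a b (fun z => u z * s j.+1 z.1) (fun z => u2 z * s j.+1 z.1)).
  - exact: cont_mulfst.
  - exact: cont_mulfst.
  - by move=> x t; have h := du2 x t; der; rewrite /=; ring.
pose I (v : R * R -> R) y := itg a b (fun x => v (x, y)).
have cI (v : R * R -> R) : continuous v -> continuous (I v) by exact: cont_param_itg.
pose u' z := u z ^+ 2; pose u1' z := u1 z ^+ 2; pose u2' z := u2 z ^+ 2.
have cIu := cI u' (csq _ cu); have cIu1 := cI u1' (csq _ cu1); have cIu2 := cI u2' (csq _ cu2).
have slice y : c <= y <= d ->
    L * I u' y <= I u1' y + \sum_(j < M) (L - w j.+1 ^+ 2) * cj j y ^+ 2 / K.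
  move=> ycd; have [ua ub] := ubc _ ycd.
  apply: (@sine_inequality R a b M L (fun x => u (x, y)) (fun x => u1 (x, y))) => //.
  by split=> x _; [exact: du1|exact: cont_slice1].
have slice2 y : \sum_(j < M) ej j y ^+ 2 / K <= I u2' y.
  apply: (@sine_bessel R a b M (fun x => u2 (x, y))) => // x _.
  exact: cont_slice1.
have cc (v : R -> R) : continuous v -> cont_on c d v by move=> cv x _; exact: cv.
have cterm (j : 'I_M) : cont_on c d (fun y => (L - w j.+1 ^+ 2) * cj j y ^+ 2 / K).
  by move=> y _; have h := ccj j y; cont.
have h1 : L * itg c d (I u') <= itg c d (I u1') +
    \sum_(j < M) (L - w j.+1 ^+ 2) / K * itg c d (fun y => cj j y ^+ 2).
  rewrite -itgZ; last by move=> y _; exact: cIu.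
  have -> : \sum_(j < M) (L - w j.+1 ^+ 2) / K * itg c d (fun y => cj j y ^+ 2) =
      itg c d (fun y => \sum_(j < M) (L - w j.+1 ^+ 2) * cj j y ^+ 2 / K).
    rewrite itg_sum//; apply: eq_bigr => j _.
    rewrite -itgZ; last by move=> y _; have h := ccj j y; cont.
    by apply: eq_itg => y _; ring.
  have cS y : {for y, continuous (fun y => \sum_(j < M) (L - w j.+1 ^+ 2) * cj j y ^+ 2 / K)}.
    by apply: cont_sum => j; have h := ccj j y; cont.
  rewrite -itgD; [|by move=> y _; exact: cIu1|by move=> y _; exact: cS].
  apply: le_itg => [y _|y _|y]; last exact: slice.
  - by have h := cIu y; cont.
  - by apply: contD; [exact: cIu1|exact: cS].
have h2 : \sum_(j < M) K^-1 * itg c d (fun y => ej j y ^+ 2) <= itg c d (I u2').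
  have -> : \sum_(j < M) K^-1 * itg c d (fun y => ej j y ^+ 2) =
      itg c d (fun y => \sum_(j < M) ej j y ^+ 2 / K).
    rewrite itg_sum; last by move=> j y _; have h := cej j y; cont.
    apply: eq_bigr => j _; rewrite -itgZ; last by move=> y _; have h := cej j y; cont.
    by apply: eq_itg => y _; rewrite mulrC.
  apply: le_itg => [y _|y _|y _]; [|exact: cIu2|exact: slice2].
  by apply: cont_sum => j; have h := cej j y; cont.
have h3 (j : 'I_M) : (L - w j.+1 ^+ 2) / K * itg c d (fun y => cj j y ^+ 2) <=
    K^-1 * itg c d (fun y => ej j y ^+ 2) +
    \sum_(i < N j) (L - w j.+1 ^+ 2) / (K * (H / (N j)%:R)) *
      (itg (c + i%:R * (H / (N j)%:R)) (c + i.+1%:R * (H / (N j)%:R)) (cj j)) ^+ 2.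
  have [N0 LN] := NP j; set dl := H / (N j)%:R.
  have dl0 : 0 < dl by rewrite divr_gt0// ltr0n.
  have dE : c + (N j)%:R * dl = d.
    by rewrite /dl mulrC divfK ?pnatr_eq0 -?lt0n// /H; ring.
  have := @cell_poincare R c dl (N j) (cj j) (ej j) dl0.
  rewrite dE => /(_ (conj (fun y _ => dcj j y) (cc _ (cej j)))).
  rewrite -/dl in LN.
  set S := \sum_(i < _) _; set X := itg c d _; set Y := itg c d _ => hXY.
  have Y0 : 0 <= Y by apply: itg_ge0 => y _; exact: sqr_ge0.
  have wj0 : 0 < L - w j.+1 ^+ 2 by rewrite subr_gt0.
  have -> : \sum_(i < N j) (L - w j.+1 ^+ 2) / (K * dl) *
      (itg (c + i%:R * dl) (c + i.+1%:R * dl) (cj j)) ^+ 2 =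
      (L - w j.+1 ^+ 2) / K * (S / dl).
    rewrite -mulr_sumr -/S; field.
    by rewrite (gt_eqF K0) (gt_eqF dl0).
  rewrite -lerBlDr -mulrBr [leLHS]mulrAC [leLHS]mulrC ler_wpM2l ?invr_ge0 ?(ltW K0)//.
  have [XS|XS] := leP (X - S / dl) 0.
    by apply: le_trans Y0; rewrite mulr_ge0_le0// ltW.
  by apply: le_trans hXY; rewrite ler_wpM2r// ltW.
have e1 (v : R * R -> R) : continuous v -> \int[mu2]_(z in rect a b c d) v z = itg c d (I v).
  by move=> cv; rewrite rect_fubini.
rewrite (e1 _ (csq _ cu)) (e1 _ (cadd _ _ (csq _ cu1) (csq _ cu2))).
have -> : itg c d (I (fun z => u1 z ^+ 2 + u2 z ^+ 2)) = itg c d (I u1') + itg c d (I u2').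
  rewrite -itgD; [|exact: cc|exact: cc]; apply: eq_itg => y _.
  by rewrite /I itgD// => x _; exact: (cont_slice1 (csq _ _)).
apply: le_trans h1 _; rewrite -addrA lerD2l.
apply: le_trans (ler_sum _ (fun j _ => h3 j)) _.
rewrite big_split /= lerD//.
apply: ler_sum => j _; apply: ler_sum => i _.
by rewrite rect_fubini//; exact: cont_mulfst.
Qed.

End Plane.

(** * Completeness of L2 *)

Section RieszFischer.
Context d (T : measurableType d) (R : realType) (mu : {measure set T -> \bar R}).

Lemma limn_einf_le (u : (\bar R)^nat) (c : \bar R) (N : nat) :
  (forall n, (N <= n)%N -> (u n <= c)%E) -> (limn_einf u <= c)%E.
Proof.
move=> uc; rewrite limn_einf_lim; apply: lime_le; first exact: is_cvg_einfs.
apply: nearW => n; apply: le_trans (uc _ (leq_maxr n N)).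
by apply: ereal_inf_lbound; exists (maxn n N) => //=; exact: leq_maxl.
Qed.

(** The increments of h are dominated by a geometric series of ratio 1/2. *)
Lemma cvgn_sqr_summable (h : nat -> R) (s : R) :
  (forall k, 4 ^+ k * (h k.+1 - h k) ^+ 2 <= s) -> cvgn h.
Proof.
move=> hs; have s0 : 0 <= s by apply: le_trans (hs 0%N); rewrite mulr_ge0 ?sqr_ge0// exprn_ge0.
have cs : cvgn (series (telescope h)).
  apply: normed_cvg; apply: (@series_le_cvg _ _ (geometric (Num.sqrt s) 2^-1)).
  - by move=> n; exact: normr_ge0.
  - by move=> n; rewrite /geometric /= mulr_ge0 ?sqrtr_ge0// exprn_ge0// invr_ge0.
  - move=> n; rewrite /geometric /telescope /=.
    rewrite exprVn ler_pdivlMr ?exprn_gt0// -[leLHS]ger0_norm; last first.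
      by rewrite mulr_ge0// exprn_ge0.
    rewrite -sqrtr_sqr ler_wsqrtr// exprMn -exprM mulnC exprM mulrC.
    rewrite (_ : 2 ^+ 2 = 4 :> R); last by rewrite expr2; ring.
    by rewrite real_normK ?num_real.
  - by apply: is_cvg_geometric_series; rewrite ger0_norm ?invr_ge0// invf_lt1// ltr1n.
have -> : h = (fun n => series (telescope h) n + h 0%N).
  by apply/funext => n; rewrite telescopeK /= subrK.
by apply: is_cvgD => //; exact: is_cvg_cst.
Qed.

(** Along a fast subsequence the weighted sum of the squared increments is
    integrable, hence finite almost everywhere, where the subsequence converges.
    Fatou then bounds the distance to the limit. *)
Lemma riesz_fischer (f : nat -> T -> R) :
  (forall n, measurable_fun [set: T] (f n)) ->
  (forall e : R, 0 < e -> exists N, forall m n, (N <= m)%N -> (N <= n)%N ->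
     (\int[mu]_x ((f m x - f n x) ^+ 2)%:E <= e%:E)%E) ->
  exists2 g : T -> R, measurable_fun [set: T] g &
    forall e : R, 0 < e -> exists N, forall n, (N <= n)%N ->
     (\int[mu]_x ((f n x - g x) ^+ 2)%:E <= e%:E)%E.
Proof.
move=> mf cf.
have [phi phiP] : exists phi : nat -> nat, forall k m n, (phi k <= m)%N -> (phi k <= n)%N ->
     (\int[mu]_x ((f m x - f n x) ^+ 2)%:E <= (8^-1 ^+ k)%:E)%E.
  have ex k : exists N, forall m n, (N <= m)%N -> (N <= n)%N ->
     (\int[mu]_x ((f m x - f n x) ^+ 2)%:E <= (8^-1 ^+ k)%:E)%E.
    by apply: cf; rewrite exprn_gt0// invr_gt0.
  by exists (fun k => projT1 (cid (ex k))) => k; case: (cid (ex k)).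
(* An index beyond phi 0, ..., phi k: the k-th squared increment of the
   subsequence h has integral at most 8^-k, and 4^k 8^-k is summable. *)
pose psi k := (\sum_(i < k.+1) phi i)%N.
have psi_phi k m : (k <= m)%N -> (phi k <= psi m)%N.
  move=> km; rewrite /psi (bigD1 (Ordinal (km : (k < m.+1)%N)))//=.
  exact: leq_addr.
pose h k := f (psi k).
have mh k : measurable_fun [set: T] (h k) by exact: mf.
pose D k x : R := 4 ^+ k * (h k.+1 x - h k x) ^+ 2.
have D0 k x : 0 <= D k x by rewrite mulr_ge0 ?sqr_ge0// exprn_ge0.
have mD k : measurable_fun [set: T] (EFin \o D k).
  apply/measurable_EFinP/measurable_funM => //.
  by apply: measurable_funX; exact: measurable_funB.
pose S x := (\sum_(0 <= k <oo) (D k x)%:E)%E.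
have mS : measurable_fun [set: T] S.
  rewrite /S (_ : (fun _ => _) = fun x => \sum_(k <oo | k \in xpredT) (D k x)%:E)%E//.
  apply: ge0_emeasurable_sum => [k x _ _|k _]; [by rewrite lee_fin|exact: mD].
have S0 x : (0 <= S x)%E by apply: nneseries_ge0 => k _ _; rewrite lee_fin.
have iS : (\int[mu]_x S x <= 2%:E)%E.
  rewrite /S integral_nneseries//; last by move=> k x _; rewrite lee_fin.
  apply: (@le_trans _ _ (\sum_(0 <= k <oo) (2 / (2 ^ k.+1)%:R)%:E)%E); last first.
    exact: (@epsilon_trick0 R 2 xpredT).
  apply: lee_nneseries => [k _ _|k _].
    by apply: integral_ge0 => x _; rewrite lee_fin.
  rewrite (_ : (fun x => _) = fun x => ((4 ^+ k)%:E * ((h k.+1 x - h k x) ^+ 2)%:E)%E)//.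
  rewrite ge0_integralZl//.
  - apply: le_trans (lee_wpmul2l _ (phiP k _ _ (psi_phi _ _ (leqnSn k)) (psi_phi _ _ (leqnn k)))) _.
      by rewrite lee_fin exprn_ge0.
    rewrite -EFinM lee_fin natrX exprS invfM mulrA mulfV// mul1r -exprVn -exprMn.
    by rewrite le_eqVlt; apply/orP; left; apply/eqP; congr (_ ^+ _); field.
  - by apply/measurable_EFinP/measurable_funX; exact: measurable_funB.
  - by move=> x _; rewrite lee_fin sqr_ge0.
have aS : {ae mu, forall x, cvgn (h^~ x)}.
  have inS : mu.-integrable setT S.
    apply/integrableP; split=> //; apply: le_lt_trans (ltry 2).
    by under eq_integral => x _ do rewrite gee0_abs//.
  have := integrable_ae measurableT inS; apply: filterS => x /(_ I) Sx.
  apply: (@cvgn_sqr_summable _ (fine (S x))) => k.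
  rewrite -lee_fin fineK//.
  apply: (@le_trans _ _ (\sum_(0 <= i < k.+1) (D i x)%:E)%E).
    rewrite big_nat_recr//= leeDr//; apply: sume_ge0 => i _; by rewrite lee_fin.
  by apply: nneseries_lim_ge => i _ _; rewrite lee_fin.
pose g x := fine (limn_esup (fun k => (h k x)%:E)).
have mg : measurable_fun [set: T] g.
  apply: measurableT_comp => //; apply: measurable_fun_limn_esup => k.
  exact/measurable_EFinP.
have gP x : cvgn (h^~ x) -> h^~ x @ \oo --> g x.
  move=> cx; have cE : EFin \o h^~ x @ \oo --> (limn (h^~ x))%:E.
    by apply: cvg_comp cx _; exact: cvg_refl.
  by rewrite /g is_cvg_limn_esupE; [rewrite (cvg_lim _ cE)|apply: cvgP cE].
exists g => // e e0.
(* The distance to g is the limit of the distances to h k, which are at most 8^-K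
   beyond rank K. *)
have [K KP] : exists K : nat, 8^-1 ^+ K <= e :> R.
  have /cvgrPdist_le/(_ _ e0)[K _ /(_ K (leqnn _))] :
      (fun k => 8^-1 ^+ k : R) @ \oo --> (0 : R).
    by apply: cvg_expr; rewrite ger0_norm ?invr_ge0// invf_lt1// ltr1n.
  by rewrite /= sub0r normrN ger0_norm ?exprn_ge0 ?invr_ge0// => ?; exists K.
exists (psi K) => n Kn.
have mnh k : measurable_fun [set: T] (EFin \o (fun x => (f n x - h k x) ^+ 2 : R)).
  by apply/measurable_EFinP/measurable_funX; exact: measurable_funB.
have -> : (\int[mu]_x ((f n x - g x) ^+ 2)%:E =
    \int[mu]_x limn_einf (fun k => ((f n x - h k x) ^+ 2)%:E))%E.
  apply: ae_eq_integral => //.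
  - by apply/measurable_EFinP/measurable_funX; exact: measurable_funB.
  - rewrite (_ : (fun x => _) = fun x => - limn_esup (fun k => (- ((f n x - h k x) ^+ 2)%:E)))%E; last first.
      by apply/funext => x; rewrite -[LHS]oppeK -limn_esupN.
    apply: measurableT_comp => //; apply: measurable_fun_limn_esup => k.
    by apply: (@measurableT_comp _ _ _ _ _ _ (@oppe R)) => //; exact: mnh.
  - apply: filterS aS => x cx _; have hg := gP _ cx.
    have cE : (fun k => ((f n x - h k x) ^+ 2)%:E) @ \oo --> ((f n x - g x) ^+ 2)%:E.
      apply: cvg_EFin; first exact: nearW.
      by apply: cvgM; apply: cvgB => //; exact: cvg_cst.
    by rewrite is_cvg_limn_einfE; [rewrite (cvg_lim _ cE)|apply: cvgP cE].
apply: le_trans (fatou _ _ _ _) _ => //.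
  by move=> k x _; rewrite lee_fin sqr_ge0.
apply: (@limn_einf_le _ _ K) => k Kk; apply: le_trans (phiP K _ _ _ _) _.
- by apply: leq_trans Kn; exact: psi_phi.
- exact: psi_phi.
- by rewrite lee_fin.
Qed.

End RieszFischer.

(** * L2 of a planar set *)

Section L2Space.
Context {R : realType} (O : set (R * R)).
Local Notation T2 := (measurableTypeR R * measurableTypeR R)%type.
Local Notation mu2 := (lebesgue2 R).
Hypothesis mO : measurable (O : set T2).
Implicit Types (f g : R * R -> R).

Definition ip f g := \int[mu2]_(x in O) (f x * g x).

Lemma restrE f z : (f \_ O) z = if z \in O then f z else 0.
Proof. by rewrite patchE. Qed.

Lemma restr_lin k f g : (k *: f + g) \_ O = (k \o* (f \_ O)) + g \_ O.
Proof.
apply/funext => z; rewrite !fctE /= !restrE; case: ifP => _.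
  by rewrite /GRing.scale /= mulrC.
by rewrite mul0r addr0.
Qed.

Lemma restr_mul f g : (f \_ O) \* (g \_ O) = (fun z => f z * g z) \_ O.
Proof.
by apply/funext => z; rewrite /= !restrE; case: ifP => _ //; rewrite mul0r.
Qed.

Lemma integrable_restr f :
  mu2.-integrable O (EFin \o f) <-> mu2.-integrable [set: T2] (EFin \o (f \_ O)).
Proof.
have := integrable_restrict mu2 mO measurableT (EFin \o f).
by rewrite setTI restrict_EFin.
Qed.

Lemma L2_lin k f g : L2 O f -> L2 O g -> L2 O (k *: f + g).
Proof.
move=> hf hg; rewrite /L2 restr_lin.
have one2 : (1 <= 2 :> R) by rewrite ler1n.
have [_ h] := @Lfun_addr_closed _ T2 R mu2 2%:E (ltac:(by rewrite lee_fin)).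
by apply: h => //; exact: Lfun_scale.
Qed.

Lemma L2_0 : L2 O 0.
Proof.
rewrite /L2 (_ : 0 \_ O = 0); last by apply/funext => z; rewrite restrE; case: ifP.
have [h _] := @Lfun_addr_closed _ T2 R mu2 2%:E (ltac:(by rewrite lee_fin ler1n)).
exact: h.
Qed.

Lemma L2_subspace : subspace (L2 O).
Proof. by split; [exact: L2_0|exact: L2_lin]. Qed.

Lemma L2_measurable f : L2 O f -> measurable_fun [set: T2] (f \_ O).
Proof. by rewrite /L2 inE => /andP[]; rewrite inE. Qed.

Lemma L2_mul_integrable f g : L2 O f -> L2 O g ->
  mu2.-integrable O (EFin \o (fun z => f z * g z)).
Proof.
move=> hf hg; apply/integrable_restr; rewrite -restr_mul.
by apply/Lfun1_integrable; exact: Lfun2_mul_Lfun1.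
Qed.

Lemma L2_form : positive_form (L2 O) ip.
Proof.
split=> [u v _ _|k u v w hu hv hw|u hu].
- by apply: eq_Rintegral => z _; rewrite mulrC.
- rewrite /ip -RintegralZl//; last exact: L2_mul_integrable.
  rewrite -RintegralD//.
  + by apply: eq_Rintegral => z _; rewrite !fctE /GRing.scale /=; ring.
  + rewrite (_ : (fun x => _) = (fun z => (k *: u) z * w z)); last first.
      by apply/funext => z; rewrite fctE /GRing.scale /= mulrA.
    apply: L2_mul_integrable => //.
    by rewrite -[k *: u]addr0; apply: L2_lin => //; exact: L2_0.
  + exact: L2_mul_integrable.
- by apply: Rintegral_ge0 => z _; rewrite -expr2 sqr_ge0.
Qed.

Lemma ipE f : L2 O f -> (\int[mu2]_x (((f \_ O) x) ^+ 2)%:E = (ip f f)%:E)%E.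
Proof.
move=> hf; rewrite /ip Rintegral_mkcond /Rintegral fineK.
  apply: eq_integral => z _; congr EFin.
  by rewrite !restrE; case: ifP => _; rewrite expr2// mul0r.
apply: integrable_fin_num => //; apply/integrable_restr.
exact: L2_mul_integrable.
Qed.

Lemma L2_normE f : L2 O f -> L2norm O f = (Num.sqrt (ip f f))%:E.
Proof.
move=> hf; rewrite /L2norm unlock.
have -> : (\int[mu2]_x (`|(EFin \o f \_ O) x| `^ 2) =
    \int[mu2]_x (((f \_ O) x) ^+ 2)%:E)%E.
  apply: eq_integral => z _ /=.
  by rewrite powR_mulrn// real_normK// num_real.
rewrite ipE// poweR_EFin powR12_sqrt//.
by apply: (form_ge0 L2_form).
Qed.

Lemma L2_norm_lt f (e : R) : L2 O f -> 0 < e -> (L2norm O f < e%:E)%E = (ip f f < e ^+ 2).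
Proof.
move=> hf e0; rewrite L2_normE// lte_fin.
rewrite -[in RHS](sqr_sqrtr (form_ge0 L2_form hf)) ltr_pXn2r// nnegrE ?sqrtr_ge0//.
exact: ltW.
Qed.

Lemma L2_intro f : measurable_fun [set: T2] (f \_ O) ->
  (\int[mu2]_x (((f \_ O) x) ^+ 2)%:E < +oo)%E -> L2 O f.
Proof.
move=> mf fy; rewrite /L2 inE; apply/andP; split; rewrite inE //=.
rewrite /finite_norm unlock poweR_lty//.
have -> // : (\int[mu2]_x (`|(EFin \o f \_ O) x| `^ 2) =
    \int[mu2]_x (((f \_ O) x) ^+ 2)%:E)%E.
by apply: eq_integral => z _ /=; rewrite powR_mulrn// real_normK// num_real.
Qed.

Lemma L2_complete (f : nat -> R * R -> R) : (forall n, L2 O (f n)) ->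
  (forall e : R, 0 < e -> exists N, forall m n, (N <= m)%N -> (N <= n)%N ->
     ip (f m - f n) (f m - f n) < e) ->
  exists2 g, L2 O g & forall e : R, 0 < e -> exists N, forall n, (N <= n)%N ->
     ip (f n - g) (f n - g) < e.
Proof.
move=> hf cf.
have subE (u v : R * R -> R) : (u - v) \_ O = (fun z => (u \_ O) z - (v \_ O) z).
  by apply/funext => z; rewrite !restrE; case: ifP => _ //; rewrite subrr.
have L2B (u v : R * R -> R) : L2 O u -> L2 O v -> L2 O (u - v).
  by move=> hu hv; exact: (subspaceB L2_subspace).
have [||g mg gP] := @riesz_fischer _ T2 R mu2 (fun n => f n \_ O).
- by move=> n; exact: L2_measurable.
- move=> e e0; have [N NP] := cf e e0; exists N => m n Nm Nn.
  have := ipE (L2B _ _ (hf m) (hf n)); rewrite subE => ->.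
  by rewrite lee_fin ltW// NP.
have gE n : (f n - g) \_ O = (fun z => (f n \_ O) z - g z) \_ O.
  by apply/funext => z; rewrite !restrE; case: ifP => // ->.
have mgO : measurable_fun [set: T2] (g \_ O).
  by apply: (measurable_restrictT _ mO).1; exact: measurable_funTS.
have le_restr n : (\int[mu2]_z ((((f n - g) \_ O) z) ^+ 2)%:E <=
    \int[mu2]_z (((f n \_ O) z - g z) ^+ 2)%:E)%E.
  apply: ge0_le_integral => //.
  - by move=> z _; rewrite lee_fin sqr_ge0.
  - apply/measurable_EFinP/measurable_funX; rewrite subE; apply: measurable_funB => //.
    exact: L2_measurable.
  - by apply/measurable_EFinP/measurable_funX; apply: measurable_funB => //; exact: L2_measurable.
  - move=> z _; rewrite lee_fin gE [X in X ^+ 2 <= _]restrE; case: ifP => // _.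
    by rewrite expr0n sqr_ge0.
have hd n : (\int[mu2]_z (((f n \_ O) z - g z) ^+ 2)%:E < +oo)%E -> L2 O (f n - g).
  move=> fin; apply: L2_intro; last exact: le_lt_trans (le_restr n) fin.
  by rewrite subE; apply: measurable_funB => //; exact: L2_measurable.
have hg : L2 O g.
  have [N NP] := gP 1 ltr01.
  have := L2B _ _ (hf N) (hd N (le_lt_trans (NP N (leqnn _)) (ltry 1))).
  by rewrite opprB addrC subrK.
exists g => // e e0; have [N NP] := gP (e / 2) (divr_gt0 e0 (ltr0n R 2)).
exists N => n Nn; rewrite -lte_fin -ipE; last exact: L2B.
apply: le_lt_trans (le_restr n) _; apply: le_lt_trans (NP n Nn) _.
by rewrite lte_fin; lra.
Qed.

End L2Space.

(** * Test functions and integration by parts *)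

Section TestFunctions.
Context {R : realType}.
Local Notation T2 := (measurableTypeR R * measurableTypeR R)%type.
Local Notation mu2 := (lebesgue2 R).
Local Notation D1 f := ('D_(e1 R) f).
Local Notation D2 f := ('D_(e2 R) f).
Implicit Types (O : set (R * R)) (f g u v phi psi : R * R -> R).

Lemma slice1E f x y : (fun h : R => h^-1 *: ((f \o shift (x, y)) (h *: e1 R) - f (x, y))) =
  (fun h : R => h^-1 *: (((fun t => f (t, y)) \o shift x) (h *: (1 : R)) - f (x, y))).
Proof.
apply/funext => h /=; congr (_ *: (f _ - _)).
by apply/pair_equal_spec; split; rewrite /= ?scaler0 ?add0r.
Qed.

Lemma slice2E f x y : (fun h : R => h^-1 *: ((f \o shift (x, y)) (h *: e2 R) - f (x, y))) =
  (fun h : R => h^-1 *: (((fun t => f (x, t)) \o shift y) (h *: (1 : R)) - f (x, y))).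
Proof.
apply/funext => h /=; congr (_ *: (f _ - _)).
by apply/pair_equal_spec; split; rewrite /= ?scaler0 ?add0r.
Qed.

Lemma der_slice1 f x y d : is_derive (x, y) (e1 R) f d <->
  is_derive x 1 (fun t => f (t, y)) d.
Proof.
by split=> -[h1 h2]; split;
  move: h1 h2; rewrite /derivable /derive slice1E.
Qed.

Lemma der_slice2 f x y d : is_derive (x, y) (e2 R) f d <->
  is_derive y 1 (fun t => f (x, t)) d.
Proof.
by split=> -[h1 h2]; split;
  move: h1 h2; rewrite /derivable /derive slice2E.
Qed.

Lemma der_partial1 f z : derivable f z (e1 R) ->
  is_derive z.1 1 (fun t => f (t, z.2)) (D1 f z).
Proof. by case: z => x y h; apply/der_slice1; apply: DeriveDef. Qed.

Lemma der_partial2 f z : derivable f z (e2 R) ->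
  is_derive z.2 1 (fun t => f (z.1, t)) (D2 f z).
Proof. by case: z => x y h; apply/der_slice2; apply: DeriveDef. Qed.

(** What integration by parts uses of test functions; unlike smoothness to all
    orders, it passes to products at once. *)
Definition compact_C1 O u u1 u2 := plane_C1 u u1 u2 /\
  exists K, [/\ compact K, K `<=` O &
    forall z, ~ K z -> [/\ u z = 0, u1 z = 0 & u2 z = 0]].

Lemma test_compact_C1 O phi : test_function O phi -> compact_C1 O phi (D1 phi) (D2 phi).
Proof.
move=> [phiC cK KO]; have [d [_ _ d1c] [_ _ d2c]] := phiC 2%N.
have c0 := phiC 0%N; have [_ c1 c2] := phiC 1%N.
split.
  split=> //.
  - by move=> x y; exact: (@der_partial1 phi (x, y) (d (x, y)).1).
  - by move=> x y; exact: (@der_partial2 phi (x, y) (d (x, y)).2).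
exists (closure [set x | phi x != 0]); split=> // z Kz.
have zE : \forall w \near z, cst 0 w = phi w.
  have : nbhs z (~` closure [set x | phi x != 0]).
    by apply: open_nbhs_nbhs; split=> //; exact/closed_openC/closed_closure.
  apply: filterS => w /= Kw; apply/esym/eqP; apply: contrapT => /negP pw.
  by apply: Kw; exact: subset_closure.
split; first by have := nbhs_singleton zE.
  by rewrite -(near_eq_derive (e1 R) zE) derive_cst.
by rewrite -(near_eq_derive (e2 R) zE) derive_cst.
Qed.

Lemma derive_lin k f g (w : R * R) :
  (forall x, derivable f x w) -> (forall x, derivable g x w) ->
  'D_w (k *: f + g) = k *: 'D_w f + 'D_w g.
Proof.
move=> hf hg; apply/funext => x; rewrite deriveD//; last exact: derivableZ.
by rewrite deriveZ.
Qed.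

Lemma Cn_lin n k f g : Cn n f -> Cn n g -> Cn n (k *: f + g).
Proof.
elim: n f g => [|n IH] f g /=.
  move=> cf cg z; apply: (@continuousD _ _ _ (k *: f) g); last exact: cg.
  by apply: (@continuousM _ _ (cst k) f); [exact: cvg_cst|exact: cf].
move=> [df f1 f2] [dg g1 g2].
have df1 x : derivable f x (e1 R) by case: (df x).
have df2 x : derivable f x (e2 R) by case: (df x).
have dg1 x : derivable g x (e1 R) by case: (dg x).
have dg2 x : derivable g x (e2 R) by case: (dg x).
split.
- by move=> x; split; apply: derivableD => //; exact: derivableZ.
- by rewrite (derive_lin k df1 dg1); exact: IH.
- by rewrite (derive_lin k df2 dg2); exact: IH.
Qed.

Lemma Cn_derive n k f g : Cn n.+1 f -> Cn n.+1 g ->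
  D1 (k *: f + g) = k *: D1 f + D1 g /\ D2 (k *: f + g) = k *: D2 f + D2 g.
Proof.
move=> [df _ _] [dg _ _].
have df1 x : derivable f x (e1 R) by case: (df x).
have df2 x : derivable f x (e2 R) by case: (df x).
have dg1 x : derivable g x (e1 R) by case: (dg x).
have dg2 x : derivable g x (e2 R) by case: (dg x).
by split; [rewrite (derive_lin k df1 dg1)|rewrite (derive_lin k df2 dg2)].
Qed.

Lemma test_lin O k phi psi : test_function O phi -> test_function O psi ->
  test_function O (k *: phi + psi).
Proof.
move=> [c1 k1 s1] [c2 k2 s2].
have sub : closure [set x | (k *: phi + psi) x != 0] `<=`
    closure [set x | phi x != 0] `|` closure [set x | psi x != 0].
  rewrite -closureU; apply: closureS => x /= h.
  apply: contrapT => /not_orP[/negP/negPn/eqP h1 /negP/negPn/eqP h2].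
  by move: h; rewrite !fctE h1 h2 scaler0 addr0 eqxx.
split.
- by move=> n; apply: Cn_lin.
- apply: subclosed_compact sub; first exact: closed_closure.
  exact: compactU.
- by apply: subset_trans sub _ => x [/s1|/s2].
Qed.

Lemma test_0 O : test_function O 0.
Proof.
have z0 : [set x : R * R | (0 : R * R -> R) x != 0] = set0.
  by apply/seteqP; split=> x //=; rewrite eqxx.
split; rewrite ?z0 ?closure0//; last exact: compact0.
have D0 (w : R * R) : 'D_w (0 : R * R -> R) = 0 by apply/funext => x; rewrite derive_cst.
elim=> [|n IH] /=; first by move=> x; exact: cvg_cst.
by split; rewrite ?D0// => x; split; exact: derivable_cst.
Qed.

Lemma compact_in_rect (K : set (R * R)) : compact K -> exists2 m : R, 0 < m &
  forall z, K z -> - m < z.1 < m /\ - m < z.2 < m.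
Proof.
move=> cK.
have c1 : continuous (fst : R * R -> R) by move=> z; exact: cvg_fst.
have c2 : continuous (snd : R * R -> R) by move=> z; exact: cvg_snd.
have [M1 M10 h1] := compact_bound c1 cK.
have [M2 M20 h2] := compact_bound c2 cK.
exists (M1 + M2 + 1); first by rewrite ltr_wpDl// addr_ge0.
move=> z Kz; split; rewrite -ltr_norml.
  by apply: le_lt_trans (h1 _ Kz) _; lra.
by apply: le_lt_trans (h2 _ Kz) _; lra.
Qed.

Lemma integral_supp O f (S : set (R * R)) : (forall z, ~ (O z /\ S z) -> f z = 0) ->
  \int[mu2]_(z in O) f z = \int[mu2]_(z in S) f z.
Proof.
move=> h; rewrite Rintegral_mkcond [in RHS]Rintegral_mkcond.
apply: eq_Rintegral => z _; rewrite !restrE.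
case: (asboolP (O z /\ S z)) => [[Oz Sz]|/h ->]; last by case: ifP; case: ifP.
by rewrite !mem_set.
Qed.

Lemma compact_supp_L2 O f (K : set (R * R)) : measurable (O : set T2) ->
  continuous f -> compact K -> K `<=` O -> (forall z, ~ K z -> f z = 0) -> L2 O f.
Proof.
move=> mO cf cK KO f0.
have fO : f \_ O = f.
  apply/funext => z; rewrite restrE; case: ifP => // /negP zO.
  by apply/esym/f0 => /KO Oz; apply: zO; rewrite inE.
have mf : measurable_fun [set: T2] f by exact: continuous_measurable2.
apply: L2_intro => //; rewrite fO//.
have [m m0 mK] := compact_in_rect cK.
have cf2 : continuous (fun z => f z ^+ 2).
  by move=> z; apply: (@continuous_comp _ _ _ f (fun x => x ^+ 2)); [exact: cf|exact: exprn_continuous].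
have fr : (fun z => f z ^+ 2) = (fun z => f z ^+ 2) \_ (rect (- m) m (- m) m).
  apply/funext => z; rewrite restrE; case: ifP => // /negP zr.
  rewrite f0 ?expr0n// => /mK[/andP[/ltW a /ltW b] /andP[/ltW c /ltW d]]; apply: zr.
  by rewrite inE; split; rewrite /= in_itv /= ?a ?b ?c ?d.
have := rect_integrable (- m) m (- m) m cf2.
move=> /(integrable_restr (measurable_rect _ _ _ _)); rewrite -fr => /integrableP[_].
by under eq_integral => z _ do rewrite /= ger0_norm ?sqr_ge0//.
Qed.

Lemma compact_C1_L2 O u u1 u2 : measurable (O : set T2) -> compact_C1 O u u1 u2 ->
  [/\ L2 O u, L2 O u1 & L2 O u2].
Proof.
move=> mO [[c c1 c2 _ _] [K [cK KO KP]]].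
by split; apply: (compact_supp_L2 mO _ cK KO) => // z /KP[].
Qed.

(** Integrate first along the direction of the derivative, over a square that
    contains the support. *)
Lemma compact_C1_divergence O u u1 u2 : compact_C1 O u u1 u2 ->
  \int[mu2]_(z in O) u1 z = 0 /\ \int[mu2]_(z in O) u2 z = 0.
Proof.
move=> [[c c1 c2 d1 d2] [K [cK KO KP]]].
have [m m0 mK] := compact_in_rect cK.
have Kr z : K z -> rect (- m) m (- m) m z.
  by move=> /mK[/andP[/ltW a /ltW b] /andP[/ltW e /ltW d]];
    split; rewrite /= in_itv /= ?a ?b ?e ?d.
have red f : (forall z, ~ K z -> f z = 0) ->
    \int[mu2]_(z in O) f z = \int[mu2]_(z in rect (- m) m (- m) m) f z.
  by move=> f0; apply: integral_supp => z h; apply: f0 => Kz; apply: h; split; [exact: KO|exact: Kr].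
have mm : - m <= m by lra.
have u0 z : z.1 = - m \/ z.1 = m \/ z.2 = - m \/ z.2 = m -> u z = 0.
  move=> h; case: (KP z) => // /mK[/andP[a b] /andP[e d]].
  by move: h => [|[|[|]]]; lra.
split.
  rewrite red; last by move=> z /KP[].
  rewrite rect_fubini// -[RHS](itg0 (- m) m); apply: eq_itg => y _.
  have cs : cont_on (- m) m (fun x => u1 (x, y)) by move=> x _; exact: cont_slice1.
  rewrite (itg_FTC mm cs (fun x _ => d1 x y)).
  by rewrite !u0 ?subrr//=; [left|right; left].
rewrite red; last by move=> z /KP[].
rewrite rect_fubini'// -[RHS](itg0 (- m) m); apply: eq_itg => x _.
have cs : cont_on (- m) m (fun y => u2 (x, y)) by move=> y _; exact: cont_slice2.
rewrite (itg_FTC mm cs (fun y _ => d2 x y)).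
by rewrite !u0 ?subrr//=; [right; right; left|right; right; right].
Qed.

Lemma cont_mul2 f g : continuous f -> continuous g -> continuous (fun z => f z * g z).
Proof. by move=> cf cg z; apply: (@continuousM _ _ f g); [exact: cf|exact: cg]. Qed.

Lemma cont_add2 f g : continuous f -> continuous g -> continuous (fun z => f z + g z).
Proof. by move=> cf cg z; apply: (@continuousD _ _ _ f g); [exact: cf|exact: cg]. Qed.

Lemma compact_C1_mul O u u1 u2 v v1 v2 : compact_C1 O u u1 u2 -> compact_C1 O v v1 v2 ->
  compact_C1 O (fun z => u z * v z) (fun z => u z * v1 z + u1 z * v z)
    (fun z => u z * v2 z + u2 z * v z).
Proof.
move=> [[c c1 c2 d1 d2] [K [cK KO KP]]] [[c' c1' c2' d1' d2'] _]; split.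
  split.
  - exact: cont_mul2.
  - by apply: cont_add2; apply: cont_mul2.
  - by apply: cont_add2; apply: cont_mul2.
  - by move=> x y; have h1 := d1 x y; have h2 := d1' x y; der; rewrite /=; ring.
  - by move=> x y; have h1 := d2 x y; have h2 := d2' x y; der; rewrite /=; ring.
exists K; split=> // z /KP[-> -> ->].
by rewrite !mul0r addr0.
Qed.

Lemma integration_by_parts2 O phi psi : measurable (O : set T2) ->
  test_function O phi -> test_function O psi ->
  ip O phi (D1 psi) = - ip O (D1 phi) psi /\ ip O phi (D2 psi) = - ip O (D2 phi) psi.
Proof.
move=> mO /test_compact_C1 h1 /test_compact_C1 h2.
have [l l1 l2] := compact_C1_L2 mO h1; have [k k1 k2] := compact_C1_L2 mO h2.
have [e1 e2] := compact_C1_divergence (compact_C1_mul h1 h2).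
have s1 := RintegralD mO (L2_mul_integrable mO l k1) (L2_mul_integrable mO l1 k).
have s2 := RintegralD mO (L2_mul_integrable mO l k2) (L2_mul_integrable mO l2 k).
rewrite /ip; split; apply/eqP; rewrite -addr_eq0; apply/eqP.
  exact: etrans (esym s1) e1.
exact: etrans (esym s2) e2.
Qed.

End TestFunctions.

(** * The Sobolev space and its forms *)

Section SobolevSpace.
Context {R : realType} (O : set (R * R)).
Local Notation T2 := (measurableTypeR R * measurableTypeR R)%type.
Local Notation mu2 := (lebesgue2 R).
Local Notation D1 f := ('D_(e1 R) f).
Local Notation D2 f := ('D_(e2 R) f).
Hypothesis mO : measurable (O : set T2).
Implicit Types (f g u v phi psi : R * R -> R).

(** A function with its weak gradient.  Keeping the gradient as data makes mass
    and energy bilinear on a vector space. *)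
Definition triple : lmodType R :=
  ((R * R -> R) * (R * R -> R) * (R * R -> R))%type.
Implicit Types (U W : triple).

Lemma triple_lin1 k U W : (k *: U + W).1.1 = k *: U.1.1 + W.1.1.
Proof. by []. Qed.

Lemma triple_lin2 k U W : (k *: U + W).1.2 = k *: U.1.2 + W.1.2.
Proof. by []. Qed.

Lemma triple_lin3 k U W : (k *: U + W).2 = k *: U.2 + W.2.
Proof. by []. Qed.

Definition grad phi : triple := (phi, D1 phi, D2 phi).
Definition sobolev U := H10 O U.1.1 U.1.2 U.2.
Definition L2_triple U := [/\ L2 O U.1.1, L2 O U.1.2 & L2 O U.2].
Definition mass_form U W := ip O U.1.1 W.1.1.
Definition energy_form U W := ip O U.1.2 W.1.2 + ip O U.2 W.2.

Definition approximable U := L2_triple U /\ forall e : R, 0 < e ->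
  exists2 phi, test_function O phi &
    [/\ ip O (phi - U.1.1) (phi - U.1.1) < e,
        ip O (D1 phi - U.1.2) (D1 phi - U.1.2) < e &
        ip O (D2 phi - U.2) (D2 phi - U.2) < e].

Lemma test_L2 phi : test_function O phi -> L2_triple (grad phi).
Proof. by move=> h; exact: (compact_C1_L2 mO (test_compact_C1 h)). Qed.

Lemma L2B f g : L2 O f -> L2 O g -> L2 O (f - g).
Proof. by move=> hf hg; exact: (subspaceB (L2_subspace O)). Qed.

(** Both sides of the definition are continuous for the L2 norms, and the equality
    holds for test functions. *)
Lemma weak_derivative_limit (w : R * R) u g : L2 O u -> L2 O g ->
  (forall psi, test_function O psi -> L2 O ('D_w psi)) ->
  (forall phi psi, test_function O phi -> test_function O psi ->
     ip O phi ('D_w psi) = - ip O ('D_w phi) psi) ->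
  (forall e : R, 0 < e -> exists2 phi, test_function O phi &
     ip O (phi - u) (phi - u) < e /\ ip O ('D_w phi - g) ('D_w phi - g) < e) ->
  weak_derivative O w u g.
Proof.
move=> hu hg hD ibp happ psi hpsi.
have pf := L2_form mO; have sp := L2_subspace O.
have hp : L2 O psi by case: (test_L2 hpsi).
have hdp := hD _ hpsi.
rewrite -/(ip O u ('D_w psi)) -/(ip O g psi).
apply/eqP; rewrite -addr_eq0 -normr_eq0 eq_le normr_ge0 andbT.
apply/ler_addgt0Pr => e e0; rewrite add0r.
(* By Cauchy-Schwarz an error d in the squared norms moves both sides by at most
   sqrt (d A) = e / 2. *)
pose A := ip O ('D_w psi) ('D_w psi) + ip O psi psi + 1.
have A1 : 1 <= A by rewrite lerDr addr_ge0// (form_ge0 pf).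
have A0 : 0 < A by exact: lt_le_trans ltr01 A1.
pose d := (e / 2) ^+ 2 / A.
have d0 : 0 < d by rewrite divr_gt0// exprn_gt0// divr_gt0.
have [phi hphi [h1 h2]] := happ d d0.
have hph : L2 O phi by case: (test_L2 hphi).
have hdph := hD _ hphi.
have subl f f' k : L2 O f -> L2 O f' -> L2 O k -> ip O (f - f') k = ip O f k - ip O f' k.
  move=> hf hf' hk; rewrite -[f - f']addrC -scaleN1r (form_linl pf)//.
  by rewrite mulN1r addrC.
have -> : ip O u ('D_w psi) + ip O g psi =
    - (ip O (phi - u) ('D_w psi) + ip O ('D_w phi - g) psi).
  rewrite (subl _ _ _ hph hu hdp) (subl _ _ _ hdph hg hp) (ibp _ _ hphi hpsi).
  by ring.
have small f k : L2 O f -> L2 O k -> ip O f f < d -> ip O k k <= A -> `|ip O f k| <= e / 2.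
  move=> hf hk fd kA; rewrite -(ler_pXn2r (n := 2))// ?nnegrE ?normr_ge0// ?divr_ge0 ?(ltW e0)//.
  rewrite real_normK ?num_real//; apply: le_trans (form_CS sp pf hf hk) _.
  apply: (@le_trans _ _ (d * A)).
    by apply: ler_pM; rewrite ?(form_ge0 pf)// ltW.
  by rewrite /d divfK// gt_eqF.
rewrite normrN; apply: le_trans (ler_normD _ _) _.
have s1 := small (phi - u) ('D_w psi) (L2B hph hu) hdp h1.
have s2 := small ('D_w phi - g) psi (L2B hdph hg) hp h2.
have p1 := form_ge0 pf hp; have p2 := form_ge0 pf hdp.
have := s1 ltac:(rewrite /A; lra); have := s2 ltac:(rewrite /A; lra); lra.
Qed.

(** The weak gradient identities pass to limits of test functions. *)
Lemma sobolevP U : sobolev U <-> approximable U.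
Proof.
case: U => [[u g1] g2]; rewrite /sobolev /approximable /=; split.
  move=> [[hu h1 h2 _ _] app]; split=> // e e0.
  have se0 : 0 < Num.sqrt e by rewrite sqrtr_gt0.
  have [phi [hphi a1 a2 a3]] := app _ se0; exists phi => //.
  have [p1 p2 p3] := test_L2 hphi.
  have E f f' : L2 O f -> L2 O f' -> (L2norm O (f \- f')%R < (Num.sqrt e)%:E)%E ->
      ip O (f - f') (f - f') < e.
    by move=> hf hf'; rewrite L2_norm_lt// ?sqr_sqrtr ?(ltW e0)//; exact: L2B.
  by split; [exact: (E _ _ p1 hu a1)|exact: (E _ _ p2 h1 a2)|exact: (E _ _ p3 h2 a3)].
move=> [[/= hu h1 h2] app]; split; last first.
  move=> e e0; have [phi hphi [a1 a2 a3]] := app _ (exprn_gt0 2 e0).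
  have [p1 p2 p3] := test_L2 hphi.
  exists phi; split; first exact: hphi.
  - by rewrite (L2_norm_lt mO (L2B p1 hu) e0).
  - by rewrite (L2_norm_lt mO (L2B p2 h1) e0).
  - by rewrite (L2_norm_lt mO (L2B p3 h2) e0).
split=> //.
- apply: (weak_derivative_limit hu h1).
  + by move=> psi hpsi; case: (test_L2 hpsi) => _ q1 q2; exact: q1.
  + by move=> phi psi hphi hpsi; case: (integration_by_parts2 mO hphi hpsi) => q1 q2; exact: q1.
  + move=> e e0; have [phi hphi [a1 a2 a3]] := app _ e0; exists phi; first exact: hphi.
    by split; [exact: a1|exact: a2].
- apply: (weak_derivative_limit hu h2).
  + by move=> psi hpsi; case: (test_L2 hpsi) => _ q1 q2; exact: q2.
  + by move=> phi psi hphi hpsi; case: (integration_by_parts2 mO hphi hpsi) => q1 q2; exact: q2.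
  + move=> e e0; have [phi hphi [a1 a2 a3]] := app _ e0; exists phi; first exact: hphi.
    by split; [exact: a1|exact: a3].
Qed.

Lemma sobolev_L2 U : sobolev U -> L2_triple U.
Proof. by move=> /sobolevP[]. Qed.

Lemma test_sobolev phi : test_function O phi -> sobolev (grad phi).
Proof.
move=> hphi; apply/sobolevP; split; first exact: test_L2.
move=> e e0; exists phi => //; rewrite /= !subrr.
by rewrite (form0l (L2_form mO))//; exact: (L2_0 O).
Qed.

Lemma sobolev_dist U : approximable U <-> L2_triple U /\ forall e : R, 0 < e ->
  exists2 phi, test_function O phi &
    mass_form (grad phi - U) (grad phi - U) < e /\
    energy_form (grad phi - U) (grad phi - U) < e.
Proof.
have pf := L2_form mO.
split=> -[hU app]; split=> // e e0.
  have [phi hphi [a1 a2 a3]] := app _ (divr_gt0 e0 (ltr0n R 2)).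
  exists phi => //; rewrite /mass_form /energy_form /=; split; last by lra.
  by apply: lt_le_trans a1 _; lra.
have [phi hphi [a1 a2]] := app _ e0; exists phi => //.
have [h1 h2 h3] := hU; have [p1 p2 p3] := test_L2 hphi.
have := form_ge0 pf (L2B p2 h2); have := form_ge0 pf (L2B p3 h3).
by move: a1 a2; rewrite /mass_form /energy_form /= => a1 a2 b1 b2; split=> //; lra.
Qed.

Lemma L2_triple_subspace : subspace L2_triple.
Proof.
have [z l] := L2_subspace O.
split=> [|k U W [u1 u2 u3] [w1 w2 w3]]; first by split; exact: z.
split; rewrite ?triple_lin1 ?triple_lin2 ?triple_lin3.
- exact: l u1 w1.
- exact: l u2 w2.
- exact: l u3 w3.
Qed.

Lemma mass_form_L2 : positive_form L2_triple mass_form.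
Proof.
have [f1 f2 f3] := L2_form mO.
rewrite /mass_form; split=> [U W [u _ _] [w _ _]|k U W X [u _ _] [w _ _] [x _ _]|U [u _ _]].
- exact: f1 u w.
- by rewrite triple_lin1; exact: f2 u w x.
- exact: f3 u.
Qed.

Lemma energy_form_L2 : positive_form L2_triple energy_form.
Proof.
have [f1 f2 f3] := L2_form mO.
split=> [U W [_ u u'] [_ w w']|k U W X [_ u u'] [_ w w'] [_ x x']|U [_ u u']].
- by rewrite /energy_form (f1 _ _ u w) (f1 _ _ u' w').
- rewrite /energy_form triple_lin2 triple_lin3.
  by rewrite (f2 _ _ _ _ u w x) (f2 _ _ _ _ u' w' x'); ring.
- by rewrite /energy_form addr_ge0 ?(f3 _ u) ?(f3 _ u').
Qed.

Lemma sub_positive_form (V : lmodType R) (H H' : V -> Prop) (a : V -> V -> R) :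
  (forall x, H' x -> H x) -> positive_form H a -> positive_form H' a.
Proof.
by move=> HH [h1 h2 h3]; split=> [x y /HH ? /HH ?|k x y z /HH ? /HH ? /HH ?|x /HH ?];
  [exact: h1|exact: h2|exact: h3].
Qed.

Lemma mass_form_pos : positive_form sobolev mass_form.
Proof. exact: sub_positive_form sobolev_L2 mass_form_L2. Qed.

Lemma energy_form_pos : positive_form sobolev energy_form.
Proof. exact: sub_positive_form sobolev_L2 energy_form_L2. Qed.

Lemma grad_lin k phi psi : test_function O phi -> test_function O psi ->
  grad (k *: phi + psi) = k *: grad phi + grad psi.
Proof.
move=> [c1 _ _] [c2 _ _]; have [E1 E2] := Cn_derive k (c1 1%N) (c2 1%N).
by rewrite /grad E1 E2.
Qed.

Definition graph_form U W := mass_form U W + energy_form U W.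

Lemma graph_form_L2 : positive_form L2_triple graph_form.
Proof.
have [f1 f2 f3] := mass_form_L2; have [g1 g2 g3] := energy_form_L2.
split=> [U W u w|k U W X u w x|U u].
- by rewrite /graph_form f1// g1.
- by rewrite /graph_form f2// g2//; ring.
- by rewrite addr_ge0 ?f3 ?g3.
Qed.

Lemma sobolev_closure U : sobolev U <-> L2_triple U /\ forall e : R, 0 < e ->
  exists2 phi, test_function O phi & graph_form (grad phi - U) (grad phi - U) < e.
Proof.
split=> [/sobolevP/sobolev_dist[hU app]|[hU app]]; last (apply/sobolevP/sobolev_dist); split=> // e e0.
  have [phi hphi [a1 a2]] := app _ (divr_gt0 e0 (ltr0n R 2)).
  by exists phi => //; rewrite /graph_form; lra.
have [phi hphi a1] := app _ e0; exists phi => //.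
have hd := subspaceB L2_triple_subspace (test_L2 hphi) hU.
have := form_ge0 mass_form_L2 hd; have := form_ge0 energy_form_L2 hd.
by move: a1; rewrite /graph_form; lra.
Qed.

Lemma sobolev_subspace : subspace sobolev.
Proof.
have sL := L2_triple_subspace; have pg := graph_form_L2.
split=> [|k U W /[dup] /sobolev_L2 hU /sobolev_closure[_ aU] /[dup] /sobolev_L2 hW /sobolev_closure[_ aW]].
  have -> : (0 : triple) = grad 0.
    have D0 (w : R * R) : 'D_w (0 : R * R -> R) = 0 by apply/funext => x; rewrite derive_cst.
    by rewrite /grad !D0.
  by apply: test_sobolev; exact: test_0.
apply/sobolev_closure; split; first exact: sL.2.
(* The squared error of k *: phi + psi is at most 2 (k^2 e / c + e / c) = e. *)
move=> e e0; pose c := 2 * (k ^+ 2 + 1).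
have c0 : 0 < c by rewrite mulr_gt0// ltr_wpDl// sqr_ge0.
have [phi hphi aphi] := aU _ (divr_gt0 e0 c0).
have [psi hpsi apsi] := aW _ (divr_gt0 e0 c0).
exists (k *: phi + psi); first exact: test_lin.
have h1 := subspaceB sL (test_L2 hphi) hU; have h2 := subspaceB sL (test_L2 hpsi) hW.
have -> : grad (k *: phi + psi) - (k *: U + W) =
    k *: (grad phi - U) - (W - grad psi).
  by rewrite grad_lin// scalerBr !opprD !opprK addrACA [- W + _]addrC.
have h3 : L2_triple (W - grad psi) by apply: subspaceB => //; exact: test_L2.
have h4 : L2_triple (k *: (grad phi - U)) by exact: (subspaceZ sL).
apply: le_lt_trans (form_distr sL pg h4 h3) _.
have sE : graph_form (W - grad psi) (W - grad psi) = graph_form (grad psi - W) (grad psi - W).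
  have hp := test_L2 hpsi.
  by rewrite !(form_quadB sL pg)// (form_sym pg hp hW); ring.
have kE : graph_form (k *: (grad phi - U)) (k *: (grad phi - U)) =
    k ^+ 2 * graph_form (grad phi - U) (grad phi - U).
  by rewrite (formZl sL pg)// (form_sym pg h1 h4) (formZl sL pg)//; ring.
rewrite sE kE.
apply: (@lt_le_trans _ _ (2 * (k ^+ 2 * (e / c) + e / c))); last first.
  rewrite le_eqVlt; apply/orP; left; apply/eqP; rewrite /c; field.
  by rewrite gt_eqF// ltr_wpDl// sqr_ge0.
rewrite ltr_pM2l// ler_ltD//.
by rewrite ler_wpM2l ?sqr_ge0// ltW.
Qed.

(** The three components converge in L2, and a diagonal choice of test functions
    approximates the limit. *)
Lemma sobolev_complete : complete_for energy_form mass_form sobolev.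
Proof.
move=> U hU cU; have sL := L2_triple_subspace; have pg := graph_form_L2.
have hL n : L2_triple (U n) by exact: sobolev_L2.
have pf := L2_form mO.
have comp (p : triple -> R * R -> R) :
    (forall V W, p (V - W) = p V - p W) -> (forall V, L2_triple V -> L2 O (p V)) ->
    (forall V, L2_triple V -> ip O (p V) (p V) <= energy_form V V + mass_form V V) ->
    exists2 g, L2 O g & forall e : R, 0 < e -> exists N, forall n, (N <= n)%N ->
      ip O (p (U n) - g) (p (U n) - g) < e.
  move=> pB pL ple; apply: (L2_complete mO) => [n|e e0]; first exact: pL.
  have [N NP] := cU e e0; exists N => m n Nm Nn; apply: le_lt_trans (NP m n Nm Nn).
  by rewrite -pB; apply: ple; exact: (subspaceB sL).
have ge0 V : L2_triple V -> [/\ 0 <= ip O V.1.1 V.1.1, 0 <= ip O V.1.2 V.1.2 & 0 <= ip O V.2 V.2].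
  by move=> [v1 v2 v3]; split; exact: (form_ge0 pf).
have [||V /ge0[q1 q2 q3]|u hu uP] := comp (fun V => V.1.1) => //.
- by move=> V [].
- by rewrite /energy_form /mass_form; lra.
have [||V /ge0[q1 q2 q3]|g1 hg1 g1P] := comp (fun V => V.1.2) => //.
- by move=> V [].
- by rewrite /energy_form /mass_form; lra.
have [||V /ge0[q1 q2 q3]|g2 hg2 g2P] := comp (fun V => V.2) => //.
- by move=> V [].
- by rewrite /energy_form /mass_form; lra.
pose W : triple := (u, g1, g2).
have hW : L2_triple W by [].
have lim (e : R) : 0 < e -> exists N, forall n, (N <= n)%N ->
    energy_form (U n - W) (U n - W) + mass_form (U n - W) (U n - W) < e.
  move=> e0; have e3 : 0 < e / 3 by rewrite divr_gt0.
  have [N1 h1] := uP _ e3; have [N2 h2] := g1P _ e3; have [N3 h3] := g2P _ e3.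
  exists (maxn N1 (maxn N2 N3)) => n; rewrite !geq_max => /andP[n1 /andP[n2 n3]].
  have := h1 n n1; have := h2 n n2; have := h3 n n3.
  by rewrite /energy_form /mass_form /W /=; lra.
exists W => //; apply/sobolev_closure; split=> // e e0.
have e4 : 0 < e / 4 by rewrite divr_gt0.
have [N /(_ N (leqnn _)) h1] := lim _ e4.
have /sobolev_closure[_ /(_ _ e4)[phi hphi h2]] := hU N.
exists phi => //; have hp := test_L2 hphi.
have -> : grad phi - W = (grad phi - U N) - (W - U N) by rewrite opprB addrA subrK.
have d1 := subspaceB sL hp (hL N); have d2 := subspaceB sL hW (hL N).
apply: le_lt_trans (form_distr sL pg d1 d2) _.
have sE : graph_form (W - U N) (W - U N) = graph_form (U N - W) (U N - W).
  have hUN := hL N.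
  by rewrite !(form_quadB sL pg)// (form_sym pg hW hUN); ring.
by rewrite sE; move: h1 h2; rewrite /graph_form; lra.
Qed.

(** Both sides are continuous for the graph norm, for which test functions are
    dense. *)
Lemma gap_from_test (L : R) (J : finType) (xi : J -> R * R -> R) :
  0 <= L -> (forall j, L2 O (xi j)) ->
  (forall phi, test_function O phi -> L * mass_form (grad phi) (grad phi) <=
     energy_form (grad phi) (grad phi) + \sum_j (ip O phi (xi j)) ^+ 2) ->
  gap_inequality energy_form mass_form sobolev L (fun j U => ip O U.1.1 (xi j)).
Proof.
move=> L0 hxi test; have pf := L2_form mO; have sL := L2_triple_subspace.
have spL := L2_subspace O.
split.
- move=> j k U W /sobolev_L2[u _ _] /sobolev_L2[w _ _].
  by rewrite triple_lin1 (form_linl pf k u w (hxi j)).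
- exists (\sum_j ip O (xi j) (xi j)) => j U /sobolev_L2[u _ _].
  apply: le_trans (form_CS spL pf u (hxi j)) _.
  rewrite mulrC ler_wpM2r ?(form_ge0 pf)//.
  rewrite (bigD1 j)//= lerDl; apply: sumr_ge0 => i _; exact: (form_ge0 pf).
exists 1; first exact: ler01.
move=> U hU; rewrite mul1r.
have pm := mass_form_L2; have pe := energy_form_L2; have hL := sobolev_L2 hU.
(* The right-hand side is itself a positive form, bounded by the graph norm. *)
pose F V W := energy_form V W + \sum_j ip O V.1.1 (xi j) * ip O W.1.1 (xi j).
have pF : positive_form L2_triple F.
  have [g1 g2 g3] := pe.
  split=> [V W v w|k V W X v w x|V v].
  - by rewrite /F (g1 _ _ v w); congr (_ + _); apply: eq_bigr => j _; rewrite mulrC.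
  - have S : \sum_j ip O (k *: V + W).1.1 (xi j) * ip O X.1.1 (xi j) =
        k * (\sum_j ip O V.1.1 (xi j) * ip O X.1.1 (xi j)) +
        \sum_j ip O W.1.1 (xi j) * ip O X.1.1 (xi j).
      rewrite mulr_sumr -big_split /=; apply: eq_bigr => j _.
      case: v w => [v _ _] [w _ _].
      by rewrite (form_linl pf k v w (hxi j)); ring.
    by rewrite /F (g2 _ _ _ _ v w x) S; ring.
  - rewrite /F addr_ge0 ?(g3 _ v)//.
    by apply: sumr_ge0 => j _; rewrite -expr2 sqr_ge0.
pose K := \sum_j ip O (xi j) (xi j).
have K0 : 0 <= K by apply: sumr_ge0 => j _; exact: (form_ge0 pf).
have Fle V : L2_triple V -> F V V <= (1 + K) * graph_form V V.
  move=> hV; have v0 := form_ge0 pe hV; have m0 := form_ge0 pm hV.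
  have h : \sum_j ip O V.1.1 (xi j) * ip O V.1.1 (xi j) <= K * mass_form V V.
    rewrite mulr_suml; apply: ler_sum => j _; rewrite -expr2 mulrC.
    by apply: (form_CS spL pf) => //; case: hV.
  have : 0 <= K * energy_form V V by rewrite mulr_ge0.
  rewrite /F /graph_form; lra.
have FE V : F V V = energy_form V V + \sum_j (ip O V.1.1 (xi j)) ^+ 2.
  by congr (_ + _); apply: eq_bigr => j _; rewrite expr2.
rewrite -FE; apply/ler_addgt0Pr => e e0.
have e2 : 0 < e / 2 by rewrite divr_gt0.
have eL : 0 < e / 2 / (L + 1) by rewrite divr_gt0// ltr_wpDl.
have [d1 d10 h1] := form_close sL pF hL e2.
have [d2 d20 h2] := form_close sL pm hL eL.
have dm0 : 0 < Num.min d1 d2 / (1 + K) by rewrite divr_gt0 ?lt_min ?d10// ltr_wpDr.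
have /sobolev_closure[_ /(_ _ dm0)[phi hphi hd]] := hU.
have hp := test_L2 hphi; have hdd := subspaceB sL hp hL.
have v0 := form_ge0 pe hdd; have m0 := form_ge0 pm hdd.
have K1 : 0 < 1 + K by rewrite ltr_wpDr.
have hd' : (1 + K) * graph_form (grad phi - U) (grad phi - U) < Num.min d1 d2.
  by rewrite mulrC -ltr_pdivlMr.
have c1 : F (grad phi - U) (grad phi - U) < d1.
  apply: le_lt_trans (Fle _ hdd) _; apply: lt_le_trans hd' _.
  by rewrite ge_min lexx.
have c2 : mass_form (grad phi - U) (grad phi - U) < d2.
  apply: (@le_lt_trans _ _ ((1 + K) * graph_form (grad phi - U) (grad phi - U))).
    have : 0 <= K * graph_form (grad phi - U) (grad phi - U) by rewrite mulr_ge0// addr_ge0.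
    by move: v0; rewrite /graph_form; lra.
  by apply: lt_le_trans hd' _; rewrite ge_min lexx orbT.
have := test _ hphi; rewrite -(FE (grad phi)).
have /ltr_normlP[k1 k2] := h1 _ hp c1.
have /ltr_normlP[k3 k4] := h2 _ hp c2.
have : L * (mass_form U U - mass_form (grad phi) (grad phi)) <= e / 2.
  apply: (@le_trans _ _ (L * (e / 2 / (L + 1)))).
    by rewrite ler_wpM2l//; lra.
  rewrite mulrA ler_pdivrMr ?ltr_wpDl// mulrC ler_wpM2l ?(ltW e2)//; lra.
lra.
Qed.

End SobolevSpace.

(** * Smooth functions of one variable *)

Section Smooth1d.
Context {R : realType}.
Implicit Types (f g : R -> R) (x y t k : R).

Lemma derX (n : nat) f x (df : R) : is_derive x 1 f df ->
  is_derive x 1 (fun y => f y ^+ n) (n%:R * f x ^+ n.-1 * df).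
Proof.
move=> hf; elim: n => [|n IH]; first by rewrite !mul0r; exact: derC.
rewrite (_ : (fun y => f y ^+ n.+1) = fun y => f y * f y ^+ n); last first.
  by apply/funext => y; rewrite exprS.
notypeclasses refine (is_derive_eq (derM hf IH) _).
by case: n {IH} => [|n]; rewrite /= -?natr1 ?exprS; ring.
Qed.

(** The derivative is quantified instead of being computed by an operator, so that
    rules of differentiation prove smoothness. *)
Fixpoint smooth_upto (n : nat) f : Prop :=
  match n with
  | 0%N => continuous f
  | m.+1 => exists2 df, forall x, is_derive x 1 f (df x) & smooth_upto m df
  end.

Lemma smooth_uptoW n f : smooth_upto n.+1 f -> smooth_upto n f.
Proof.
elim: n f => [|n IH] f [df d1 d2]; first by move=> x; exact: der_cont (d1 x).
by exists df => //; exact: IH.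
Qed.

Lemma smooth_uptoD n f g : smooth_upto n f -> smooth_upto n g ->
  smooth_upto n (fun x => f x + g x).
Proof.
elim: n f g => [|n IH] f g.
  by move=> cf cg x; apply: contD; [exact: cf|exact: cg].
move=> [df f1 f2] [dg g1 g2]; exists (fun x => df x + dg x); last exact: IH.
by move=> x; exact: derD.
Qed.

Lemma smooth_uptoM n f g : smooth_upto n f -> smooth_upto n g ->
  smooth_upto n (fun x => f x * g x).
Proof.
elim: n f g => [|n IH] f g.
  by move=> cf cg x; apply: contM; [exact: cf|exact: cg].
move=> hf hg; have hf' := smooth_uptoW hf; have hg' := smooth_uptoW hg.
move: hf hg => [df f1 f2] [dg g1 g2]; exists (fun x => df x * g x + f x * dg x).
  by move=> x; exact: derM.
by apply: smooth_uptoD; apply: IH.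
Qed.

Lemma smooth_cst n k : smooth_upto n (fun _ : R => k).
Proof.
elim: n k => [|n IH] k; first by move=> x; exact: contC.
by exists (fun=> 0) => // x; exact: derC.
Qed.

Lemma smooth_affine n f k c : smooth_upto n f -> smooth_upto n (fun x => f (k * x + c)).
Proof.
have dA x : is_derive x 1 (fun y => k * y + c) k by der; ring.
elim: n f => [|n IH] f.
  by move=> cf x; apply: (@continuous_comp _ _ _ (fun y => k * y + c) f);
    [exact: der_cont (dA x)|exact: cf].
move=> [df f1 f2]; exists (fun x => df (k * x + c) * k).
  by move=> x; exact: (der_comp (f1 _) (dA x)).
by apply: smooth_uptoM; [exact: IH|exact: smooth_cst].
Qed.

Lemma smooth_sin_cos n : smooth_upto n (@sin R) /\ smooth_upto n (@cos R).
Proof.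
elim: n => [|n [IHs IHc]]; first by split; [exact: continuous_sin|exact: continuous_cos].
split; first by exists cos => // x; exact: is_derive_sin.
exists (fun x => (- 1) * sin x); first by move=> x; rewrite mulN1r; exact: is_derive_cos.
by apply: smooth_uptoM => //; exact: smooth_cst.
Qed.

(** The functions that arise by differentiating exp (- 1/t), extended by 0 to the
    left of 0. *)
Definition flat (k : nat) t : R := if 0 < t then t ^- k * expR (- t^-1) else 0.

(** Raise the inequality 1 + y <= exp y to the power n + 1. *)
Lemma expRN_inv_le (n : nat) t : 0 < t -> expR (- t^-1) <= (n.+1%:R * t) ^+ n.+1.
Proof.
move=> t0; have nt0 : 0 < n.+1%:R * t by rewrite mulr_gt0.
rewrite expRN -[leRHS]invrK lef_pV2 ?posrE ?expR_gt0 ?invr_gt0 ?exprn_gt0//.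
have -> : t^-1 = n.+1%:R * (n.+1%:R * t)^-1.
  by rewrite invfM mulrA mulfV ?mul1r// pnatr_eq0.
rewrite expRM_natl -exprVn ler_pXn2r ?nnegrE ?invr_ge0 ?expR_ge0 ?(ltW nt0)//.
by apply: le_trans (expR_ge1Dx _); rewrite lerDr.
Qed.

Lemma flat_ge0 (k : nat) t : 0 <= flat k t.
Proof.
rewrite /flat; case: ifP => // t0.
by rewrite mulr_ge0 ?expR_ge0// invr_ge0 exprn_ge0// ltW.
Qed.

Lemma flat_le (k : nat) t : flat k.+1 t <= k.+1%:R ^+ k.+1.
Proof.
rewrite /flat; case: ifP => t0; last by rewrite exprn_ge0.
by rewrite mulrC ler_pdivrMr ?exprn_gt0// -exprMn expRN_inv_le.
Qed.

Lemma flat0_le1 t : flat 0 t <= 1.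
Proof.
rewrite /flat; case: ifP => // t0; rewrite expr0 invr1 mul1r -expR0 ler_expR.
by rewrite oppr_le0 invr_ge0 ltW.
Qed.

Lemma flatM (k : nat) t : t * flat k.+1 t = flat k t.
Proof.
rewrite /flat; case: ifP => t0; last by rewrite mulr0.
by rewrite mulrA exprS invfM mulrA mulfV ?mul1r// gt_eqF.
Qed.

Lemma flat_le_lin (k : nat) t : 0 < t -> flat k t <= k.+1%:R ^+ k.+1 * t.
Proof.
by move=> t0; rewrite -flatM mulrC ler_pM2r// flat_le.
Qed.

(** At the origin, the difference quotient of flat k is flat k.+1, which tends
    to 0. *)
Lemma der_flat (k : nat) t : is_derive t 1 (flat k) (- k%:R * flat k.+1 t + flat k.+2 t).
Proof.
have [t0|t0|->] := ltrgtP t 0.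
- have fE (j : nat) s : s < 0 -> flat j s = 0 by move=> s0; rewrite /flat ltNge (ltW s0).
  rewrite !fE// mulr0 addr0; apply: (near_eq_is_derive _ (derC 0 t)).
  by near=> s; rewrite fE//; near: s; exact: lt_nbhsl.
- have h : is_derive t 1 (fun s => s ^- k * expR (- s^-1))
      (- k%:R * flat k.+1 t + flat k.+2 t).
    have tn : t != 0 by rewrite gt_eqF.
    have h1 : is_derive t 1 (fun s : R => s^-1) (- 1 / t ^+ 2).
      by apply: (@derV _ (fun y => y)) => //; exact: derI.
    have h2 : is_derive t 1 (fun s => expR (- s^-1)) (expR (- t^-1) * (1 / t ^+ 2)).
      notypeclasses refine
        (is_derive_eq (@der_comp R expR (fun s => - s^-1) t _ _ (is_derive_expR _) (derN h1)) _).
      by rewrite mulNr opprK.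
    have h3 : is_derive t 1 (fun s : R => s ^+ k) (k%:R * t ^+ k.-1).
      by have := derX k (derI t); rewrite mulr1.
    have h4 := @derV R (fun s => s ^+ k) t _ (expf_neq0 k tn) h3.
    notypeclasses refine (is_derive_eq (derM h4 h2) _).
    rewrite /flat t0; case: k {h3 h4} => [|k].
      by rewrite expr0; field.
    rewrite /= !exprS !expr0 !invfM; have := expf_neq0 k tn; move: (t ^+ k) => r rn.
    by field; apply/andP.
  apply: (near_eq_is_derive _ h).
  by near=> s; rewrite /flat ifT//; near: s; exact: lt_nbhsr.
- have f0 j : flat j 0 = 0 by rewrite /flat ltxx.
  rewrite !f0 mulr0 addr0; apply/is_derive1_caratheodory.
  exists (flat k.+1); split.
  + by move=> s; rewrite !f0 !subr0 mulrC flatM.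
  + apply/cvgrPdist_le => e e0.
    near=> s; rewrite f0 sub0r normrN ger0_norm ?flat_ge0//.
    have [s0|s0] := ltP 0 s; last by rewrite /flat ltNge s0 /= ltW.
    apply: le_trans (flat_le_lin _ s0) _.
    rewrite mulrC -ler_pdivlMr ?exprn_gt0//.
    apply: le_trans (ler_norm _) _.
    near: s; apply/nbhs_ballP; exists (e / k.+2%:R ^+ k.+2) => /=.
      by rewrite divr_gt0// exprn_gt0.
    by move=> z; rewrite /ball /= sub0r normrN => /ltW.
  + exact: f0.
Unshelve. all: by end_near. Qed.

End Smooth1d.

(** * Cut-offs of sine modes *)

Section Cutoff.
Context {R : realType}.
Implicit Types (a b x e : R).

Lemma smooth_flat n (k : nat) : smooth_upto n (flat k : R -> R).
Proof.
elim: n k => [|n IH] k; first by move=> x; exact: der_cont (der_flat k x).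
exists (fun x => (- k%:R) * flat k.+1 x + flat k.+2 x); first exact: der_flat.
by apply: smooth_uptoD => //; apply: smooth_uptoM => //; exact: smooth_cst.
Qed.

Lemma smooth_sine_mode n a b m : smooth_upto n (sine_mode a b m).
Proof.
have := smooth_affine (wavenumber a b m) (- (wavenumber a b m * a)) (smooth_sin_cos n).1.
by rewrite (_ : (fun x => _) = sine_mode a b m)//; apply/funext => x;
  rewrite /sine_mode mulrBr.
Qed.

(** The ramp functions are affine, and positive beyond distance e from the end of
    the interval; composed with flat 0 they cut off near this end. *)
Definition lramp a e x : R := e^-1 * x + (- (a / e) - 1).
Definition rramp b e x : R := (- e^-1) * x + (b / e - 1).

(** A sine mode multiplied by two smooth steps, which tend to 1 inside ]a, b[ as
    e tends to 0. *)
Definition cut_mode a b m e x : R :=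
  sine_mode a b m x * (flat 0 (lramp a e x) * flat 0 (rramp b e x)).
Definition dcut_mode a b m e x : R :=
  dsine_mode a b m x * (flat 0 (lramp a e x) * flat 0 (rramp b e x)) +
  sine_mode a b m x * (flat 2 (lramp a e x) * e^-1 * flat 0 (rramp b e x)
    - flat 0 (lramp a e x) * (flat 2 (rramp b e x) * e^-1)).

Lemma smooth_cut_mode n a b m e : smooth_upto n (cut_mode a b m e).
Proof.
apply: smooth_uptoM; first exact: smooth_sine_mode.
by apply: smooth_uptoM; apply: smooth_affine; exact: smooth_flat.
Qed.

Lemma der_cut_mode a b m e x : is_derive x 1 (cut_mode a b m e) (dcut_mode a b m e x).
Proof.
have hs := der_sine_mode a b m x.
have hl : is_derive x 1 (lramp a e) e^-1 by rewrite /lramp; der; ring.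
have hr : is_derive x 1 (rramp b e) (- e^-1) by rewrite /rramp; der; ring.
have h1 := der_comp (der_flat 0 (lramp a e x)) hl.
have h2 := der_comp (der_flat 0 (rramp b e x)) hr.
notypeclasses refine (is_derive_eq (derM hs (derM h1 h2)) _).
by rewrite /dcut_mode; ring.
Qed.

Lemma cont_dcut_mode a b m e : continuous (dcut_mode a b m e).
Proof.
have [df h1 [ddf h2 _]] := smooth_cut_mode 2 a b m e.
have -> : dcut_mode a b m e = df.
  apply/funext => x.
  by rewrite -(derE (h1 x)) (derE (der_cut_mode a b m e x)).
by move=> x; exact: der_cont (h2 x).
Qed.

Lemma flat_le0 (k : nat) (t : R) : t <= 0 -> flat k t = 0.
Proof. by move=> t0; rewrite /flat ltNge t0. Qed.

Lemma lrampE a e x : 0 < e -> lramp a e x = (x - a - e) / e.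
Proof. by move=> e0; rewrite /lramp; field; rewrite gt_eqF. Qed.

Lemma rrampE b e x : 0 < e -> rramp b e x = (b - x - e) / e.
Proof. by move=> e0; rewrite /rramp; field; rewrite gt_eqF. Qed.

Lemma cut_mode_out a b m e x : 0 < e -> ~ (a + e < x < b - e) ->
  cut_mode a b m e x = 0 /\ dcut_mode a b m e x = 0.
Proof.
move=> e0 /negP; rewrite negb_and -!leNgt => /orP[xa|xb].
  have l0 : lramp a e x <= 0 by rewrite lrampE// pmulr_lle0 ?invr_gt0//; lra.
  by rewrite /cut_mode /dcut_mode !(flat_le0 _ l0) !mul0r !mulr0 subrr mulr0 addr0.
have l0 : rramp b e x <= 0 by rewrite rrampE// pmulr_lle0 ?invr_gt0//; lra.
by rewrite /cut_mode /dcut_mode !(flat_le0 _ l0) mul0r !mulr0 subrr mulr0 addr0.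
Qed.

Lemma sine_mode_lip a b m x y : a < b ->
  `|sine_mode a b m x - sine_mode a b m y| <= wavenumber a b m * `|x - y|.
Proof.
move=> ab; wlog xy : x y / y <= x => [h|].
  have [|/ltW] := leP y x; first exact: h.
  by move=> /h; rewrite distrC [`|y - x|]distrC.
have cs : {within `[y, x], continuous (sine_mode a b m)}.
  by apply: continuous_subspace_itv => z _; exact: cont_sine_mode.
have [z _ ->] := MVT_segment xy (fun z _ => der_sine_mode a b m z) cs.
rewrite normrM ler_wpM2r// /dsine_mode normrM ger0_norm ?wavenumber_ge0//.
rewrite ler_piMr ?wavenumber_ge0//.
by rewrite ler_norml cos_geN1 cos_le1.
Qed.

Lemma sine_mode_le1 a b m x : `|sine_mode a b m x| <= 1.
Proof. by rewrite ler_norml sin_geN1 sin_le1. Qed.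

Lemma dsine_mode_le a b m x : a < b -> `|dsine_mode a b m x| <= wavenumber a b m.
Proof.
move=> ab; rewrite /dsine_mode normrM ger0_norm ?wavenumber_ge0//.
by rewrite ler_piMr ?wavenumber_ge0// ler_norml cos_geN1 cos_le1.
Qed.

Lemma cut_mode_le1 a b m e x : `|cut_mode a b m e x| <= 1.
Proof.
rewrite /cut_mode normrM mulr_ile1// ?sine_mode_le1//.
rewrite normrM mulr_ile1// ger0_norm ?flat_ge0//; exact: flat0_le1.
Qed.

(** Here (t + 1) * e is the distance to the end of the interval. *)
Lemma flat2_ramp_le (t e : R) : 0 < t -> 0 < e -> (t + 1) * e * (flat 2 t * e^-1) <= 5.
Proof.
move=> t0 e0.
have -> : (t + 1) * e * (flat 2 t * e^-1) = t * flat 2 t + flat 2 t by field; rewrite gt_eqF.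
rewrite flatM; have := @flat_le R 0 t; have := @flat_le R 1 t.
(* The two terms are at most 1^1 and 2^2. *)
by rewrite expr1 expr2 -natrM /=; lra.
Qed.

(** The derivative of a step is of order 1/e, but it lives near an end of the
    interval, where the sine mode is at most wavenumber times the distance. *)
Lemma dcut_mode_le a b m e x : a < b -> 0 < e ->
  `|dcut_mode a b m e x| <= 11 * wavenumber a b m.
Proof.
move=> ab e0; set k := wavenumber a b m.
have k0 : 0 <= k by exact: wavenumber_ge0.
have [xab|/negP xab] := boolP (a + e < x < b - e); last first.
  by rewrite (cut_mode_out m e0 xab).2 normr0 mulr_ge0.
have /andP[xa xb] := xab.
set u := lramp a e x; set v := rramp b e x.
have u0 : 0 < u by rewrite /u lrampE// divr_gt0//; lra.
have v0 : 0 < v by rewrite /v rrampE// divr_gt0//; lra.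
have ue : (u + 1) * e = x - a by rewrite /u lrampE//; field; rewrite gt_eqF.
have ve : (v + 1) * e = b - x by rewrite /v rrampE//; field; rewrite gt_eqF.
have su : `|sine_mode a b m x| <= k * (x - a).
  have := @sine_mode_lip a b m x a ab.
  by rewrite sine_mode_l subr0 [`|x - a|]ger0_norm//; lra.
have sv : `|sine_mode a b m x| <= k * (b - x).
  have := @sine_mode_lip a b m x b ab.
  by rewrite sine_mode_r// subr0 [`|x - b|]distrC [`|b - x|]ger0_norm//; lra.
have f0 (t : R) : 0 <= flat 0 t <= 1 by rewrite flat_ge0 flat0_le1.
have f2 (t : R) : 0 <= flat 2 t by exact: flat_ge0.
have ei : 0 < e^-1 by rewrite invr_gt0.
have h1 : `|sine_mode a b m x| * (flat 2 u * e^-1) <= k * 5.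
  apply: (@le_trans _ _ (k * (x - a) * (flat 2 u * e^-1))).
    by rewrite ler_wpM2r// mulr_ge0// ltW.
  by rewrite -mulrA ler_wpM2l// -ue; exact: flat2_ramp_le.
have h2 : `|sine_mode a b m x| * (flat 2 v * e^-1) <= k * 5.
  apply: (@le_trans _ _ (k * (b - x) * (flat 2 v * e^-1))).
    by rewrite ler_wpM2r// mulr_ge0// ltW.
  by rewrite -mulrA ler_wpM2l// -ve; exact: flat2_ramp_le.
have /andP[fu0 fu1] := f0 u; have /andP[fv0 fv1] := f0 v.
rewrite /dcut_mode -/u -/v; apply: le_trans (ler_normD _ _) _.
(* One term from the derivative of the mode, two from the derivatives of the steps. *)
have -> : 11 * k = k + (k * 5 + k * 5) by ring.
apply: lerD.
  rewrite normrM -[leRHS]mulr1; apply: ler_pM => //; first exact: dsine_mode_le.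
  by rewrite ger0_norm ?mulr_ge0// mulr_ile1.
rewrite mulrBr; apply: le_trans (ler_normB _ _) _; apply: lerD.
  rewrite normrM [`|flat 2 u * e^-1 * flat 0 v|]ger0_norm ?mulr_ge0 ?(ltW ei)//.
  apply: le_trans h1; rewrite ler_wpM2l// ler_piMr// mulr_ge0// ltW//.
rewrite normrM [`|flat 0 u * (flat 2 v * e^-1)|]ger0_norm ?mulr_ge0 ?(ltW ei)//.
apply: le_trans h2; rewrite ler_wpM2l// ler_piMl// mulr_ge0// ltW//.
Qed.

Lemma ramp_limit (t e : R) : 0 < t -> 0 < e -> 2 * e <= t ->
  `|1 - flat 0 ((t - e) / e)| <= 2 / t * e /\
  `|0 - flat 2 ((t - e) / e) * e^-1| <= 4 / t ^+ 2 * e.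
Proof.
move=> t0 e0 et; set u := (t - e) / e.
have ule : t / (2 * e) <= u.
  rewrite /u ler_pdivlMr// (_ : t / (2 * e) * e = t / 2); last by field; rewrite gt_eqF.
  lra.
have v0 : 0 < t / (2 * e) by rewrite divr_gt0// mulr_gt0.
have u0 : 0 < u by exact: lt_le_trans ule.
have ui : u^-1 <= 2 / t * e.
  rewrite (_ : 2 / t * e = (t / (2 * e))^-1); last by field; rewrite !gt_eqF.
  by rewrite lef_pV2.
have ui0 : 0 <= u^-1 by rewrite invr_ge0 ltW.
split.
  rewrite ger0_norm ?subr_ge0 ?flat0_le1//; apply: le_trans ui.
  rewrite /flat u0 expr0 invr1 mul1r.
  by have := expR_ge1Dx (- u^-1); lra.
rewrite sub0r normrN ger0_norm; last by rewrite mulr_ge0 ?flat_ge0// invr_ge0 ltW.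
rewrite ler_pdivrMr// (_ : 4 / t ^+ 2 * e * e = (2 / t * e) ^+ 2); last by field; rewrite gt_eqF.
apply: (@le_trans _ _ (u^-1 ^+ 2)); last by rewrite ler_pXn2r// nnegrE ?(le_trans ui0).
rewrite /flat u0 exprVn ler_piMr ?invr_ge0 ?exprn_ge0 ?(ltW u0)//.
by rewrite -expR0 ler_expR oppr_le0.
Qed.

Lemma cvg_harmonic_bound (f : nat -> R) (l k : R) :
  (\forall n \near \oo, `|l - f n| <= k * harmonic n) -> f @ \oo --> l.
Proof.
move=> fk; apply/cvgrPdist_le => e e0.
have hk : (fun n => k * harmonic n) @ \oo --> (k * 0 : R).
  by apply: cvgM; [exact: cvg_cst|exact: cvg_harmonic].
rewrite mulr0 in hk; move/cvgrPdist_le: hk => /(_ _ e0) hk.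
near=> n; apply: (@le_trans _ _ (k * harmonic n)); first by near: n.
have : `|0 - k * harmonic n| <= e by near: n.
by rewrite sub0r normrN; apply: le_trans; exact: ler_norm.
Unshelve. all: by end_near. Qed.

Lemma ramp_cvg (t : R) : 0 < t ->
  flat 0 ((t - harmonic n) / harmonic n) @[n --> \oo] --> (1 : R) /\
  flat 2 ((t - harmonic n) / harmonic n) * (harmonic n)^-1 @[n --> \oo] --> (0 : R).
Proof.
move=> t0.
have small : \forall n \near \oo, 2 * harmonic n <= t :> R.
  have /cvgrPdist_le/(_ (t / 2)) := @cvg_harmonic R.
  move=> /(_ (divr_gt0 t0 (ltr0n R 2))) h; near=> n.
  have : `|0 - harmonic n| <= t / 2 :> R by near: n.
  by rewrite sub0r normrN => /(le_trans (ler_norm _)); lra.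
split; [apply: (@cvg_harmonic_bound _ _ (2 / t))|apply: (@cvg_harmonic_bound _ _ (4 / t ^+ 2))];
  near=> n; have nt : 2 * harmonic n <= t :> R by near: n.
- by have [h _] := ramp_limit t0 (harmonic_gt0 n) nt.
- by have [_ h] := ramp_limit t0 (harmonic_gt0 n) nt.
Unshelve. all: by end_near. Qed.

Lemma cut_mode_cvg a b m x : a < x < b ->
  cut_mode a b m (harmonic n) x @[n --> \oo] --> sine_mode a b m x /\
  dcut_mode a b m (harmonic n) x @[n --> \oo] --> dsine_mode a b m x.
Proof.
move=> /andP[ax xb].
have [l0 l2] := ramp_cvg (ltac:(lra) : 0 < x - a).
have [r0 r2] := ramp_cvg (ltac:(lra) : 0 < b - x).
have lE n : lramp a (harmonic n) x = (x - a - harmonic n) / harmonic n by exact/lrampE/harmonic_gt0.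
have rE n : rramp b (harmonic n) x = (b - x - harmonic n) / harmonic n by exact/rrampE/harmonic_gt0.
have p : (fun n => flat 0 (lramp a (harmonic n) x) * flat 0 (rramp b (harmonic n) x)) @ \oo --> (1 * 1 : R).
  under eq_fun do rewrite lE rE.
  by apply: cvgM; [exact: l0|exact: r0].
rewrite mulr1 in p; split.
  rewrite -[X in _ --> X]mulr1 /cut_mode; apply: cvgM; [exact: cvg_cst|exact: p].
have -> : dsine_mode a b m x = dsine_mode a b m x * 1 + sine_mode a b m x * (0 * 1 - 1 * 0) by ring.
rewrite /dcut_mode; apply: cvgD; apply: cvgM; first exact: cvg_cst.
- exact: p.
- exact: cvg_cst.
under eq_fun do rewrite lE rE.
apply: cvgB; apply: cvgM.
- exact: l2.
- exact: r0.
- exact: l0.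
- exact: r2.
Qed.

End Cutoff.

(** * Functions carried by a rectangle *)

Section RectangleIntegrals.
Context {R : realType}.
Implicit Types (a b c d : R) (f g : R * R -> R).
Local Notation mu := (@lebesgue_measure R).
Local Notation T2 := (measurableTypeR R * measurableTypeR R)%type.
Local Notation mu2 := (lebesgue2 R).

Definition orect a b c d : set (R * R) := `]a, b[ `*` `]c, d[.

Lemma measurable_orect a b c d : measurable (orect a b c d : set T2).
Proof. by apply: measurableX; exact: measurable_itv. Qed.

Lemma orect_sub a b c d : orect a b c d `<=` rect a b c d.
Proof.
move=> [x y] [] /=; rewrite !in_itv /= => /andP[/ltW h1 /ltW h2] /andP[/ltW h3 /ltW h4].
by split; rewrite /= in_itv /= ?h1 ?h2 ?h3 ?h4.
Qed.

Lemma rect_boundary_null a b c d : mu2 (rect a b c d `\` orect a b c d) = 0%E.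
Proof.
have mr := @measurable_rect R a b c d; have mo := measurable_orect a b c d.
have -> := measureD mr mo (rect_lty a b c d).
rewrite setIidr; last exact: orect_sub.
have E : mu2 (orect a b c d) = mu2 (rect a b c d).
  have -> : mu2 (rect a b c d) = (mu `[a, b]%classic * mu `[c, d]%classic)%E.
    by apply: product_measure1E; exact: measurable_itv.
  have -> : mu2 (orect a b c d) = (mu `]a, b[%classic * mu `]c, d[%classic)%E.
    by apply: product_measure1E; exact: measurable_itv.
  by rewrite /= !lebesgue_measure_itv.
have fr : mu2 (rect a b c d) \is a fin_num by rewrite ge0_fin_numE// rect_lty.
exact: etrans (congr1 (fun x => mu2 (rect a b c d) - x)%E E) (subee fr).
Qed.

(** The boundary of a rectangle is a null set. *)
Lemma rect_sandwich a b c d (A : set (R * R)) f : measurable (A : set T2) ->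
  orect a b c d `<=` A -> A `<=` rect a b c d -> continuous f ->
  \int[mu2]_(z in A) f z = \int[mu2]_(z in rect a b c d) f z.
Proof.
move=> mA oA Ar cf; have mr := @measurable_rect R a b c d.
have mN : measurable (rect a b c d `\` A : set T2) by exact: measurableD.
have N0 : mu2 (rect a b c d `\` A) = 0%E.
  apply: (@subset_measure0 _ T2 R mu2 _ (rect a b c d `\` orect a b c d)) => //.
  - by apply: measurableD => //; exact: measurable_orect.
  - by move=> z [rz Az]; split=> // oz; apply: Az; exact: oA.
  - exact: rect_boundary_null.
rewrite /Rintegral (negligible_integral mN mr (rect_integrable a b c d cf) N0).
by rewrite setDD setIidr.
Qed.

Lemma L2_restrict O f a b c d (A : set (R * R)) : measurable (O : set T2) ->
  measurable (A : set T2) -> A `<=` rect a b c d -> continuous f -> L2 O (f \_ A).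
Proof.
move=> mO mA Ar cf.
have mf : measurable_fun [set: T2] (f \_ A).
  by apply: (measurable_restrictT _ mA).1; apply: measurable_funTS; exact: continuous_measurable2.
have mfO : measurable_fun [set: T2] ((f \_ A) \_ O).
  by apply: (measurable_restrictT _ mO).1; apply: measurable_funTS.
have cf2 : continuous (fun z => f z ^+ 2).
  by move=> z; apply: (@continuous_comp _ _ _ f (fun x => x ^+ 2)); [exact: cf|exact: exprn_continuous].
apply: L2_intro => //.
have := rect_integrable a b c d cf2.
move=> /(integrable_restr (measurable_rect _ _ _ _)) /integrableP[mg]; apply: le_lt_trans.
apply: ge0_le_integral => //.
- by move=> z _; rewrite lee_fin sqr_ge0.
- by apply/measurable_EFinP/measurable_funX.
- by apply: measurableT_comp.
- move=> z _; rewrite lee_fin !restrE.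
  case: ifP => _; last by rewrite expr0n normr_ge0.
  have [zA|zA] := boolP (z \in A); last by rewrite expr0n normr_ge0.
  rewrite (mem_set (Ar _ (set_mem zA))); exact: ler_norm.
Qed.

Lemma ip_restrict (O : set (R * R)) f g a b c d (A : set (R * R)) : measurable (A : set T2) ->
  orect a b c d `<=` A -> A `<=` rect a b c d -> A `<=` O ->
  continuous f -> continuous g ->
  ip O (f \_ A) (g \_ A) = \int[mu2]_(z in rect a b c d) (f z * g z).
Proof.
move=> mA oA Ar AO cf cg; rewrite -(rect_sandwich mA oA Ar (cont_mul2 cf cg)).
rewrite /ip (@integral_supp _ _ _ A).
  by apply: eq_Rintegral => z zA; rewrite !restrE zA.
move=> z h; rewrite restrE; case: ifP => [|_]; last by rewrite mul0r.
by rewrite inE => Az; case: h; split=> //; exact: AO.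
Qed.

Lemma ip_disjoint (O A B : set (R * R)) f g : (forall z, A z -> ~ B z) ->
  ip O (f \_ A) (g \_ B) = 0.
Proof.
move=> AB; rewrite /ip (@integral_supp _ _ _ set0) ?Rintegral_set0// => z _.
rewrite !restrE.
case: ifP => [zA|_]; last by rewrite mul0r.
case: ifP => [zB|_]; last by rewrite mulr0.
by case: (AB z); exact: set_mem.
Qed.

(** Dominated convergence. *)
Lemma dominated_ip O (S : nat -> R * R -> R) (M : R) a b c d :
  (forall n, measurable_fun [set: T2] (S n)) -> (forall n z, `|S n z| <= M) ->
  (forall n z, ~ (O z /\ rect a b c d z) -> S n z = 0) ->
  (forall z, S n z @[n --> \oo] --> 0) ->
  forall e : R, 0 < e -> \forall n \near \oo, ip O (S n) (S n) < e.
Proof.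
move=> mS SM S0 Sl e e0.
pose r := rect a b c d; have mr : measurable (r : set T2) := @measurable_rect R a b c d.
have E n : ip O (S n) (S n) = \int[mu2]_(z in r) (S n z ^+ 2).
  rewrite /ip (@integral_supp _ _ _ r).
    by apply: eq_Rintegral => z _; rewrite expr2.
  by move=> z /(S0 n) ->; rewrite mul0r.
pose G (n : nat) : R * R -> \bar R := EFin \o (fun z => S n z ^+ 2).
pose GM : R * R -> \bar R := EFin \o (fun _ => M ^+ 2).
have mS2 n : measurable_fun r (G n).
  by apply/measurable_EFinP; apply: measurable_funX; apply: measurable_funTS; exact: mS.
have iM : mu2.-integrable r GM.
  by apply: rect_integrable => z; exact: cvg_cst.
have S2M n z : r z -> (`|G n z| <= GM z)%E.
  move=> _ /=; rewrite lee_fin ger0_norm ?sqr_ge0// -(real_normK (num_real (S n z))).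
  by rewrite ler_pXn2r ?nnegrE// (le_trans _ (SM n z)).
have S2l z : r z -> G n z @[n --> \oo] --> (EFin \o (fun _ : R * R => 0 : R)) z.
  move=> _; apply: cvg_EFin; first by apply: nearW.
  have h : (fun n => S n z * S n z) @ \oo --> (0 * 0 : R) by apply: cvgM; exact: Sl.
  rewrite mulr0 in h; rewrite (_ : fine \o _ = (fun n => S n z * S n z))//.
have GMf z : r z -> GM z \is a fin_num by [].
have := @dominated_cvg _ T2 R mu2 r mr _ _ _ mS2 S2l GMf iM S2M.
rewrite [X in _ --> X]integral0.
move=> /fine_cvgP[_] /cvgrPdist_lt/(_ e e0) h.
near=> n; rewrite E.
have : `|0 - \int[mu2]_(z in r) (S n z ^+ 2)| < e by near: n.
by rewrite sub0r normrN; apply: le_lt_trans; exact: ler_norm.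
Unshelve. all: by end_near. Qed.

End RectangleIntegrals.

Section TrialFunctions.
Context {R : realType}.
Implicit Types (a b c d : R) (f g df dg : R -> R) (O : set (R * R)).
Local Notation T2 := (measurableTypeR R * measurableTypeR R)%type.
Local Notation mu2 := (lebesgue2 R).
Local Notation D1 f := ('D_(e1 R) f).
Local Notation D2 f := ('D_(e2 R) f).

Definition tensor f g : R * R -> R := fun z => f z.1 * g z.2.

Lemma der_tensor1 f g df : (forall x : R, is_derive x 1 f (df x)) ->
  forall z, is_derive z (e1 R) (tensor f g) (tensor df g z).
Proof.
move=> hf [x y]; apply/der_slice1; rewrite /tensor /=.
have h := hf x; have h2 := derC (g y) x.
by notypeclasses refine (is_derive_eq (derM h h2) _); rewrite mulr0 addr0.
Qed.

Lemma der_tensor2 f g dg : (forall x : R, is_derive x 1 g (dg x)) ->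
  forall z, is_derive z (e2 R) (tensor f g) (tensor f dg z).
Proof.
move=> hg [x y]; apply/der_slice2; rewrite /tensor /=.
have h := hg y; have h2 := derC (f x) y.
by notypeclasses refine (is_derive_eq (derM h2 h) _); rewrite mul0r add0r.
Qed.

Lemma tensor_D1 f g df : (forall x : R, is_derive x 1 f (df x)) ->
  D1 (tensor f g) = tensor df g.
Proof. by move=> hf; apply/funext => z; case: (der_tensor1 g hf z). Qed.

Lemma tensor_D2 f g dg : (forall x : R, is_derive x 1 g (dg x)) ->
  D2 (tensor f g) = tensor f dg.
Proof. by move=> hg; apply/funext => z; case: (der_tensor2 f hg z). Qed.

Lemma cont_tensor f g : continuous f -> continuous g -> continuous (tensor f g).
Proof.
move=> cf cg z; apply: (@continuousM _ _ (fun z => f z.1) (fun z => g z.2)).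
  by apply: (@continuous_comp _ _ _ fst f); [exact: cvg_fst|exact: cf].
by apply: (@continuous_comp _ _ _ snd g); [exact: cvg_snd|exact: cg].
Qed.

Lemma Cn_tensor n f g : smooth_upto n f -> smooth_upto n g -> Cn n (tensor f g).
Proof.
elim: n f g => [|n IH] f g; first exact: cont_tensor.
move=> hf hg; have hf' := smooth_uptoW hf; have hg' := smooth_uptoW hg.
move: hf hg => [df f1 f2] [dg g1 g2]; split.
- by move=> z; split; [case: (der_tensor1 g f1 z)|case: (der_tensor2 f g1 z)].
- by rewrite (tensor_D1 g f1); exact: IH.
- by rewrite (tensor_D2 f g1); exact: IH.
Qed.

Lemma closed_rect a b c d : closed (rect a b c d).
Proof. by apply: compact_closed; [exact: norm_hausdorff|exact: compact_rect]. Qed.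

Lemma test_cut_mode O a b c d m l (e : R) : orect a b c d `<=` O -> 0 < e ->
  test_function O (tensor (cut_mode a b m e) (cut_mode c d l e)).
Proof.
move=> rO e0.
have sub : closure [set z | tensor (cut_mode a b m e) (cut_mode c d l e) z != 0] `<=`
    rect (a + e) (b - e) (c + e) (d - e).
  rewrite [X in _ `<=` X]((closure_id _).1 (@closed_rect _ _ _ _)).
  apply: closureS => -[x y] /=; rewrite /tensor /= mulf_eq0 negb_or => /andP[h1 h2].
  have /andP[x1 x2] : a + e < x < b - e.
    by apply/negPn/negP => /negP h; rewrite (cut_mode_out m e0 h).1 eqxx in h1.
  have /andP[y1 y2] : c + e < y < d - e.
    by apply/negPn/negP => /negP h; rewrite (cut_mode_out l e0 h).1 eqxx in h2.
  by split; rewrite /= in_itv /= ?(ltW x1) ?(ltW x2) ?(ltW y1) ?(ltW y2).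
split.
- by move=> n; apply: Cn_tensor; exact: smooth_cut_mode.
- by apply: subclosed_compact sub; [exact: closed_closure|exact: compact_rect].
- apply: subset_trans sub _ => -[x y] [] /=; rewrite !in_itv /= => /andP[x1 x2] /andP[y1 y2].
  by apply: rO; split; rewrite /= in_itv /=; apply/andP; split; lra.
Qed.

Lemma tensor_cvg (F G : nat -> R -> R) f g z : F n z.1 @[n --> \oo] --> f z.1 ->
  G n z.2 @[n --> \oo] --> g z.2 -> tensor (F n) (G n) z @[n --> \oo] --> tensor f g z.
Proof. by move=> hf hg; apply: cvgM; [exact: hf|exact: hg]. Qed.

(** Dominated convergence on the rectangle; outside it both functions vanish. *)
Lemma tensor_close O a b c d (F G : nat -> R -> R) f g (M N : R) :
  orect a b c d `<=` O ->
  (forall n, continuous (F n)) -> (forall n, continuous (G n)) ->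
  continuous f -> continuous g ->
  (forall n x, `|F n x| <= M) -> (forall n x, `|G n x| <= N) ->
  (forall x, `|f x| <= M) -> (forall x, `|g x| <= N) ->
  (forall n x, ~ (a < x < b) -> F n x = 0) -> (forall n x, ~ (c < x < d) -> G n x = 0) ->
  (forall x, a < x < b -> F n x @[n --> \oo] --> f x) ->
  (forall x, c < x < d -> G n x @[n --> \oo] --> g x) ->
  forall e : R, 0 < e -> \forall n \near \oo,
    ip O (tensor (F n) (G n) - tensor f g \_ (orect a b c d))
         (tensor (F n) (G n) - tensor f g \_ (orect a b c d)) < e.
Proof.
move=> rO cF cG cf cg FM GN fM gN F0 G0 Ff Gg.
have M0 : 0 <= M by exact: le_trans (normr_ge0 _) (fM 0).
have out n z : ~ orect a b c d z -> tensor (F n) (G n) z = 0.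
  move=> rz; rewrite /tensor.
  have [xab|/negP xab] := boolP (a < z.1 < b); last by rewrite F0// mul0r.
  have [ycd|/negP ycd] := boolP (c < z.2 < d); last by rewrite G0// mulr0.
  by case: rz; split; rewrite /= in_itv /=.
apply: (@dominated_ip _ _ _ (M * N + M * N) a b c d).
- move=> n; apply: measurable_funB.
    by apply: continuous_measurable2; apply: cont_tensor.
  apply: (measurable_restrictT _ (@measurable_orect R a b c d)).1; apply: measurable_funTS.
  by apply: continuous_measurable2; apply: cont_tensor.
- move=> n z; rewrite fctE; apply: le_trans (ler_normB _ _) _.
  apply: lerD; first by rewrite /tensor normrM ler_pM.
  rewrite restrE; case: ifP => _; first by rewrite /tensor normrM ler_pM.
  by rewrite normr0 mulr_ge0// (le_trans _ (gN 0)).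
- move=> n z h; have rz : ~ orect a b c d z.
    by move=> rz; apply: h; split; [exact: rO|exact: orect_sub].
  by rewrite !fctE out// sub0r restrE; case: ifP => [/set_mem//|_]; rewrite oppr0.
- move=> z; have [rz|rz] := pselect (orect a b c d z); last first.
    rewrite (_ : (fun n => _) = fun=> 0); first exact: cvg_cst.
    apply/funext => n; rewrite !fctE out// sub0r restrE; case: ifP => [/set_mem//|_].
    by rewrite oppr0.
  have [/= zx zy] := rz; rewrite !in_itv /= in zx zy.
  rewrite -[X in _ --> X](subrr (tensor f g z)).
  rewrite (_ : (fun n => _) = fun n => tensor (F n) (G n) z - tensor f g z); last first.
    by apply/funext => n; rewrite !fctE restrE (mem_set rz).
  apply: cvgB; last exact: cvg_cst.
  by apply: tensor_cvg; [exact: Ff|exact: Gg].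
Qed.

(** The function is extended by 0, and its gradient too. *)
Definition trial a b c d m l : triple :=
  (tensor (sine_mode a b m) (sine_mode c d l) \_ (orect a b c d),
   tensor (dsine_mode a b m) (sine_mode c d l) \_ (orect a b c d),
   tensor (sine_mode a b m) (dsine_mode c d l) \_ (orect a b c d)).

(** The cut-off modes are test functions, and they and their derivatives are bounded
    independently of e and converge pointwise in the open rectangle. *)
Lemma trial_sobolev O a b c d m l : measurable (O : set T2) -> a < b -> c < d ->
  orect a b c d `<=` O -> sobolev O (trial a b c d m l).
Proof.
move=> mO ab cd rO; apply/(sobolevP mO).
have cs a' b' k : continuous (sine_mode a' b' k) by move=> x; exact: cont_sine_mode.
have cd' a' b' k : continuous (dsine_mode a' b' k) by move=> x; exact: cont_dsine_mode.
have mr := @measurable_orect R a b c d; have sr := @orect_sub R a b c d.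
split.
  split; apply: (L2_restrict mO mr sr); exact: cont_tensor.
move=> e e0.
pose F n := cut_mode a b m (harmonic n); pose G n := cut_mode c d l (harmonic n).
pose dF n := dcut_mode a b m (harmonic n); pose dG n := dcut_mode c d l (harmonic n).
have cc a' b' k (r : R) : continuous (cut_mode a' b' k r).
  by move=> x; exact: der_cont (der_cut_mode a' b' k r x).
have out a' b' k n x : ~ (a' < x < b') -> cut_mode a' b' k (harmonic n) x = 0 /\
    dcut_mode a' b' k (harmonic n) x = 0.
  move=> h; apply: cut_mode_out; first exact: harmonic_gt0.
  have := harmonic_gt0 n : 0 < harmonic n :> R.
  by move=> h0 /andP[h1 h2]; apply: h; apply/andP; split; lra.
have kM a' b' k : a' < b' -> (forall x, `|dsine_mode a' b' k x| <= 11 * wavenumber a' b' k) .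
  move=> ab' x; apply: le_trans (dsine_mode_le k x ab') _.
  by have := wavenumber_ge0 k ab'; lra.
have h1 := @tensor_close O a b c d F G (sine_mode a b m) (sine_mode c d l) 1 1 rO
  (fun n => cc _ _ _ _) (fun n => cc _ _ _ _) (cs _ _ _) (cs _ _ _)
  (fun n => cut_mode_le1 _ _ _ _) (fun n => cut_mode_le1 _ _ _ _)
  (sine_mode_le1 _ _ _) (sine_mode_le1 _ _ _)
  (fun n x h => (out _ _ _ n x h).1) (fun n x h => (out _ _ _ n x h).1)
  (fun x h => (cut_mode_cvg m h).1) (fun x h => (cut_mode_cvg l h).1) e e0.
have h2 := @tensor_close O a b c d dF G (dsine_mode a b m) (sine_mode c d l) _ 1 rO
  (fun n => @cont_dcut_mode R _ _ _ _) (fun n => cc _ _ _ _) (cd' _ _ _) (cs _ _ _)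
  (fun n x => dcut_mode_le m x ab (harmonic_gt0 n)) (fun n => cut_mode_le1 _ _ _ _)
  (kM _ _ _ ab) (sine_mode_le1 _ _ _)
  (fun n x h => (out _ _ _ n x h).2) (fun n x h => (out _ _ _ n x h).1)
  (fun x h => (cut_mode_cvg m h).2) (fun x h => (cut_mode_cvg l h).1) e e0.
have h3 := @tensor_close O a b c d F dG (sine_mode a b m) (dsine_mode c d l) 1 _ rO
  (fun n => cc _ _ _ _) (fun n => @cont_dcut_mode R _ _ _ _) (cs _ _ _) (cd' _ _ _)
  (fun n => cut_mode_le1 _ _ _ _) (fun n x => dcut_mode_le l x cd (harmonic_gt0 n))
  (sine_mode_le1 _ _ _) (kM _ _ _ cd)
  (fun n x h => (out _ _ _ n x h).1) (fun n x h => (out _ _ _ n x h).2)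
  (fun x h => (cut_mode_cvg m h).1) (fun x h => (cut_mode_cvg l h).2) e e0.
have [n [k1 k2 k3]] : exists n, [/\ ip O (tensor (F n) (G n) - (trial a b c d m l).1.1)
      (tensor (F n) (G n) - (trial a b c d m l).1.1) < e,
    ip O (tensor (dF n) (G n) - (trial a b c d m l).1.2)
      (tensor (dF n) (G n) - (trial a b c d m l).1.2) < e &
    ip O (tensor (F n) (dG n) - (trial a b c d m l).2)
      (tensor (F n) (dG n) - (trial a b c d m l).2) < e].
  near \oo => n; exists n; split; near: n.
  - exact: h1.
  - exact: h2.
  - exact: h3.
exists (tensor (F n) (G n)).
  by apply: test_cut_mode => //; exact: harmonic_gt0.
have E1 : D1 (tensor (F n) (G n)) = tensor (dF n) (G n).
  by apply: tensor_D1 => x; exact: der_cut_mode.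
have E2 : D2 (tensor (F n) (G n)) = tensor (F n) (dG n).
  by apply: tensor_D2 => x; exact: der_cut_mode.
pose close u (v : R * R -> R) := ip O (u - v) (u - v) < e.
split; first exact: k1.
- exact: (eq_ind_r (fun u => close u _) k2 E1).
- exact: (eq_ind_r (fun u => close u _) k3 E2).
Unshelve. all: by end_near. Qed.

Lemma rect_tensor a b c d f g f' g' : continuous f -> continuous g ->
  continuous f' -> continuous g' ->
  \int[mu2]_(z in rect a b c d) (tensor f g z * tensor f' g' z) =
  itg a b (fun x => f x * f' x) * itg c d (fun y => g y * g' y).
Proof.
move=> cf cg cf' cg'.
rewrite rect_fubini; last by apply: cont_mul2; exact: cont_tensor.
have cff : cont_on a b (fun x => f x * f' x).
  by move=> x _; have h1 := cf x; have h2 := cf' x; cont.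
have cgg : cont_on c d (fun x => g x * g' x).
  by move=> x _; have h1 := cg x; have h2 := cg' x; cont.
rewrite -itgZ//; apply: eq_itg => y _.
rewrite mulrC -itgZ//; apply: eq_itg => x _.
by rewrite /tensor /=; ring.
Qed.

End TrialFunctions.

(** * Neumann bracketing on a partition into rectangles *)

Section Partition.
Context {R : realType}.
Local Notation T2 := (measurableTypeR R * measurableTypeR R)%type.
Local Notation mu2 := (lebesgue2 R).
Local Notation D1 f := ('D_(e1 R) f).
Local Notation D2 f := ('D_(e2 R) f).
Variables (O : set (R * R)) (P : finType) (a b c d : P -> R) (A : P -> set (R * R)).
Hypothesis mO : measurable (O : set T2).
Hypothesis ab : forall p, a p < b p.
Hypothesis cd : forall p, c p < d p.
Hypothesis mA : forall p, measurable (A p : set T2).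
Hypothesis disjA : forall p p' z, A p z -> A p' z -> p = p'.
Hypothesis orectA : forall p, orect (a p) (b p) (c p) (d p) `<=` A p.
Hypothesis Arect : forall p, A p `<=` rect (a p) (b p) (c p) (d p).
Implicit Types (f : R * R -> R) (p : P).

(** The sets A p are disjoint, and agree with the closed rectangles up to null
    sets. *)
Lemma partition_integral f : (forall z, O z -> exists p, A p z) ->
  continuous f -> (forall z, ~ O z -> f z = 0) ->
  \int[mu2]_(z in O) f z = \sum_p \int[mu2]_(z in rect (a p) (b p) (c p) (d p)) f z.
Proof.
move=> OA cf f0.
have i1 p : mu2.-integrable [set: T2] (EFin \o (f \_ (A p))).
  apply/(integrable_restr (mA p)); apply: integrableS (rect_integrable _ _ _ _ cf) => //.
  exact: measurable_rect.
(* At most one term of the sum is nonzero, and f vanishes on A p outside O. *)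
have fE z : (EFin \o (f \_ O)) z = (\sum_p (EFin \o (f \_ (A p))) z)%E.
  rewrite /= sumEFin; congr EFin; rewrite restrE.
  have [[p Ap]|nA] := pselect (exists p, A p z).
    rewrite (bigD1 p)//= big1 ?addr0; last first.
      move=> p' p'p; rewrite restrE; case: ifP => // /set_mem Ap'.
      by rewrite (disjA Ap Ap') eqxx in p'p.
    rewrite restrE (mem_set Ap); case: ifPn => // /negP zO.
    by rewrite f0// => Oz; apply: zO; rewrite inE.
  rewrite big1; last first.
    by move=> p _; rewrite restrE; case: ifP => // /set_mem Ap; case: nA; exists p.
  by case: ifP => // /set_mem /OA.
rewrite Rintegral_mkcond /Rintegral.
have -> : (\int[mu2]_z ((f \_ O) z)%:E)%E = (\int[mu2]_z \sum_p (EFin \o (f \_ (A p))) z)%E.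
  by apply: eq_integral => z _; exact: fE.
rewrite integral_sum// -sum_fine; last by move=> p _; apply: integrable_fin_num.
apply: eq_bigr => p _; rewrite -[RHS](rect_sandwich (mA p) (@orectA p) (@Arect p) cf).
by rewrite [RHS]Rintegral_mkcond.
Qed.

Variables (L : R) (M : P -> nat) (N : P -> nat -> nat).

(** A piece, a mode in the horizontal direction, and a cell, or a second mode, in
    the vertical one. *)
Definition mode_index := {p : P & {j : 'I_(M p) & 'I_(N p j)}}.

Lemma card_mode_index : #|{: mode_index}| = (\sum_p \sum_(j < M p) N p j)%N.
Proof.
rewrite card_tagged sumnE big_map big_enum /=.
apply: eq_bigr => p _; rewrite card_tagged sumnE big_map big_enum /=.
by apply: eq_bigr => k _; rewrite card_ord.
Qed.

(** Apply the inequality for a rectangle on each piece and add: the functionals are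
    the weighted integrals of a sine mode over a cell. *)
Lemma neumann_gap : 0 <= L -> (forall z, O z -> exists p, A p z) ->
  (forall p y, c p <= y <= d p -> ~ O (a p, y) /\ ~ O (b p, y)) ->
  (forall p (j : 'I_(M p)), wavenumber (a p) (b p) j.+1 ^+ 2 < L) ->
  (forall p, L <= wavenumber (a p) (b p) (M p).+1 ^+ 2) ->
  (forall p (j : 'I_(M p)), (0 < N p j)%N /\
     L - wavenumber (a p) (b p) j.+1 ^+ 2 <= (pi / ((d p - c p) / (N p j)%:R)) ^+ 2) ->
  exists l : mode_index -> triple -> R,
    gap_inequality (energy_form O) (mass_form O) (sobolev O) L l.
Proof.
move=> L0 OA Oside wL Lw NP.
pose w p j := wavenumber (a p) (b p) j.
pose delta p j := (d p - c p) / (N p j)%:R.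
(* The factor of the squared cell integrals in the inequality for a rectangle; its
   square root goes into the functional. *)
pose weight p j := (L - w p j.+1 ^+ 2) / ((b p - a p) / 2 * delta p j).
pose cell p j i := rect (a p) (b p) (c p + i%:R * delta p j) (c p + i.+1%:R * delta p j).
pose xi (t : mode_index) := let p := tag t in let j := tag (tagged t) in
  let i := tagged (tagged t) in
  (fun z : R * R => Num.sqrt (weight p j) * sine_mode (a p) (b p) j.+1 z.1) \_ (cell p j i).
exists (fun t U => ip O U.1.1 (xi t)); apply: gap_from_test => //.
  move=> t; apply: (L2_restrict mO (@measurable_rect R _ _ _ _) (fun z h => h)).
  apply: (@cont_mulfst _ (fun=> _)); first by move=> z; exact: cvg_cst.
  by move=> x; exact: cont_sine_mode.
move=> phi hphi; have [pC [K [cK KO K0]]] := test_compact_C1 hphi.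
have [cu cu1 cu2 du1 du2] := pC.
have out z : ~ O z -> [/\ phi z = 0, D1 phi z = 0 & D2 phi z = 0].
  by move=> Oz; apply: K0 => /KO.
have sq f : (fun z => f z * f z) = (fun z => f z ^+ 2) by apply/funext => z; rewrite expr2.
have csq f : continuous f -> continuous (fun z => f z ^+ 2).
  by move=> cf; rewrite -sq; exact: cont_mul2.
have mE : mass_form O (grad phi) (grad phi) =
    \sum_p \int[mu2]_(z in rect (a p) (b p) (c p) (d p)) (phi z ^+ 2).
  rewrite /mass_form /ip sq; apply: (partition_integral OA); first exact: csq.
  by move=> z /out[h _ _]; rewrite /= h expr0n.
have eE : energy_form O (grad phi) (grad phi) =
    \sum_p \int[mu2]_(z in rect (a p) (b p) (c p) (d p)) (D1 phi z ^+ 2 + D2 phi z ^+ 2).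
  have [p1 p2 p3] := test_L2 mO hphi.
  rewrite /energy_form /ip -RintegralD//; [|exact: L2_mul_integrable|exact: L2_mul_integrable].
  rewrite (_ : (fun z => _) = fun z => D1 phi z ^+ 2 + D2 phi z ^+ 2); last first.
    by apply/funext => z; rewrite !expr2.
  apply: (partition_integral OA); first exact: (cont_add2 (csq _ cu1) (csq _ cu2)).
  by move=> z /out[_ -> ->]; rewrite expr0n addr0.
rewrite mE eE mulr_sumr.
have -> : \sum_t ip O phi (xi t) ^+ 2 = \sum_p \sum_(j < M p) \sum_(i < N p j)
    weight p j * (\int[mu2]_(z in cell p j i) (phi z * sine_mode (a p) (b p) j.+1 z.1)) ^+ 2.
  rewrite [RHS](eq_bigr (fun p => \sum_(s : {j : 'I_(M p) & 'I_(N p j)})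
    ip O phi (xi (Tagged (fun p => {j : 'I_(M p) & 'I_(N p j)}) s)) ^+ 2)).
    rewrite sig_big_dep /=; apply: eq_bigr => -[p s] _; by [].
  move=> p _; rewrite [LHS](eq_bigr (fun j : 'I_(M p) => \sum_(i < N p j)
     ip O phi (xi (Tagged (fun p => {j : 'I_(M p) & 'I_(N p j)})
       (Tagged (fun j : 'I_(M p) => 'I_(N p j)) i))) ^+ 2)).
    by rewrite sig_big_dep /=; apply: eq_bigr => -[j i] _.
  move=> j _; apply: eq_bigr => i _.
  have w0 : 0 <= weight p j.
    have [N0 _] := NP p j.
    rewrite divr_ge0 ?subr_ge0 ?(ltW (wL p j))// mulr_ge0// divr_ge0 ?subr_ge0 ?(ltW (ab p))//.
    by rewrite ltW.
  rewrite -(sqr_sqrtr w0) -exprMn; congr (_ ^+ 2).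
  set t := Tagged (fun p0 => {j0 : 'I_(M p0) & 'I_(N p0 j0)}) _.
  have -> : ip O phi (xi t) = \int[mu2]_(z in cell p j i) (phi z * xi t z).
    apply: integral_supp => z h; rewrite /xi restrE /=.
    case: ifP => [/set_mem zc|_]; last by rewrite mulr0.
    have [Oz|/out[-> _ _]] := pselect (O z); first by case: h.
    by rewrite mul0r.
  rewrite -RintegralZl.
  - by apply: eq_Rintegral => z zc; rewrite /xi restrE /= zc mulrCA.
  - exact: measurable_rect.
  - by apply: rect_integrable; apply: cont_mulfst => // x; exact: cont_sine_mode.
rewrite -big_split /=; apply: ler_sum => p _.
apply: (@rect_inequality R _ _ _ _ phi (D1 phi) (D2 phi) L (M p) (fun j => N p j)) => //.
move=> y /(Oside p)[h1 h2].
by split; [case: (out _ h1)|case: (out _ h2)].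
Qed.

End Partition.

(** * Products of sine modes, and the pieces of the comb *)

Section TrialForms.
Context {R : realType}.
Implicit Types (a b c d lam : R) (O : set (R * R)).
Local Notation T2 := (measurableTypeR R * measurableTypeR R)%type.

Lemma trial_forms O a b c d m l m' l' : a < b -> c < d -> orect a b c d `<=` O ->
  let ii := itg a b (fun x => sine_mode a b m x * sine_mode a b m' x) *
    itg c d (fun y => sine_mode c d l y * sine_mode c d l' y) in
  mass_form O (trial a b c d m l) (trial a b c d m' l') = ii /\
  energy_form O (trial a b c d m l) (trial a b c d m' l') =
    (wavenumber a b m ^+ 2 + wavenumber c d l ^+ 2) * ii.
Proof.
move=> ab cd rO ii.
have cs a' b' k : continuous (sine_mode a' b' k) by move=> x; exact: cont_sine_mode.
have cds a' b' k : continuous (dsine_mode a' b' k) by move=> x; exact: cont_dsine_mode.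
have mr := @measurable_orect R a b c d; have sr := @orect_sub R a b c d.
have dE a' b' k k' : a' < b' ->
    itg a' b' (fun x => dsine_mode a' b' k x * dsine_mode a' b' k' x) =
    wavenumber a' b' k ^+ 2 * itg a' b' (fun x => sine_mode a' b' k x * sine_mode a' b' k' x).
  move=> ab'; apply: sine_mode_energy => //; first exact: C1_sine_mode.
    exact: sine_mode_l.
  exact: sine_mode_r.
split.
  rewrite /mass_form /= (ip_restrict mr (fun z h => h) sr rO); last 2 first.
  - exact: (cont_tensor (cs _ _ _) (cs _ _ _)).
  - exact: (cont_tensor (cs _ _ _) (cs _ _ _)).
  by rewrite (rect_tensor _ _ _ _ (cs _ _ _) (cs _ _ _) (cs _ _ _) (cs _ _ _)).
rewrite /energy_form /= (ip_restrict mr (fun z h => h) sr rO); last 2 first.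
- exact: (cont_tensor (cds _ _ _) (cs _ _ _)).
- exact: (cont_tensor (cds _ _ _) (cs _ _ _)).
rewrite (rect_tensor _ _ _ _ (cds _ _ _) (cs _ _ _) (cds _ _ _) (cs _ _ _)).
rewrite (ip_restrict mr (fun z h => h) sr rO); last 2 first.
- exact: (cont_tensor (cs _ _ _) (cds _ _ _)).
- exact: (cont_tensor (cs _ _ _) (cds _ _ _)).
rewrite (rect_tensor _ _ _ _ (cs _ _ _) (cds _ _ _) (cs _ _ _) (cds _ _ _)).
by rewrite !dE// /ii; ring.
Qed.

Lemma trial_disjoint O a b c d m l a' b' c' d' m' l' :
  (forall z, orect a b c d z -> ~ orect a' b' c' d' z) ->
  mass_form O (trial a b c d m l) (trial a' b' c' d' m' l') = 0 /\
  energy_form O (trial a b c d m l) (trial a' b' c' d' m' l') = 0.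
Proof.
move=> h; rewrite /mass_form /energy_form /=.
by rewrite !(ip_disjoint O _ _ h) addr0.
Qed.

Variables (P : finType) (a b c d : P -> R) (M : P -> nat) (N : P -> nat -> nat).

Lemma dirichlet_family O lam : measurable (O : set T2) ->
  (forall p, a p < b p) -> (forall p, c p < d p) ->
  (forall p, orect (a p) (b p) (c p) (d p) `<=` O) ->
  (forall p p' z, orect (a p) (b p) (c p) (d p) z -> orect (a p') (b p') (c p') (d p') z -> p = p') ->
  (forall p (j : 'I_(M p)) (i : 'I_(N p j)),
     wavenumber (a p) (b p) j.+1 ^+ 2 + wavenumber (c p) (d p) i.+1 ^+ 2 <= lam) ->
  exists w : mode_index M N -> triple,
    (forall i, [/\ sobolev O (w i), 0 < mass_form O (w i) (w i) &
       energy_form O (w i) (w i) <= lam * mass_form O (w i) (w i)]) /\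
    (forall i j, i != j -> energy_form O (w i) (w j) = 0 /\ mass_form O (w i) (w j) = 0).
Proof.
move=> mO ab cd rO disj wlam.
exists (fun t => let p := tag t in let j : 'I_(M p) := tag (tagged t) in
  let i : 'I_(N p j) := tagged (tagged t) in trial (a p) (b p) (c p) (d p) j.+1 i.+1); split.
  move=> [p [j i]] /=.
  have [mE eE] := trial_forms j.+1 i.+1 j.+1 i.+1 (ab p) (cd p) (rO p).
  rewrite sine_mode_norm// sine_mode_norm// in mE eE.
  have m0 : 0 < mass_form O (trial (a p) (b p) (c p) (d p) j.+1 i.+1)
       (trial (a p) (b p) (c p) (d p) j.+1 i.+1).
    by rewrite mE mulr_gt0// divr_gt0// subr_gt0.
  split=> //; first exact: trial_sobolev.
  by rewrite eE -mE ler_wpM2r ?(ltW m0)//; exact: wlam.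
move=> [p [j i]] [p' [j' i']] /= ne.
have [pp|pp] := eqVneq p p'; last first.
  have [//|-> ->] := @trial_disjoint O (a p) (b p) (c p) (d p) j.+1 i.+1
    (a p') (b p') (c p') (d p') j'.+1 i'.+1.
    by move=> z h1 h2; rewrite (disj _ _ _ h1 h2) eqxx in pp.
  by [].
subst p'.
have [-> ->] := trial_forms j.+1 i.+1 j'.+1 i'.+1 (ab p) (cd p) (rO p).
suff -> : itg (a p) (b p) (fun x => sine_mode (a p) (b p) j.+1 x * sine_mode (a p) (b p) j'.+1 x) *
    itg (c p) (d p) (fun y => sine_mode (c p) (d p) i.+1 y * sine_mode (c p) (d p) i'.+1 y) = 0.
  by rewrite mulr0.
have [jj|jj] := eqVneq j j'; last first.
  by rewrite sine_mode_orth// ?mul0r.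
subst j'; have [ii|ii] := eqVneq i i'; first by subst i'; rewrite eqxx in ne.
by rewrite [X in _ * X]sine_mode_orth// mulr0.
Qed.

End TrialForms.

Section CombDomain.
Context {R : realType}.
Variables (h : R) (q : nat).
Hypotheses (h0 : 0 < h) (q0 : (0 < q)%N).
Local Notation T2 := (measurableTypeR R * measurableTypeR R)%type.

(** The piece None is the square, and Some j is the tooth of number j.+1. *)
Definition piece_l (p : option 'I_q) : R := if p is Some j then j%:R / q%:R else 0.
Definition piece_r (p : option 'I_q) : R :=
  if p is Some j then j%:R / q%:R + 1 / (2 * q%:R) else 1.
Definition piece_b (p : option 'I_q) : R := if p is Some j then 1 else 0.
Definition piece_t (p : option 'I_q) : R := if p is Some j then 1 + h else 1.
Definition piece_rect p := rect (piece_l p) (piece_r p) (piece_b p) (piece_t p).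
Definition piece_orect p := orect (piece_l p) (piece_r p) (piece_b p) (piece_t p).

(** The base of a tooth belongs to the square: this makes the pieces disjoint. *)
Definition piece_set (p : option 'I_q) : set (R * R) :=
  if p is Some j then piece_rect p `\` piece_rect None else piece_rect None.

Let qR0 : 0 < q%:R :> R. Proof. by rewrite ltr0n. Qed.

Lemma toothE (j : nat) : tooth h q j.+1 =
  rect (j%:R / q%:R) (j%:R / q%:R + 1 / (2 * q%:R)) 1 (1 + h).
Proof.
have E : j.+1%:R - 1 = j%:R :> R by rewrite -natr1 addrK.
rewrite /tooth E; apply/seteqP; split=> [_ [[x y] [/= xq yh] <-]|[x y] [/= xq yh]].
  move: xq yh; rewrite !in_itv /= => /andP[x0 x1] /andP[y0 y1].
  by split; rewrite /= in_itv /=; apply/andP; split; lra.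
move: xq yh; rewrite !in_itv /= => /andP[x0 x1] /andP[y0 y1].
exists (x - j%:R / q%:R, y - 1).
  by split; rewrite /= in_itv /=; apply/andP; split; lra.
by apply/pair_equal_spec; split; rewrite /= subrK.
Qed.

Lemma combE z : comb h q z <-> exists p, piece_rect p z.
Proof.
split=> [[Qz|[[|j] //= jq]]|[[j|] pz]].
- by exists None.
- by rewrite toothE => tz; exists (Some (Ordinal jq)).
- by right; exists j.+1 => /=; [exact: ltn_ord|rewrite toothE].
- by left.
Qed.

Lemma piece_lt p : piece_l p < piece_r p /\ piece_b p < piece_t p.
Proof.
by case: p => [j|] /=; split; rewrite ?ltr01// ltrDl// divr_gt0// mulr_gt0.
Qed.

(** Distinct teeth are at distance at least 1 / (2 q). *)
Lemma piece_gap (j i : 'I_q) (x : R) : piece_l (Some j) <= x <= piece_r (Some j) ->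
  piece_l (Some i) <= x <= piece_r (Some i) -> i = j.
Proof.
move=> /= /andP[x1 x2] /andP[x3 x4].
have key (m n : nat) : m%:R / q%:R <= n%:R / q%:R + 1 / (2 * q%:R) :> R -> (m <= n)%N.
  rewrite (_ : n%:R / q%:R + 1 / (2 * q%:R) = (n%:R + 1 / 2) / q%:R); last by field; rewrite gt_eqF.
  rewrite ler_pM2r ?invr_gt0// => mn; rewrite -ltnS -(ltr_nat R) -natr1; lra.
apply/val_inj/eqP; rewrite eqn_leq; apply/andP; split; apply: key.
  exact: le_trans x3 x2.
exact: le_trans x1 x4.
Qed.

Lemma measurable_piece p : measurable (piece_set p : set T2).
Proof. by case: p => [j|] /=; [apply: measurableD|]; exact: measurable_rect. Qed.

Lemma piece_disjoint p p' z : piece_set p z -> piece_set p' z -> p = p'.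
Proof.
case: p p' => [j|] [j'|] // => [[h1 _] [h3 _]|[_ h1] /h1//|h1 [_ /(_ h1)]//].
move: h1 h3 => [/= + _] [/= + _]; rewrite !in_itv /= => h1 h3.
by rewrite (piece_gap h1 h3).
Qed.

Lemma piece_orect_sub p : piece_orect p `<=` piece_set p.
Proof.
case: p => [j|] z; last exact: orect_sub.
move=> zo; split; first exact: orect_sub.
by move: zo => [_ /=]; rewrite in_itv /= => /andP[z1 _] [_ /=]; rewrite in_itv /=; lra.
Qed.

Lemma piece_sub_rect p : piece_set p `<=` piece_rect p.
Proof. by case: p => [j|] z //= []. Qed.

Lemma comb_piece z : comb h q z -> exists p, piece_set p z.
Proof.
move=> /combE[[j|] pz]; last by exists None.
have [Qz|Qz] := pselect (piece_rect None z); first by exists None.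
by exists (Some j).
Qed.

Lemma open_orect (a b c d : R) : open (orect a b c d).
Proof. rewrite openE => -[x y] [/= xab ycd].
have h1 : nbhs x `]a, b[%classic by apply: open_nbhs_nbhs; split=> //; exact: interval_open.
have h2 : nbhs y `]c, d[%classic by apply: open_nbhs_nbhs; split=> //; exact: interval_open.
by exists (`]a, b[%classic, `]c, d[%classic). Qed.

Lemma piece_interior p : piece_orect p `<=` interior (comb h q).
Proof.
have := @open_subsetE _ (piece_orect p) (comb h q) (@open_orect _ _ _ _).
by move=> <- z pz; apply/combE; exists p; exact: orect_sub.
Qed.

Lemma interior_shift z : interior (comb h q) z -> exists2 e : R, 0 < e &
  forall s t : R, `|s| < e -> `|t| < e -> comb h q (z.1 + s, z.2 + t).
Proof.
move=> /nbhs_ballP[e /= e0 eh]; exists e => // s t se te; apply: eh.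
by split; rewrite /ball /= opprD addrA subrr sub0r normrN.
Qed.

(** Arbitrarily close to a point on a vertical side of a piece there are points
    outside the comb; next to the base of a tooth they lie above the square, in the
    gap between two teeth. *)
Lemma piece_side p y : piece_b p <= y <= piece_t p ->
  ~ interior (comb h q) (piece_l p, y) /\ ~ interior (comb h q) (piece_r p, y).
Proof.
set u : R := 1 / (2 * q%:R).
have u0 : 0 < u by rewrite divr_gt0// mulr_gt0.
have u2 : 0 < 2 * u by rewrite mulr_gt0.
have qu : q%:R * (2 * u) = 1 by rewrite /u; field; rewrite gt_eqF.
have jE (j : nat) : j%:R / q%:R = j%:R * (2 * u) :> R by rewrite /u; field; rewrite gt_eqF.
have step (i j : nat) : (i < j)%N -> i%:R * (2 * u) + 2 * u <= j%:R * (2 * u).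
  move=> ij; rewrite (_ : _ + _ = i.+1%:R * (2 * u)); last by rewrite -natr1; ring.
  by rewrite (ler_pM2r u2) ler_nat.
have mono (i j : nat) : i%:R * (2 * u) < j%:R * (2 * u) -> (i < j)%N.
  by rewrite (ltr_pM2r u2) ltr_nat.
have pos (i : nat) : 0 <= i%:R * (2 * u) by rewrite mulr_ge0// ltW.
have inE' p' x t : piece_rect p' (x, t) ->
    piece_l p' <= x <= piece_r p' /\ piece_b p' <= t <= piece_t p'.
  by move=> [] /=; rewrite !in_itv.
move=> yp; split=> /interior_shift[e e0 eh].
- pose s := Num.min (e / 2) (u / 2).
  have [s0 se su] : [/\ 0 < s, s < e & s < u].
    have hh : s <= e / 2 by rewrite ge_min lexx.
    have hh' : s <= u / 2 by rewrite ge_min lexx orbT.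
    have : 0 < s by rewrite lt_min; apply/andP; split; lra.
    by move=> ?; split=> //; lra.
  have := eh (- s) (if p is Some _ then s else 0); rewrite normrN gtr0_norm// => /(_ se) {eh}.
  case: p yp => [j|] /= yp; rewrite ?(gtr0_norm s0) ?normr0 => /(_ ltac:(lra)) /combE[[i|] /inE'[/=]].
  + rewrite !jE -/u => x1 x2.
    have /step : (i < j)%N by apply: mono; lra.
    lra.
  + by move=> x1 x2; lra.
  + rewrite !jE => x1 x2; have := pos i; lra.
  + by move=> x1 x2; lra.
- pose s := Num.min (e / 2) (u / 2).
  have [s0 se su] : [/\ 0 < s, s < e & s < u].
    have hh : s <= e / 2 by rewrite ge_min lexx.
    have hh' : s <= u / 2 by rewrite ge_min lexx orbT.
    have : 0 < s by rewrite lt_min; apply/andP; split; lra.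
    by move=> ?; split=> //; lra.
  have := eh s (if p is Some _ then s else 0); rewrite gtr0_norm// => /(_ se) {eh}.
  case: p yp => [j|] /= yp; rewrite ?(gtr0_norm s0) ?normr0 => /(_ ltac:(lra)) /combE[[i|] /inE'[/=]].
  + rewrite !jE -/u => x1 x2.
    have /step : (j < i)%N by apply: mono; lra.
    lra.
  + by move=> x1 x2; lra.
  + rewrite !jE -/u => x1 x2; have := step i q (ltn_ord i); lra.
  + by move=> x1 x2; lra.
Qed.

End CombDomain.

(** * The counting function between two finite dimensions *)

Section Counting.
Context {R : realType} (O : set (R * R)).
Local Notation T2 := (measurableTypeR R * measurableTypeR R)%type.
Local Notation mu2 := (lebesgue2 R).
Hypothesis mO : measurable (O : set T2).
Implicit Types (u v : R * R -> R) (lam nu : R) (U W : @triple R).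
Local Notation aE := (energy_form O).
Local Notation bE := (mass_form O).
Local Notation HO := (sobolev O).

(** The square of u has zero integral only if it vanishes almost everywhere. *)
Lemma L2_null u : L2 O u -> ip O u u = 0 <-> u = cst 0 %[ae mu2 in O].
Proof.
move=> hu; have iu := L2_mul_integrable mO hu hu.
pose f : R * R -> \bar R := EFin \o (fun z => u z * u z).
have mu_ : measurable_fun O f by exact: (measurable_int mu2).
have E : (\int[mu2]_(z in O) `|f z| = (ip O u u)%:E)%E.
  rewrite /ip /Rintegral fineK; last exact: integrable_fin_num.
  by apply: eq_integral => z _; rewrite /f /= ger0_norm// -expr2 sqr_ge0.
have aeP := ae_eq_integral_abs mu2 mO mu_; rewrite E in aeP.
split=> [u0|u0].
  have : ((ip O u u)%:E = 0)%E by rewrite u0.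
  move=> /aeP; apply: filterS => z h Oz; have /= := h Oz.
  by move=> /eqP; rewrite eqe mulf_eq0 orbb => /eqP.
suff /aeP : ae_eq mu2 O f (cst 0%E) by case.
move: u0 => [A [mA A0 sA]]; exists A; split=> // z h; apply: sA => h'; apply: h => Oz.
by rewrite /f /= (h' Oz) mul0r.
Qed.

Lemma eigenspace_eigenpair nu u : Defs.eigenspace O nu u ->
  exists g, eigenpair aE bE HO (u, g.1, g.2) nu.
Proof.
move=> [_ [g1 [g2 [hu wf]]]]; exists (g1, g2); split=> // -[[v h1] h2] hv.
have [/= v0 v1 v2] := sobolev_L2 mO hv.
have hU : HO (u, g1, g2) by [].
have [/= u0 u1 u2] := sobolev_L2 mO hU.
rewrite /energy_form /mass_form /ip /= -RintegralD//; last 2 first.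
- exact: L2_mul_integrable.
- exact: L2_mul_integrable.
rewrite (wf v h1 h2 hv) -RintegralZl//; last exact: L2_mul_integrable.
by apply: eq_Rintegral => z _; rewrite mulrA.
Qed.

Lemma eigenpair_eigenspace nu U : eigenpair aE bE HO U nu -> Defs.eigenspace O nu U.1.1.
Proof.
move=> [hU wf]; have [u0 u1 u2] := sobolev_L2 mO hU; split.
  have := (L2_lin nu u0 (L2_0 O)); rewrite addr0.
  by rewrite (_ : nu *: U.1.1 = fun x => nu * U.1.1 x)//; apply/funext.
exists U.1.2, U.2; split; first exact: hU.
move=> v h1 h2 hv; have hv' : HO (v, h1, h2) by [].
have [/= v0 v1 v2] := sobolev_L2 mO hv'.
have := wf _ hv'; rewrite /energy_form /mass_form /ip /= -RintegralD//; last 2 first.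
- exact: L2_mul_integrable.
- exact: L2_mul_integrable.
move=> ->; rewrite -RintegralZl//; last exact: L2_mul_integrable.
by apply: eq_Rintegral => z _; rewrite mulrA.
Qed.

Lemma sum_triple1 (k : nat) (c : 'I_k -> R) (U : 'I_k -> @triple R) :
  (\sum_i c i *: U i).1.1 = fun z => \sum_i c i * (U i).1.1 z.
Proof.
have -> : (\sum_i c i *: U i).1.1 = \sum_i c i *: (U i).1.1.
  by apply: (big_morph (fun V : @triple R => V.1.1)).
by apply/funext => z; apply: (big_morph (fun f : R * R -> R => f z)).
Qed.

Lemma lin_indep_mass (k : nat) (u : 'I_k -> R * R -> R) (U : 'I_k -> @triple R) :
  (forall i, HO (U i)) -> (forall i, (U i).1.1 = u i) ->
  lin_indep O u <-> forall c : 'I_k -> R,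
    bE (\sum_i c i *: U i) (\sum_i c i *: U i) = 0 -> forall i, c i = 0.
Proof.
move=> hU uE.
have null c : bE (\sum_i c i *: U i) (\sum_i c i *: U i) = 0 <->
    (fun x => \sum_(i < k) c i * u i x) = cst 0 %[ae mu2 in O].
  have hS : HO (\sum_i c i *: U i) by apply: (subspace_sum (sobolev_subspace mO)).
  have [s0 _ _] := sobolev_L2 mO hS.
  have E : (\sum_i c i *: U i).1.1 = fun x => \sum_(i < k) c i * u i x.
    by rewrite sum_triple1; apply/funext => x; apply: eq_bigr => i _; rewrite uE.
  by have := L2_null s0; rewrite -/(bE _ _) E.
by split=> h c /null; exact: h.
Qed.

Lemma multiplicity_ge (k : nat) nu (u : 'I_k -> R * R -> R) :
  (forall i, Defs.eigenspace O nu (u i)) -> lin_indep O u -> (k%:R%:E <= multiplicity O nu)%E.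
Proof. by move=> hu iu; apply: ereal_sup_ubound; exists k => //; exists u. Qed.

(** By the bound on families of eigenvectors every multiplicity is finite, hence
    attained, and any finite set of eigenvalues is covered by one such family. *)
Lemma counting_upper lam (L : R) (n : nat) (l : 'I_n -> @triple R -> R) :
  gap_inequality aE bE HO L l -> lam < L -> (counting_function O lam <= n%:R%:E)%E.
Proof.
move=> gap lamL.
have sH := sobolev_subspace mO; have pa := energy_form_pos mO; have pb := mass_form_pos mO.
have bound (K : finType) (nu : K -> R) (m : K -> nat) (u : forall k, 'I_(m k) -> R * R -> R) :
    injective nu -> (forall k, nu k <= lam) ->
    (forall k i, Defs.eigenspace O (nu k) (u k i)) -> (forall k, lin_indep O (u k)) ->
    (\sum_k m k <= n)%N.
  move=> nuI nulam eu iu.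
  have /choice[g gP] : forall t : {k : K & 'I_(m k)}, exists g,
      eigenpair aE bE HO (u (tag t) (tagged t), g.1, g.2) (nu (tag t)).
    by move=> [k i]; exact: eigenspace_eigenpair (eu k i).
  pose U k (i : 'I_(m k)) : @triple R := (u k i, (g (Tagged (fun k => 'I_(m k)) i)).1,
    (g (Tagged (fun k => 'I_(m k)) i)).2).
  have eU k i : eigenpair aE bE HO (U k i) (nu k) by exact: (gP (Tagged _ i)).
  apply: (eigenvector_family_bound sH pa pb gap lamL nuI eU nulam) => k.
  by apply: (lin_indep_mass (u := u k) _ _).1 => // i; case: (eU k i).
have attained nu : nu <= lam -> exists k (u : 'I_k -> R * R -> R),
    [/\ multiplicity O nu = k%:R%:E, forall i, Defs.eigenspace O nu (u i) & lin_indep O u].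
  move=> nulam.
  pose S k := exists u : 'I_k -> R * R -> R,
    (forall i, Defs.eigenspace O nu (u i)) /\ lin_indep O u.
  have S0 : exists k, `[< S k >].
    by exists 0%N; apply/asboolP; exists (fun=> 0); split=> [[]|c _ []].
  have Sn k : `[< S k >] -> (k <= n)%N.
    move=> /asboolP[u [u1 u2]].
    have := @bound unit (fun=> nu) (fun=> k) (fun=> u).
    by rewrite sum_nat_const card_unit mul1n; apply => // -[] [].
  (* The supremum defining the multiplicity is a maximum. *)
  case: (ex_maxnP S0 Sn) => k /asboolP[u [u1 u2]] kmax.
  exists k, u; split=> //; apply/eqP; rewrite eq_le (multiplicity_ge u1 u2) andbT.
  apply: ge_ereal_sup => _ [j Sj <-]; rewrite lee_fin ler_nat.
  by apply: kmax; apply/asboolP.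
apply: ge_ereal_sup => _ [A [Afin AS] <-].
have [s0 As0] := (finite_seqP A).1 Afin.
pose s := undup s0; have us : uniq s by exact: undup_uniq.
have As : A = [set` s].
  by rewrite As0; apply/seteqP; split=> x /=; rewrite mem_undup.
rewrite As -fsbig_seq//.
have slam i : tnth (in_tuple s) i <= lam.
  by have := AS (tnth (in_tuple s) i); rewrite As /= mem_tnth => /(_ isT) [].
have /choice[t tP] : forall i : 'I_(size s), exists t : {k & 'I_k -> R * R -> R},
    [/\ multiplicity O (tnth (in_tuple s) i) = (tag t)%:R%:E,
      forall j, Defs.eigenspace O (tnth (in_tuple s) i) (tagged t j) & lin_indep O (tagged t)].
  by move=> i; have [k [u hu]] := attained _ (slam i); exists (Tagged (fun k => 'I_k -> R * R -> R) u).
rewrite big_tnth (eq_bigr (fun i => (tag (t i))%:R%:E)); last by move=> i _; case: (tP i).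
rewrite sumEFin lee_fin -natr_sum ler_nat.
apply: (bound _ (fun i => tnth (in_tuple s) i) _ (fun i => tagged (t i))) => //.
- exact/tuple_uniqP.
- by move=> i j; case: (tP i).
- by move=> i; case: (tP i).
Qed.

(** Group an orthonormal family of eigenvectors by eigenvalue. *)
Lemma counting_lower lam (m : nat) (e : 'I_m -> @triple R) (nu : 'I_m -> R) :
  (forall i, eigenpair aE bE HO (e i) (nu i) /\ nu i <= lam) ->
  (forall i j, bE (e i) (e j) = (i == j)%:R) ->
  (m%:R%:E <= counting_function O lam)%E.
Proof.
move=> ep orth.
have sH := sobolev_subspace mO; have pb := mass_form_pos mO.
have he i : HO (e i) by case: (ep i) => -[].
pose s := undup [seq nu i | i <- enum 'I_m]; have us : uniq s by exact: undup_uniq.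
have ins r : r \in s -> exists i, nu i = r.
  by rewrite mem_undup => /mapP[i _ ->]; exists i.
apply: esum_ge; exists [set` s].
  split; first by apply/finite_seqP; exists s.
  move=> r /= /ins[i <-]; have [ei nui] := ep i; split=> //.
  exists (e i).1.1; first exact: eigenpair_eigenspace.
  have [u0 _ _] := sobolev_L2 mO (he i).
  move=> /(L2_null u0); rewrite -/(bE _ _) orth eqxx => /eqP.
  by rewrite oner_eq0.
rewrite -fsbig_seq//.
apply: (@le_trans _ _ (\sum_(r <- s) (#|[set i | nu i == r]%SET|)%:R%:E)%E).
  rewrite sumEFin lee_fin -natr_sum ler_nat.
  rewrite (eq_bigr (fun r => \sum_(i < m | nu i == r) 1)%N); last first.
    by move=> r _; rewrite sum1dep_card.
  (* Each index i is counted at the eigenvalue nu i. *)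
  rewrite (exchange_big_dep predT)//= -[X in (X <= _)%N]card_ord -sum1_card.
  apply: leq_sum => i _; rewrite sum1_count -has_count.
  by apply/hasP; exists (nu i); rewrite //= mem_undup map_f// mem_enum.
apply: lee_sum => r _.
pose A := [set i | nu i == r]%SET.
have inA (j : 'I_#|A|) : nu (enum_val j) = r.
  by have := enum_valP j; rewrite inE => /eqP.
apply: (@multiplicity_ge _ r (fun j : 'I_#|A| => (e (enum_val j)).1.1)).
  by move=> j; have [h _] := ep (enum_val j); rewrite -(inA j); exact: eigenpair_eigenspace.
apply: (lin_indep_mass (U := fun j => e (enum_val j)) _ _).2 => // c.
rewrite (form_suml sH pb) //; last exact: subspace_sum.
rewrite (eq_bigr (fun j => c j ^+ 2)); last first.
  move=> j _; rewrite (form_sumr sH pb)// (bigD1 j)//= orth eqxx mulr1 big1 ?addr0 ?expr2//.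
  move=> k kj; rewrite orth (inj_eq enum_val_inj) eq_sym (negbTE kj) mulr0//.
move=> /eqP; rewrite psumr_eq0; last by move=> j _; exact: sqr_ge0.
by move=> /allP/(_ _ (mem_index_enum _)) h i; have := h i; rewrite /= sqrf_eq0 => /eqP.
Qed.

End Counting.

(** * Counting modes *)

Section LatticeCount.
Context {R : realType}.
Implicit Types (r s t x y : R).

Lemma cos_nincr s t : 0 <= s -> s <= t -> t <= pi -> cos t <= cos s :> R.
Proof.
move=> s0; rewrite le_eqVlt => /orP[/eqP->//|st] tpi.
apply: ltW; rewrite ltr_cos// in_itv /=; apply/andP; split=> //; lra.
Qed.

(** The derivative is (r cos t)^2: the area under the circle up to the abscissa
    r sin t. *)
Definition disk_primitive r t := r ^+ 2 * ((t + sin t * cos t) / 2).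

(** The cosine decreases on [0, pi / 2]. *)
Lemma disk_step r s t : 0 < r -> 0 <= s -> s <= t -> t <= pi / 2 ->
  r * cos t * (r * sin t - r * sin s) <= disk_primitive r t - disk_primitive r s /\
  disk_primitive r t - disk_primitive r s <= r * cos s * (r * sin t - r * sin s).
Proof.
move=> r0 s0 st tpi; have pi0 := pi_gt0 R.
pose f x := r ^+ 2 * cos x ^+ 2; pose g k x := k * (r * cos x).
have cf : cont_on s t f by move=> x _; have h := @continuous_cos R x; rewrite /f; cont.
have cg k : cont_on s t (g k) by move=> x _; have h := @continuous_cos R x; rewrite /g; cont.
have hf : itg s t f = disk_primitive r t - disk_primitive r s.
  apply: (itg_FTC st cf) => x _; rewrite /disk_primitive.
  have h1 := is_derive_sin x; have h2 := is_derive_cos x; der.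
  rewrite /f; have := cos2Dsin2 x => h.
  have -> : sin x * - sin x = cos x ^+ 2 - 1 by rewrite -h; ring.
  by field.
have hg k : itg s t (g k) = k * (r * sin t - r * sin s).
  by rewrite mulrBr; apply: (@itg_FTC _ _ _ (fun x => k * (r * sin x))).
have cosx x : s <= x <= t -> cos t <= cos x /\ cos x <= cos s.
  by move=> /andP[sx xt]; split; apply: cos_nincr; lra.
have cos0 x : s <= x <= t -> 0 <= cos x.
  move=> /cosx[h _]; apply: le_trans h; rewrite -(@cos_pihalf R).
  by apply: cos_nincr; lra.
rewrite -hf -!hg; split; apply: le_itg => // x /[dup] /cos0 h /cosx[h1 h2].
  rewrite /f (_ : g _ x = r ^+ 2 * (cos t * cos x)); last by rewrite /g; ring.
  by rewrite ler_wpM2l ?sqr_ge0// expr2 ler_wpM2r.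
rewrite /f (_ : g _ x = r ^+ 2 * (cos s * cos x)); last by rewrite /g; ring.
by rewrite ler_wpM2l ?sqr_ge0// expr2 ler_wpM2r.
Qed.

Definition disk_area r x := disk_primitive r (asin (x / r)).

Lemma asin_angle r x : 0 < r -> 0 <= x <= r -> [/\ 0 <= asin (x / r), asin (x / r) <= pi / 2,
  r * sin (asin (x / r)) = x & r * cos (asin (x / r)) = Num.sqrt (r ^+ 2 - x ^+ 2)].
Proof.
move=> r0 /andP[x0 xr]; have pi0 := pi_gt0 R.
have u0 : 0 <= x / r by rewrite divr_ge0// ltW.
have u1 : x / r <= 1 by rewrite ler_pdivrMr// mul1r.
have u : -1 <= x / r <= 1 by apply/andP; split; lra.
have a1 := asin_geNpi2 u; have a2 := asin_lepi2 u.
have sE : sin (asin (x / r)) = x / r by apply: asinK; rewrite in_itv.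
split=> //.
- rewrite leNgt; apply/negP => an.
  have : sin (asin (x / r)) < sin 0 :> R.
    by rewrite ltr_sin// in_itv /=; apply/andP; split; lra.
  by rewrite sE sin0; lra.
- by rewrite sE mulrC divfK// gt_eqF.
- have rE : Num.sqrt (r ^+ 2) = r by rewrite sqrtr_sqr gtr0_norm.
  rewrite cos_asin// -[X in X * _]rE -sqrtrM ?sqr_ge0//.
  by congr Num.sqrt; field; rewrite gt_eqF.
Qed.

(** Parametrizing by the angle avoids the derivative of the arcsine, which is
    infinite at the end of the radius. *)
Lemma disk_area_step r x y : 0 < r -> 0 <= x -> x <= y -> y <= r ->
  Num.sqrt (r ^+ 2 - y ^+ 2) * (y - x) <= disk_area r y - disk_area r x /\
  disk_area r y - disk_area r x <= Num.sqrt (r ^+ 2 - x ^+ 2) * (y - x).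
Proof.
move=> r0 x0 xy yr; have pi0 := pi_gt0 R.
have [|a1 a2 a3 a4] := @asin_angle r x r0; first by rewrite x0 (le_trans xy).
have [|b1 b2 b3 b4] := @asin_angle r y r0; first by rewrite (le_trans x0).
have ab : asin (x / r) <= asin (y / r).
  rewrite leNgt; apply/negP => h.
  have : sin (asin (y / r)) < sin (asin (x / r)) :> R.
    by rewrite ltr_sin// in_itv /=; apply/andP; split; lra.
  by rewrite -(ltr_pM2l r0) a3 b3; lra.
by have := disk_step r0 a1 ab b2; rewrite a3 a4 b3 b4.
Qed.

Lemma disk_area0 r : disk_area r 0 = 0.
Proof.
rewrite /disk_area /disk_primitive mul0r.
have -> : asin 0 = 0 :> R.
  by rewrite -[in LHS](@sin0 R) sinK// in_itv /=; have := pi_gt0 R; lra.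
by rewrite sin0; ring.
Qed.

Lemma disk_arear r : 0 < r -> disk_area r r = pi * r ^+ 2 / 4.
Proof.
move=> r0; rewrite /disk_area /disk_primitive divff ?gt_eqF//.
have -> : asin 1 = pi / 2 :> R.
  by rewrite -[X in asin X](@sin_pihalf R) sinK// in_itv /=; have := pi_gt0 R; lra.
by rewrite cos_pihalf; field.
Qed.

Lemma quarter_disk_upper r (M : nat) : 0 < r -> M%:R <= r ->
  \sum_(j < M) Num.sqrt (r ^+ 2 - j.+1%:R ^+ 2) <= pi * r ^+ 2 / 4.
Proof.
move=> r0 Mr.
have h : \sum_(j < M) Num.sqrt (r ^+ 2 - j.+1%:R ^+ 2) <= disk_area r M%:R.
  elim: M Mr => [|M IH] Mr; first by rewrite big_ord0 disk_area0.
  have MM : M%:R <= M.+1%:R :> R by rewrite ler_nat.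
  have := IH (le_trans MM Mr).
  have [h _] := disk_area_step r0 (ler0n R M) MM Mr.
  rewrite big_ord_recr /=; move: h; rewrite -natr1 [_ + 1 - _]addrAC subrr add0r mulr1; lra.
have [h1 _] := disk_area_step r0 (ler0n R M) Mr (lexx r).
rewrite -disk_arear//; move: h1; rewrite subrr sqrtr0 mul0r; lra.
Qed.

Lemma quarter_disk_lower r (M : nat) : 0 < r -> M%:R <= r -> r <= M.+1%:R ->
  pi * r ^+ 2 / 4 - r <= \sum_(j < M) Num.sqrt (r ^+ 2 - j.+1%:R ^+ 2).
Proof.
move=> r0 Mr rM.
have h : disk_area r M%:R <= \sum_(j < M) Num.sqrt (r ^+ 2 - j%:R ^+ 2).
  elim: M Mr {rM} => [|M IH] Mr; first by rewrite big_ord0 disk_area0.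
  have MM : M%:R <= M.+1%:R :> R by rewrite ler_nat.
  have := IH (le_trans MM Mr).
  have [_ h] := disk_area_step r0 (ler0n R M) MM Mr.
  rewrite big_ord_recr /=; move: h.
  have -> : M.+1%:R - M%:R = 1 :> R by rewrite -natr1; ring.
  by rewrite mulr1; lra.
have [_ h1] := disk_area_step r0 (ler0n R M) Mr (lexx r).
have h2 : Num.sqrt (r ^+ 2 - M%:R ^+ 2) * (r - M%:R) <= Num.sqrt (r ^+ 2 - M%:R ^+ 2).
  by rewrite ler_piMr ?sqrtr_ge0//; move: rM; rewrite -natr1; lra.
have h3 : disk_area r r <= \sum_(j < M.+1) Num.sqrt (r ^+ 2 - j%:R ^+ 2).
  by rewrite big_ord_recr /=; lra.
move: h3; rewrite big_ord_recl /= expr0n subr0 sqrtr_sqr gtr0_norm// disk_arear//.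
by under eq_bigr do rewrite /bump leq0n add1n; lra.
Qed.

(** The number of i >= 1 with w^2 + (i pi / H)^2 <= L. *)
Definition lower_count (H L w : R) : nat := Num.truncn (H / pi * Num.sqrt (L - w ^+ 2)).

(** The least number N >= 1 of cells with L - w^2 < (pi N / H)^2. *)
Definition upper_count (H L w : R) : nat := (lower_count H L w).+1.

Lemma count_arg_ge0 (H L w : R) : 0 < H -> 0 <= H / pi * Num.sqrt (L - w ^+ 2).
Proof. by move=> H0; rewrite mulr_ge0 ?sqrtr_ge0// divr_ge0 ?pi_ge0// ltW. Qed.

Lemma lower_count_ge (H L w : R) :
  H / pi * Num.sqrt (L - w ^+ 2) - 1 <= (lower_count H L w)%:R.
Proof. by have := truncnS_gt (H / pi * Num.sqrt (L - w ^+ 2)); rewrite -natr1 /lower_count; lra. Qed.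

Lemma upper_count_le (H L w : R) : 0 < H ->
  (upper_count H L w)%:R <= H / pi * Num.sqrt (L - w ^+ 2) + 1.
Proof.
move=> H0; rewrite /upper_count -natr1 lerD2r /lower_count.
by case/andP: (truncn_itv (count_arg_ge0 L w H0)).
Qed.

Lemma lower_count_modes (H L w c : R) (i : nat) : 0 < H -> (i < lower_count H L w)%N ->
  w ^+ 2 + wavenumber c (c + H) i.+1 ^+ 2 <= L.
Proof.
move=> H0; rewrite truncn_gt_nat /wavenumber addrAC subrr add0r => iL.
have p0 := pi_gt0 R.
have h : i.+1%:R * (pi / H) <= Num.sqrt (L - w ^+ 2).
  rewrite mulrA ler_pdivrMr// mulrC -ler_pdivlMl//; apply: le_trans iL _.
  by rewrite mulrC [leRHS]mulrC -mulrA lexx.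
have h0 : 0 < i.+1%:R * (pi / H) by rewrite mulr_gt0// divr_gt0.
have Lw : 0 < L - w ^+ 2 by rewrite -sqrtr_gt0; exact: lt_le_trans h.
rewrite -lerBrDl -(sqr_sqrtr (ltW Lw)) ler_pXn2r// nnegrE ?sqrtr_ge0//.
exact: ltW.
Qed.

Lemma upper_count_cells (H L w c : R) : 0 < H -> w ^+ 2 <= L ->
  L - w ^+ 2 <= (pi / ((c + H - c) / (upper_count H L w)%:R)) ^+ 2.
Proof.
move=> H0 wL; rewrite addrAC subrr add0r; have p0 := pi_gt0 R.
have N0 : 0 < (upper_count H L w)%:R :> R by rewrite ltr0n.
rewrite -[leLHS]sqr_sqrtr ?subr_ge0// ler_pXn2r ?nnegrE ?sqrtr_ge0 ?divr_ge0 ?(ltW p0) ?(ltW H0) ?(ltW N0)//.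
have := ltW (truncnS_gt (H / pi * Num.sqrt (L - w ^+ 2))).
rewrite -/(upper_count _ _ _) mulrC mulrA ler_pdivrMr// => h.
by rewrite invf_div mulrA ler_pdivlMr// [pi * _]mulrC.
Qed.

End LatticeCount.

(** * Bracketing on the comb and asymptotics *)

Section CombBracketing.
Context {R : realType}.
Variables (h : R) (q : nat).
Hypotheses (h0 : 0 < h) (q0 : (0 < q)%N).
Local Notation T2 := (measurableTypeR R * measurableTypeR R)%type.
Local Notation O := (interior (comb h q)).
Implicit Types (p : option 'I_q) (lam L : R).

Definition piece_height p : R := if p is Some j then h else 1.
Definition piece_wave p (m : nat) : R := wavenumber (piece_l p) (piece_r p) m.

Lemma piece_height_gt0 p : 0 < piece_height p.
Proof. by case: p. Qed.

Lemma piece_tE p : piece_t h p = piece_b p + piece_height p.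
Proof. by case: p => [j|] /=; rewrite ?add0r. Qed.

Lemma gap_reindex (V : lmodType R) (a b : V -> V -> R) (H : V -> Prop) L (J : finType)
    (l : J -> V -> R) : gap_inequality a b H L l ->
  gap_inequality a b H L (fun (i : 'I_#|J|) => l (enum_val i)).
Proof.
move=> [h1 [K hK] [C C0 hC]]; split; first by move=> i; exact: h1.
  by exists K => i; exact: hK.
exists C => // u hu; apply: le_trans (hC u hu) _.
rewrite (reindex (fun i : 'I_#|J| => enum_val i))//.
by exists enum_rank => x _; rewrite ?enum_valK ?enum_rankK.
Qed.

(** M counts the horizontal modes below the level L, M' those used in the trial
    functions. *)
Lemma comb_bracket lam L (M M' : option 'I_q -> nat) : 0 <= L -> lam < L ->
  (forall p (j : 'I_(M p)), piece_wave p j.+1 ^+ 2 < L) ->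
  (forall p, L <= piece_wave p (M p).+1 ^+ 2) ->
  (((\sum_p \sum_(j < M' p) lower_count (piece_height p) lam (piece_wave p j.+1))%:R)%:E
     <= counting_function O lam)%E /\
  (counting_function O lam <=
    ((\sum_p \sum_(j < M p) upper_count (piece_height p) L (piece_wave p j.+1))%:R)%:E)%E.
Proof.
move=> L0 lamL wL Lw.
have oO : open O by exact: open_interior.
have mO : measurable (O : set T2) by exact: open_measurable2.
have ab p : piece_l p < piece_r p :> R by case: (piece_lt h0 q0 p).
have cd p : piece_b p < piece_t h p by case: (piece_lt h0 q0 p).
have OA z : O z -> exists p, piece_set h p z.
  by move=> /interior_subset; exact: comb_piece.
pose N p (j : nat) := upper_count (piece_height p) L (piece_wave p j.+1).
have NP p (j : 'I_(M p)) : (0 < N p j)%N /\ L - piece_wave p j.+1 ^+ 2 <=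
    (pi / ((piece_t h p - piece_b p) / (N p j)%:R)) ^+ 2.
  split=> //; rewrite piece_tE; apply: upper_count_cells; first exact: piece_height_gt0.
  exact: ltW (wL p j).
have [l gap] := neumann_gap mO ab cd (@measurable_piece R h q) (@piece_disjoint R h q q0)
  (@piece_orect_sub R h q) (@piece_sub_rect R h q) L0 OA (@piece_side R h q q0) wL Lw NP.
have gap' := gap_reindex gap.
split; last first.
  by have := counting_upper mO gap' lamL; rewrite card_mode_index.
pose N' p (j : nat) := lower_count (piece_height p) lam (piece_wave p j.+1).
have w' p (j : 'I_(M' p)) (i : 'I_(N' p j)) :
    piece_wave p j.+1 ^+ 2 + wavenumber (piece_b p) (piece_t h p) i.+1 ^+ 2 <= lam.
  by rewrite piece_tE; apply: lower_count_modes; [exact: piece_height_gt0|exact: ltn_ord].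
have disj p p' z : piece_orect h p z -> piece_orect h p' z -> p = p'.
  by move=> /piece_orect_sub h1 /piece_orect_sub h2; exact: (piece_disjoint q0 h1 h2).
have [w [w1 w2]] := dirichlet_family mO ab cd (@piece_interior R h q) disj w'.
have [e [nu [e1 e2]]] := eigenvectors_exist (sobolev_subspace mO) (energy_form_pos mO)
  (mass_form_pos mO) (sobolev_complete mO) gap' lamL w1 w2.
by have := counting_lower mO e1 e2; rewrite card_mode_index.
Qed.

End CombBracketing.

Section Asymptotics.
Context {R : realType}.
Implicit Types (h mu L : R).

Lemma sum_option (q : nat) (F : option 'I_q -> nat) :
  (\sum_p F p = F None + \sum_(i < q) F (Some i))%N.
Proof.
rewrite (bigD1 None)//=; congr addn.
rewrite (reindex_omap Some id) /=; last by case.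
by apply: eq_bigl => i; rewrite eqxx.
Qed.

Lemma piece_wave_square (q : nat) (m : nat) :
  piece_wave (None : option 'I_q) m = m%:R * pi :> R.
Proof. by rewrite /piece_wave /wavenumber /= subr0 divr1. Qed.

Lemma piece_wave_tooth (q : nat) (i : 'I_q) (m : nat) : (0 < q)%N ->
  piece_wave (Some i) m = q%:R * (2 * pi * m%:R) :> R.
Proof.
move=> q0; rewrite /piece_wave /wavenumber /= addrAC subrr add0r; field.
by rewrite pnatr_eq0 -lt0n.
Qed.

Lemma square_root_scaled L (m : nat) : 0 < L ->
  1 / pi * Num.sqrt (L - (m%:R * pi) ^+ 2) = Num.sqrt ((Num.sqrt L / pi) ^+ 2 - m%:R ^+ 2) :> R.
Proof.
move=> L0; have p0 := pi_gt0 R.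
have -> : 1 / pi = Num.sqrt ((1 / pi) ^+ 2) :> R.
  by rewrite sqrtr_sqr gtr0_norm// divr_gt0.
rewrite -sqrtrM ?sqr_ge0//; congr Num.sqrt.
rewrite -[in LHS](sqr_sqrtr (ltW L0)).
have key (P S : R) : 0 < P -> (1 / P) ^+ 2 * (S ^+ 2 - (m%:R * P) ^+ 2) = (S / P) ^+ 2 - m%:R ^+ 2.
  by move=> P0; field; rewrite gt_eqF.
exact: key.
Qed.

Lemma disk_areaE L : 0 < L -> pi * (Num.sqrt L / pi) ^+ 2 / 4 = L / (4 * pi) :> R.
Proof.
move=> L0; rewrite -[in RHS](sqr_sqrtr (ltW L0)).
have key (P S : R) : 0 < P -> P * (S / P) ^+ 2 / 4 = S ^+ 2 / (4 * P).
  by move=> P0; field; rewrite gt_eqF.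
exact: key (pi_gt0 R).
Qed.

(** M is the number of m >= 1 with m < r, where r = sqrt L / pi. *)
Lemma square_upper L : 0 < L -> exists M,
  [/\ forall j : 'I_M, (j.+1%:R * pi) ^+ 2 < L, L <= (M.+1%:R * pi) ^+ 2 &
    \sum_(j < M) (upper_count 1 L (j.+1%:R * pi))%:R <= L / (4 * pi) + Num.sqrt L / pi].
Proof.
move=> L0; have p0 := pi_gt0 R; pose r := Num.sqrt L / pi.
have sL0 : 0 < Num.sqrt L by rewrite sqrtr_gt0.
have r0 : 0 < r by rewrite divr_gt0.
have rL m : (r <= m%:R) = (L <= (m%:R * pi) ^+ 2).
  rewrite ler_pdivrMr// -[in RHS](sqr_sqrtr (ltW L0)) ler_pXn2r// nnegrE ?(ltW sL0)//.
  by rewrite mulr_ge0// ltW.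
have exM : exists n, r <= n.+1%:R by exists (Num.truncn r); exact/ltW/truncnS_gt.
case: (ex_minnP exM) => M rM Mmin; exists M.
have jr (j : 'I_M) : j.+1%:R < r.
  rewrite ltNge; apply/negP => rj; have := Mmin _ rj.
  by rewrite leqNgt ltn_ord.
split.
- by move=> j; rewrite ltNge -rL -ltNge.
- by rewrite -rL.
have Mr : M%:R <= r.
  case: M {rM Mmin} jr => [|M] jr; first exact: ltW.
  exact: ltW (jr ord_max).
apply: (@le_trans _ _ (\sum_(j < M) (Num.sqrt (r ^+ 2 - j.+1%:R ^+ 2) + 1))).
  apply: ler_sum => j _; apply: le_trans (upper_count_le L _ ltr01) _.
  by rewrite square_root_scaled.
rewrite big_split /= sumr_const card_ord; apply: lerD.
  by apply: le_trans (quarter_disk_upper r0 Mr) _; rewrite disk_areaE.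
by [].
Qed.

(** The rounding and the first column of the quarter disk cost at most r each. *)
Lemma square_lower L : 0 < L -> exists M,
  L / (4 * pi) - 2 * (Num.sqrt L / pi) <= \sum_(j < M) (lower_count 1 L (j.+1%:R * pi))%:R.
Proof.
move=> L0; have p0 := pi_gt0 R; pose r := Num.sqrt L / pi.
have sL0 : 0 < Num.sqrt L by rewrite sqrtr_gt0.
have r0 : 0 < r by rewrite divr_gt0.
exists (Num.truncn r); set M := Num.truncn r.
have Mr : M%:R <= r by rewrite /M truncn_le ltW.
have rM : r <= M.+1%:R by exact/ltW/truncnS_gt.
apply: (@le_trans _ _ (\sum_(j < M) (Num.sqrt (r ^+ 2 - j.+1%:R ^+ 2) - 1))); last first.
  apply: ler_sum => j _; apply: le_trans (lower_count_ge 1 L _).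
  by rewrite square_root_scaled.
rewrite big_split /= sumr_const card_ord mulNrn.
by have := quarter_disk_lower r0 Mr rM; rewrite disk_areaE// -/r; lra.
Qed.

(** The modes with 4 pi^2 l^2 <= mu. *)
Definition tooth_modes mu : nat := Num.truncn (Num.sqrt mu / (2 * pi)).

(** The vertical wave number available at level mu q^2 in a tooth, divided by q, for
    the horizontal mode l. *)
Definition residual_wave mu (l : nat) : R := Num.sqrt (mu - (2 * pi * l%:R) ^+ 2).

Lemma tooth_modes_in mu (j : 'I_(tooth_modes mu)) : 0 < mu ->
  (2 * pi * j.+1%:R) ^+ 2 <= mu.
Proof.
move=> m0; have p0 := pi_gt0 R.
have sm0 : 0 < Num.sqrt mu by rewrite sqrtr_gt0.
have := ltn_ord j; rewrite /tooth_modes truncn_gt_nat ler_pdivlMr ?mulr_gt0// => h.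
rewrite -[leRHS](sqr_sqrtr (ltW m0)) ler_pXn2r// ?nnegrE ?(ltW sm0)//.
  by rewrite mulrC.
by rewrite !mulr_ge0 ?(ltW p0).
Qed.

Lemma tooth_modes_out mu : 0 < mu -> mu < (2 * pi * (tooth_modes mu).+1%:R) ^+ 2.
Proof.
move=> m0; have p0 := pi_gt0 R.
have sm0 : 0 < Num.sqrt mu by rewrite sqrtr_gt0.
have := truncnS_gt (Num.sqrt mu / (2 * pi)).
rewrite ltr_pdivrMr ?mulr_gt0// mulrC => h.
rewrite -[X in X < _](sqr_sqrtr (ltW m0)) ltr_pXn2r// ?nnegrE ?(ltW sm0)//.
by rewrite !mulr_ge0 ?(ltW p0).
Qed.

Lemma weyl_constE h mu : 0 < mu ->
  weyl_const h mu = mu / (4 * pi) + h / pi * \sum_(j < tooth_modes mu) residual_wave mu j.+1.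
Proof.
move=> m0; rewrite /weyl_const -mulrA; congr (_ + _ * _).
rewrite big_add1 big_mkord mulr_sumr; apply: eq_bigr => j _.
rewrite -sqrtrM ?(ltW m0)// /residual_wave; congr Num.sqrt.
by field; rewrite gt_eqF.
Qed.

(** The shift from mu q^2 to mu q^2 + 1 raises each square root by at most 1. *)
Lemma tooth_upper h mu (q : nat) : 0 < h -> 0 < mu ->
  \sum_(j < tooth_modes mu) (upper_count h (mu * q%:R ^+ 2 + 1) (q%:R * (2 * pi * j.+1%:R)))%:R
  <= q%:R * (h / pi * \sum_(j < tooth_modes mu) residual_wave mu j.+1)
     + (tooth_modes mu)%:R * (h / pi + 1).
Proof.
move=> h0 m0; have p0 := pi_gt0 R.
have -> : q%:R * (h / pi * \sum_(j < tooth_modes mu) residual_wave mu j.+1)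
     + (tooth_modes mu)%:R * (h / pi + 1) =
    \sum_(j < tooth_modes mu) (h / pi * (q%:R * residual_wave mu j.+1 + 1) + 1).
  rewrite !big_split /= sumr_const card_ord -mulr_sumr big_split /= sumr_const card_ord -mulr_sumr.
  by ring.
apply: ler_sum => j _; apply: le_trans (upper_count_le _ _ h0) _.
rewrite lerD2r ler_wpM2l ?divr_ge0 ?(ltW h0) ?(ltW p0)//.
have s2 : residual_wave mu j.+1 ^+ 2 = mu - (2 * pi * j.+1%:R) ^+ 2.
  by rewrite sqr_sqrtr// subr_ge0 tooth_modes_in.
have t0 : 0 <= q%:R * residual_wave mu j.+1 by rewrite mulr_ge0// sqrtr_ge0.
rewrite -[leRHS]ger0_norm ?addr_ge0// -sqrtr_sqr ler_sqrt ?sqr_ge0//.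
have -> : mu * q%:R ^+ 2 + 1 - (q%:R * (2 * pi * j.+1%:R)) ^+ 2 =
    q%:R ^+ 2 * residual_wave mu j.+1 ^+ 2 + 1 by rewrite s2; ring.
have -> : (q%:R * residual_wave mu j.+1 + 1) ^+ 2 =
    q%:R ^+ 2 * residual_wave mu j.+1 ^+ 2 + 2 * (q%:R * residual_wave mu j.+1) + 1 by ring.
lra.
Qed.

Lemma tooth_lower h mu (q : nat) : 0 < h -> 0 < mu ->
  q%:R * (h / pi * \sum_(j < tooth_modes mu) residual_wave mu j.+1) - (tooth_modes mu)%:R <=
  \sum_(j < tooth_modes mu) (lower_count h (mu * q%:R ^+ 2) (q%:R * (2 * pi * j.+1%:R)))%:R.
Proof.
move=> h0 m0; have p0 := pi_gt0 R.
have -> : q%:R * (h / pi * \sum_(j < tooth_modes mu) residual_wave mu j.+1)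
     - (tooth_modes mu)%:R =
    \sum_(j < tooth_modes mu) (h / pi * (q%:R * residual_wave mu j.+1) - 1).
  by rewrite !big_split /= sumr_const card_ord -mulr_sumr -mulr_sumr mulNrn; ring.
apply: ler_sum => j _; apply: le_trans (lower_count_ge _ _ _).
rewrite lerD2r ler_wpM2l ?divr_ge0 ?(ltW h0) ?(ltW p0)//.
rewrite -[q%:R]ger0_norm// -sqrtr_sqr /residual_wave -sqrtrM ?sqr_ge0//.
rewrite le_eqVlt; apply/orP; left; apply/eqP; congr Num.sqrt.
by rewrite sqrtr_sqr ger0_norm//; ring.
Qed.

Lemma ereal_sandwich (x : \bar R) (a b w c : R) : (a%:E <= x)%E -> (x <= b%:E)%E ->
  w - c <= a -> b <= w + c -> (`| x - w%:E | <= c%:E)%E.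
Proof.
case: x => [x| |]; rewrite ?leye_eq ?leeNy_eq// !lee_fin => ax xb wa bw.
by rewrite ler_norml; apply/andP; split; lra.
Qed.

End Asymptotics.

Theorem mainTheorem1 (R : realType) (h mu : R) (h_gt0 : 0 < h) (mu_gt0 : 0 < mu) :
  exists C : R, \forall q \near \oo,
    (`| counting_function (interior (comb h q)) (mu * q%:R ^+ 2)
        - (weyl_const h mu * q%:R ^+ 2)%:E | <= (C * q%:R)%:E)%E.
Proof.
have p0 := pi_gt0 R; have sm0 : 0 < Num.sqrt mu by rewrite sqrtr_gt0.
(* d > 0 is the margin by which the first mode left out exceeds mu; the shift by 1
   in L = lam + 1 stays within it as soon as d q^2 >= 1. *)
pose L0 := tooth_modes mu; pose d := (2 * pi * L0.+1%:R) ^+ 2 - mu.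
have d0 : 0 < d by rewrite subr_gt0; exact: tooth_modes_out.
(* Errors of the square, from the shift of L, the boundary of the quarter disk and
   the rounding; and of each tooth, at most h / pi + 1 for each of its L0 modes. *)
pose C := 1 / (4 * pi) + (2 * Num.sqrt mu + 1) / pi + L0%:R * (h / pi + 1).
exists C; near=> q.
have q1 : 1 <= q%:R :> R by near: q; exact: nbhs_infty_ger.
have qd : d^-1 <= q%:R by near: q; exact: nbhs_infty_ger.
have q0 : (0 < q)%N by rewrite -(ltr_nat R); exact: lt_le_trans q1.
set lam := mu * q%:R ^+ 2; pose L := lam + 1.
have lam0 : 0 < lam by rewrite mulr_gt0// exprn_gt0// (lt_le_trans ltr01).
have Lp : 0 < L by rewrite ltr_wpDl// ltW.
have dq : 1 <= d * q%:R ^+ 2.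
  have h1 : 1 <= d * q%:R by rewrite mulrC -ler_pdivrMr// div1r.
  by apply: le_trans h1 _; rewrite ler_pM2l// expr2 ler_peMr// (le_trans ler01).
have [M [M1 M2 M3]] := square_upper Lp.
have [M' M'1] := square_lower lam0.
pose MM (p : option 'I_q) := if p is Some _ then L0 else M.
pose MM' (p : option 'I_q) := if p is Some _ then L0 else M'.
have wL p (j : 'I_(MM p)) : piece_wave p j.+1 ^+ 2 < L.
  case: p j => [i|] j; last by rewrite piece_wave_square; exact: M1.
  rewrite piece_wave_tooth// exprMn; have := tooth_modes_in j mu_gt0 => h1.
  by rewrite /L ltr_pwDr// /lam mulrC ler_wpM2r// sqr_ge0.
have Lw p : L <= piece_wave p (MM p).+1 ^+ 2.
  case: p => [i|]; last by rewrite piece_wave_square.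
  rewrite piece_wave_tooth// exprMn /L /lam.
  by move: dq; rewrite /d; lra.
have [lo up] := comb_bracket h_gt0 q0 MM' (ltW Lp) (ltr_pwDr ltr01 (lexx lam)) wL Lw.
pose nl := (\sum_p \sum_(j < MM' p) lower_count (piece_height h p) lam (piece_wave p j.+1))%N.
pose nu := (\sum_p \sum_(j < MM p) upper_count (piece_height h p) L (piece_wave p j.+1))%N.
pose S := h / pi * \sum_(j < L0) residual_wave mu j.+1.
have nlE : lam / (4 * pi) - 2 * (Num.sqrt lam / pi) + q%:R * (q%:R * S - L0%:R) <= nl%:R.
  rewrite /nl sum_option natrD; apply: lerD.
    apply: le_trans M'1 _; rewrite /= natr_sum le_eqVlt; apply/orP; left; apply/eqP.
    by apply: eq_bigr => j _; rewrite piece_wave_square.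
  rewrite natr_sum (eq_bigr (fun=> \sum_(j < L0) (lower_count h lam (q%:R * (2 * pi * j.+1%:R)))%:R)).
    by rewrite big_const_ord iter_addr addr0 -[leRHS]mulr_natl ler_wpM2l//; exact: tooth_lower.
  by move=> i _; rewrite natr_sum; apply: eq_bigr => j _; rewrite piece_wave_tooth.
have nuE : nu%:R <= L / (4 * pi) + Num.sqrt L / pi + q%:R * (q%:R * S + L0%:R * (h / pi + 1)).
  rewrite /nu sum_option natrD; apply: lerD.
    apply: le_trans M3; rewrite /= natr_sum le_eqVlt; apply/orP; left; apply/eqP.
    by apply: eq_bigr => j _; rewrite piece_wave_square.
  rewrite natr_sum (eq_bigr (fun=> \sum_(j < L0) (upper_count h L (q%:R * (2 * pi * j.+1%:R)))%:R)).
    by rewrite big_const_ord iter_addr addr0 -[leLHS]mulr_natl ler_wpM2l//; exact: tooth_upper.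
  by move=> i _; rewrite natr_sum; apply: eq_bigr => j _; rewrite piece_wave_tooth.
have smq : Num.sqrt lam = Num.sqrt mu * q%:R.
  by rewrite sqrtrM ?(ltW mu_gt0)// sqrtr_sqr ger0_norm.
have smL : Num.sqrt L <= Num.sqrt mu * q%:R + 1.
  rewrite -smq -[leRHS]ger0_norm ?addr_ge0 ?sqrtr_ge0// -sqrtr_sqr ler_sqrt ?sqr_ge0//.
  by rewrite sqrrD expr1n mulr1 sqr_sqrtr ?(ltW lam0)// /L; have := sqrtr_ge0 lam; lra.
have i4 x : x / (4 * pi) = x * pi^-1 / 4 :> R by rewrite invfM; ring.
have i0 : 0 <= pi^-1 :> R by rewrite invr_ge0 ltW.
have qi : pi^-1 <= q%:R * pi^-1 :> R by rewrite ler_peMl.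
have nq : 0 <= L0%:R * h * pi^-1 * q%:R by rewrite !mulr_ge0// ltW.
have CE : C * q%:R = q%:R * pi^-1 / 4 + 2 * (Num.sqrt mu * q%:R * pi^-1) + q%:R * pi^-1
    + L0%:R * h * pi^-1 * q%:R + L0%:R * q%:R by rewrite /C i4; ring.
have wE : weyl_const h mu * q%:R ^+ 2 = lam * pi^-1 / 4 + q%:R ^+ 2 * S.
  by rewrite weyl_constE// i4 /lam -/S; ring.
apply: (ereal_sandwich lo up).
- by apply: le_trans nlE; rewrite CE wE i4 smq; lra.
- apply: (le_trans nuE); rewrite CE wE i4.
  have : Num.sqrt L * pi^-1 <= (Num.sqrt mu * q%:R + 1) * pi^-1 by rewrite ler_wpM2r.
  have : 0 <= Num.sqrt mu * q%:R * pi^-1 by rewrite !mulr_ge0// ltW.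
  rewrite /L; lra.
Unshelve. all: by end_near. Qed.
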